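(* Let $G(z)$ be the Barnes $G$-function. As $z\to+\infty$, the formal series $V_n(z)$ below are the asymptotic expansions of the following functions: $$\begin{aligned}V_0(z)&\sim\log G(z+1)-\Big(\zeta'(-1)+\frac z2\log(2\pi)+\Big(\frac{z^2}2-\frac1{12}\Big)\log z-\frac{3z^2}4\Big),\\ V_1(z)&\sim\frac{d}{dz}\log G(z+1)-\frac12\log(2\pi)-z\log z+z,\\ V_2(z)&\sim\frac{d^2}{dz^2}\log G(z+1)-\log z,\\ V_n(z)&\sim\frac{d^n}{dz^n}\log G(z+1)\qquad\text{for all }n\ge3.\end{aligned}$$
   Context: For $2g-2+n>0$, $\chi(\mathcal M_{g,n})=(-1)^n\frac{(2g-1)B_{2g}}{(2g)!}(2g+n-3)!$ is the orbifold Euler characteristic of the moduli space $\mathcal M_{g,n}$ of smooth genus $g$ curves with $n$ marked points (Harer–Zagier formula; $B_{2g}$ Bernoulli numbers). Define formal series in $z^{-1}$ (finitely many nonnegative powers of $z$ do not occur): $$V_0(z):=\sum_{g\ge2}\chi(\mathcal M_{g,0})z^{2-2g},\quad V_n(z):=\sum_{g\ge1}\chi(\mathcal M_{g,n})z^{2-2g-n}\ (n=1,2),\quad V_n(z):=\sum_{g\ge0}\chi(\mathcal M_{g,n})z^{2-2g-n}\ (n\ge3).$$ Their radius of convergence is zero; $V\sim f$ means that the formal series $V$ is the asymptotic (Poincaré) expansion of the function $f$ as $z\to+\infty$. The Barnes $G$-function is $G(z+1)=(2\pi)^{z/2}e^{-z(z+1)/2-\gamma z^2/2}\prod_{n\ge1}\big\{(1+\frac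 zn)^ne^{-z+z^2/(2n)}\big\}$, with $\gamma$ the Euler–Mascheroni constant; $\zeta$ is the Riemann zeta function. *)

(* Defs.v *)
From Stdlib Require Import Reals Lra Lia Arith.
From Coquelicot Require Import Coquelicot.
Open Scope R_scope.

(** ** Bernoulli numbers, with [B_1 = -1/2] *)

(* [bernoulli_upto n k] is [B_k] for [k <= n], computed from
   [(n+2) B_{n+1} = - sum_(j <= n) binom(n+2, j) B_j].
   [Binomial.C] is the binomial coefficient; plain [C] is the type of complex
   numbers. *)
Fixpoint bernoulli_upto (n : nat) : nat -> R :=
  match n with
  | O => fun _ => 1
  | S m => fun k =>
      if (k <=? m)%nat then bernoulli_upto m k
      else - sum_f_R0 (fun j => Binomial.C (m + 2) j * bernoulli_upto m j) m
           / INR (m + 2)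
  end.

Definition bernoulli (n : nat) : R := bernoulli_upto n n.

Lemma bernoulli_uptoE (n k : nat) :
  (k <= n)%nat -> bernoulli_upto n k = bernoulli k.
Proof.
  induction n as [|n IH]; intros Hk.
  - now replace k with 0%nat by lia.
  - destruct (Nat.eq_dec k (S n)) as [->|Hne]; [reflexivity|].
    simpl. rewrite (proj2 (Nat.leb_le k n)) by lia. apply IH; lia.
Qed.

Lemma bernoulli_0 : bernoulli 0 = 1.
Proof. reflexivity. Qed.

Lemma bernoulli_rec (n : nat) :
  sum_f_R0 (fun j => Binomial.C (n + 2) j * bernoulli j) (S n) = 0.
Proof.
  assert (Hn : INR (n + 2) <> 0) by (apply not_0_INR; lia).
  assert (HS : bernoulli (S n) =
    - sum_f_R0 (fun j => Binomial.C (n + 2) j * bernoulli j) n / INR (n + 2)).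
  { unfold bernoulli at 1. cbn [bernoulli_upto].
    rewrite (proj2 (Nat.leb_gt (S n) n)) by lia.
    f_equal. f_equal. apply sum_eq. intros j Hj. now rewrite bernoulli_uptoE. }
  assert (HC : Binomial.C (n + 2) (S n) = INR (n + 2)).
  { replace (n + 2)%nat with (S (S n)) by lia.
    unfold Binomial.C. replace (S (S n) - S n)%nat with 1%nat by lia.
    rewrite (fact_simpl (S n)), mult_INR. simpl (fact 1). simpl (INR 1).
    field. apply not_0_INR, fact_neq_0. }
  rewrite tech5, HS, HC. now field.
Qed.

(** ** Orbifold Euler characteristics and the series [V_n] *)

(* The Harer-Zagier value of the Euler characteristic of [M_{g,n}]; meaningful
   for [2g - 2 + n > 0], where the truncated subtraction is exact. *)
Definition chi (g n : nat) : R :=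
  (-1) ^ n * ((2 * INR g - 1) * bernoulli (2 * g) / INR (fact (2 * g)))
  * INR (fact (2 * g + n - 3)).

Definition gmin (n : nat) : nat :=
  match n with
  | 0 => 2
  | 1 | 2 => 1
  | _ => 0
  end%nat.

(* A formal series in [z^{-1}] is its coefficient sequence: [a k] is the
   coefficient of [z^{-k}].  [V n] is the sum over [g >= gmin n] of
   [chi g n * z^{2-2g-n}]; the exponent [2-2g-n] is [-k] iff [2g+n = k+2],
   which forces [g <= k+2]. *)
Definition V (n k : nat) : R :=
  sum_n_m (fun g => if (2 * g + n =? k + 2)%nat then chi g n else 0)
          (gmin n) (k + 2).

(* Poincare expansion as [z -> +oo]: for each [N], the remainder after the
   terms up to [z^{-N}] is [o(z^{-N})]. *)
Definition asymptotic_expansion (a : nat -> R) (f : R -> R) : Prop :=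
  forall N : nat,
    is_lim (fun z => z ^ N * (f z - sum_f_R0 (fun k => a k / z ^ k) N))
           p_infty 0.

(** ** The Barnes G-function on the real line *)

Definition euler_gamma : R :=
  real (Lim_seq (fun N => sum_f_R0 (fun k => / INR (S k)) N - ln (INR (S N)))).

Definition barnes_factor (z : R) (n : nat) : R :=
  (1 + z / INR n) ^ n * exp (- z + z ^ 2 / (2 * INR n)).

Definition barnesG_succ (z : R) : R :=
  Rpower (2 * PI) (z / 2)
  * exp (- (z * (z + 1)) / 2 - euler_gamma * z ^ 2 / 2)
  * real (Lim_seq (fun N => prod_f_R0 (fun k => barnes_factor z (S k)) N)).

Definition barnesG (x : R) : R := barnesG_succ (x - 1).

Definition logG_succ (z : R) : R := ln (barnesG (z + 1)).

(** ** The Riemann zeta function *)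

Definition Cexp (z : C) : C :=
  (exp (Re z) * cos (Im z), exp (Re z) * sin (Im z)).

Definition analytic_at (f : C -> C) (s0 : C) : Prop :=
  exists (a : nat -> C) (r : R), 0 < r /\
    forall s : C, Cmod (s - s0) < r ->
      is_pseries (K := C_AbsRing) (V := C_NormedModule) a (s - s0)%C (f s).

(* The analytic continuation to [C \ {1}] of the Dirichlet series
   [sum_(n >= 1) n^{-s}], [Re s > 1].  It determines [f] away from [1]. *)
Definition is_riemann_zeta (f : C -> C) : Prop :=
  (forall s : C, 1 < Re s ->
     is_series (K := C_AbsRing) (V := C_NormedModule)
       (fun k => Cexp (- (s * RtoC (ln (INR (S k)))))%C) (f s)) /\
  (forall s : C, s <> RtoC 1 -> analytic_at f s).

(* Main.v *)
Require Import Defs.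
From Stdlib Require Import Reals Lra Lia Arith.
From Coquelicot Require Import Coquelicot.
Open Scope R_scope.

(** Write [L z] for [log G(z+1)]. Taking logarithms in the product,
    [L z = z/2 log(2 pi) - z(z+1)/2 - gamma z^2/2
           + sum_n (n log(1 + z/n) - z + z^2/(2n))],
    which may be differentiated termwise; from the third derivative on, the
    polynomial part is gone and, for [n >= 3],
    [L^(n) z = (-1)^(n-1) (n-1)! sum_k k/(k+z)^n].
    Since [k = (k+z) - z], this sum is a combination of the polygamma sums
    [T_m z = sum_k (k+z)^(-m)], so the case [n >= 3] follows from the classical
    expansion of [T_m]. The latter is obtained from the difference equation
    [T_m (z-1) - T_m z = z^(-m)]: the recursion of the Bernoulli numbers says
    that the expected polynomial in [1/z] satisfies this equation up to a high
    power of [1/z] ([polygamma_approx_difference]), and summing the error over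
    [z + 1, z + 2, ...] gives the expansion. The term of index [j] carries the
    factor [(j - 1) B_j], which is zero for odd [j] ([bernoulli_odd]); this is why
    only the terms [j = 2g] indexed by a genus [g] appear.

    The coefficients satisfy [V_(n+1) = V_n'] up to the terms in [1/z] that the
    logarithms produce ([V_derivative]), so the cases [n = 2, 1, 0] follow by
    integrating three times from [+oo] ([expands_integrate]). Each integration
    leaves one constant, which is found along the integers, where everything
    is explicit:
    - for [n = 2], [sum_k (1/k - 1/(k+N))] is the harmonic number [H_N], and
      [H_N - log N] tends to [gamma];
    - for [n = 1], the next term [1/(2N)] of the harmonic numbers is used;
    - for [n = 0], [G(N+2) = N! G(N+1)] ([logG_increment], where Stirling's
      constant [log(2 pi)/2] enters through Wallis' product) gives
      [L N = N log N! - sum_(k <= N) k log k], and the constant in the expansion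
      of the last sum is [1/4 - P/6] with
      [P = sum_k int_0^1 B_3(y) (k+y)^(-2) dy].

    It remains to see that [zeta'(-1) = -1/6 + P/6] ([zeta_derivative]). By the
    Euler-Maclaurin formula, for [Re s > 1],
    [zeta s = 1/(s-1) + 1/2 + s/12 - s(s+1)(s+2)/6 Psi s],
    [Psi s = sum_k int_0^1 B_3(y) (k+y)^(-s-3) dy].
    The function [Psi] is analytic for [Re s > -2] ([taylor_Psi]), so the
    identity theorem along a segment from [2 + i] to [-1], which avoids the pole,
    extends this formula to a neighbourhood of [-1]. There the factor [s+1]
    vanishes, and the derivative only involves the value [P = Psi(-1)]. *)

(** * Finite sums and the Bernoulli numbers *)

Lemma sum_triangle (F : nat -> nat -> R) (n : nat) :
  sum_f_R0 (fun i => sum_f_R0 (F i) (n - i)) n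
  = sum_f_R0 (fun q => sum_f_R0 (fun i => F i (q - i)%nat) q) n.
Proof.
  induction n as [|n IH]; [reflexivity|].
  rewrite 2!tech5, <- IH, (tech5 (fun i => F i (S n - i)%nat)).
  replace (S n - S n)%nat with 0%nat by lia; simpl (sum_f_R0 _ 0).
  rewrite <- Rplus_assoc. f_equal.
  rewrite <- plus_sum. apply sum_eq. intros i Hi.
  replace (S n - i)%nat with (S (n - i)) by lia. now rewrite tech5.
Qed.

Lemma sum_last (u : nat -> R) (n : nat) :
  (forall j, (j < n)%nat -> u j = 0) -> sum_f_R0 u n = u n.
Proof.
  intros Hu. destruct n as [|n]; [reflexivity|].
  rewrite tech5, (sum_eq _ (fun _ => 0)), sum_cte; [ring|].
  intros j Hj; apply Hu; lia.
Qed.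

Lemma binomial_trinomial (n i l : nat) : (i + l <= n)%nat ->
  Binomial.C n (i + l) * Binomial.C (i + l) i
  = Binomial.C n i * Binomial.C (n - i) l.
Proof.
  intros H. unfold Binomial.C.
  replace (i + l - i)%nat with l by lia.
  replace (n - i - l)%nat with (n - (i + l))%nat by lia.
  field. repeat split; apply INR_fact_neq_0.
Qed.

Lemma binomial_diag (n : nat) : Binomial.C n n = 1.
Proof.
  unfold Binomial.C. rewrite Nat.sub_diag. simpl. field. apply INR_fact_neq_0.
Qed.

Definition delta1 (n : nat) : R := if (n =? 1)%nat then 1 else 0.

Lemma bernoulli_binomial_sum (n : nat) :
  sum_f_R0 (fun j => Binomial.C n j * bernoulli j) n = bernoulli n + delta1 n.
Proof.
  destruct n as [|[|n]].
  - unfold Binomial.C, delta1. simpl. rewrite bernoulli_0. field.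
  - rewrite tech5. simpl (sum_f_R0 _ 0).
    rewrite bernoulli_0. unfold Binomial.C, delta1.
    change (fact 0) with 1%nat. change (fact 1) with 1%nat. simpl. field.
  - rewrite tech5.
    assert (H := bernoulli_rec n).
    replace (n + 2)%nat with (S (S n)) in H by lia. rewrite H.
    unfold delta1; simpl (S (S n) =? 1)%nat. cbv iota.
    rewrite binomial_diag; ring.
Qed.

Lemma alternating_binomial_sum (n : nat) :
  sum_f_R0 (fun l => Binomial.C n l * (-1) ^ l) n = if (n =? 0)%nat then 1 else 0.
Proof.
  assert (H := binomial (-1) 1 n).
  replace (-1 + 1) with 0 in H by ring.
  rewrite (sum_eq _ (fun i => Binomial.C n i * (-1) ^ i * 1 ^ (n - i))), <- H.
  - destruct n; simpl; ring.
  - intros i _. rewrite pow1; ring.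
Qed.

Lemma sum_delta1 (u : nat -> R) (n : nat) :
  sum_f_R0 (fun j => u j * delta1 j) (S n) = u 1%nat.
Proof.
  induction n as [|n IH]; [unfold delta1; simpl; ring|].
  rewrite tech5, IH. unfold delta1; simpl; ring.
Qed.

Lemma binomial_1 (n : nat) : Binomial.C (S n) 1 = INR (S n).
Proof.
  unfold Binomial.C. rewrite Nat.sub_succ, Nat.sub_0_r, fact_simpl, mult_INR.
  change (fact 1) with 1%nat. simpl (INR 1). field. apply INR_fact_neq_0.
Qed.

(** Pascal inversion: apply the recursion to each [B_j], exchange the sums, and
    use that [sum_l binom(m, l) (-1)^l] vanishes for [m > 0]. Up to the values at
    index 1, [(-1)^n B_n] thus obeys the recursion that determines [B_n]. *)
Lemma bernoulli_signed_binomial_sum (n : nat) :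
  sum_f_R0 (fun j => Binomial.C n j * ((-1) ^ j * bernoulli j)) n
  = (-1) ^ n * bernoulli n + INR n.
Proof.
  transitivity (sum_f_R0 (fun j => sum_f_R0 (fun i =>
      Binomial.C n j * (-1) ^ j * (Binomial.C j i * bernoulli i)) j) n
    - sum_f_R0 (fun j => Binomial.C n j * (-1) ^ j * delta1 j) n).
  { rewrite <- minus_sum. apply sum_eq. intros j _.
    rewrite (sum_eq _ (fun i => Binomial.C j i * bernoulli i * (Binomial.C n j * (-1) ^ j)))
      by (intros; ring).
    rewrite <- scal_sum, bernoulli_binomial_sum. ring. }
  assert (H1 : sum_f_R0 (fun j => Binomial.C n j * (-1) ^ j * delta1 j) n = - INR n).
  { destruct n as [|n]; [unfold delta1; simpl; ring|].
    rewrite sum_delta1, binomial_1. ring. }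
  rewrite H1.
  assert (H2 := sum_triangle (fun i l => Binomial.C n (i + l) * (-1) ^ (i + l)
     * (Binomial.C (i + l) i * bernoulli i)) n).
  assert (H3 : forall q, (q <= n)%nat ->
     sum_f_R0 (fun i => Binomial.C n (i + (q - i)) * (-1) ^ (i + (q - i))
     * (Binomial.C (i + (q - i)) i * bernoulli i)) q
     = sum_f_R0 (fun i => Binomial.C n q * (-1) ^ q * (Binomial.C q i * bernoulli i)) q).
  { intros q _. apply sum_eq. intros i Hi. now replace (i + (q - i))%nat with q by lia. }
  rewrite <- (sum_eq _ _ n H3), <- H2, sum_last.
  - rewrite Nat.sub_diag; simpl (sum_f_R0 _ 0). rewrite Nat.add_0_r.
    rewrite !binomial_diag; ring.
  - intros j Hj.
    rewrite (sum_eq _ (fun l => Binomial.C (n - j) l * (-1) ^ l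
                        * (Binomial.C n j * (-1) ^ j * bernoulli j))).
    + rewrite <- scal_sum, alternating_binomial_sum.
      rewrite (proj2 (Nat.eqb_neq (n - j) 0)) by lia. ring.
    + intros l Hl.
      transitivity (Binomial.C n (j + l) * Binomial.C (j + l) j * (-1) ^ (j + l) * bernoulli j);
        [ring|].
      rewrite binomial_trinomial by lia. rewrite pow_add; ring.
Qed.

(** The difference of the two sides satisfies the homogeneous Bernoulli
    recursion, whose only solution is zero. *)
Lemma bernoulli_reflection (n : nat) :
  (-1) ^ n * bernoulli n = bernoulli n + delta1 n.
Proof.
  set (e := fun j => (-1) ^ j * bernoulli j - delta1 j - bernoulli j).
  assert (He : forall n, sum_f_R0 (fun j => Binomial.C (S n) j * e j) n = 0).
  { intros m.
    assert (H : sum_f_R0 (fun j => Binomial.C (S m) j * e j) (S m) = e (S m)).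
    { rewrite (sum_eq _ (fun j => Binomial.C (S m) j * ((-1) ^ j * bernoulli j)
          - (Binomial.C (S m) j * delta1 j + Binomial.C (S m) j * bernoulli j)))
        by (intros; unfold e; ring).
      rewrite minus_sum, plus_sum, bernoulli_binomial_sum, bernoulli_signed_binomial_sum.
      replace (sum_f_R0 (fun j => Binomial.C (S m) j * delta1 j) (S m)) with (INR (S m)).
      - unfold e; ring.
      - now rewrite sum_delta1, binomial_1. }
    rewrite tech5 in H.
    rewrite binomial_diag in H; lra. }
  assert (H0 : forall n, e n = 0).
  { intros m. induction m as [m IH] using lt_wf_ind.
    assert (H := He m). rewrite sum_last in H.
    - apply Rmult_integral in H. destruct H as [H|H]; [exfalso|exact H].
      unfold Binomial.C in H.
      apply Rmult_integral in H. destruct H as [H|H]; [now apply INR_fact_neq_0 in H|].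
      apply Rinv_neq_0_compat in H; [easy|].
      apply Rmult_integral_contrapositive; split; apply INR_fact_neq_0.
    - intros j Hj. rewrite IH by easy. ring. }
  specialize (H0 n). unfold e in H0. lra.
Qed.

Lemma bernoulli_odd (n : nat) : Nat.odd n = true -> n <> 1%nat -> bernoulli n = 0.
Proof.
  intros Ho Hn. assert (H := bernoulli_reflection n).
  apply Nat.odd_spec in Ho. destruct Ho as [k ->].
  unfold delta1 in H. rewrite (proj2 (Nat.eqb_neq _ 1) Hn) in H.
  rewrite pow_add, pow_mult in H. replace ((-1) ^ 2) with 1 in H by ring.
  rewrite pow1, pow_1 in H. lra.
Qed.

(** * Expansions in powers of 1/z *)

(** A quantitative Poincare expansion. With [O(z^(-N-1))] errors in place of
    [o(z^(-N))] it can be integrated term by term. The threshold [2] is where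
    [1/(z-1)] is a convergent series in [1/z] of ratio at most [1/2]; keeping it
    fixed makes the constants the only existential data. *)
Definition expands (a : nat -> R) (f : R -> R) : Prop :=
  forall N : nat, exists K : R, forall z : R, 2 <= z ->
    Rabs (f z - sum_f_R0 (fun k => a k / z ^ k) N) <= K / z ^ S N.

Lemma expands_ext (a b : nat -> R) (f g : R -> R) :
  (forall k, a k = b k) -> (forall z, 2 <= z -> f z = g z) ->
  expands a f -> expands b g.
Proof.
  intros Hab Hfg Hf N. destruct (Hf N) as [K HK]. exists K. intros z Hz.
  rewrite <- Hfg by easy.
  rewrite <- (sum_eq (fun k => a k / z ^ k)); [now apply HK|].
  intros i _. now rewrite Hab.
Qed.

Lemma pow_div_le (z : R) (n m : nat) : 1 <= z -> (n <= m)%nat -> / z ^ m <= / z ^ n.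
Proof.
  intros Hz Hn. apply Rinv_le_contravar; [apply pow_lt; lra|]. now apply Rle_pow.
Qed.

(** Cutting an expansion shorter costs nothing: the dropped terms are of the
    order of the allowed error. This lets the proofs below be generous with the
    number of terms. *)
Lemma expands_of_longer (a : nat -> R) (f : R -> R) :
  (forall N, exists M K, (N <= M)%nat /\ forall z, 2 <= z ->
     Rabs (f z - sum_f_R0 (fun k => a k / z ^ k) M) <= K / z ^ S N) ->
  expands a f.
Proof.
  intros H N. destruct (H N) as (M & K & HM & HK).
  assert (Htail : exists K', forall z, 2 <= z ->
    Rabs (sum_f_R0 (fun k => a k / z ^ k) M - sum_f_R0 (fun k => a k / z ^ k) N) <= K' / z ^ S N).
  { clear HK. induction HM as [|M HM [K' IH]].
    - exists 0. intros z Hz. rewrite Rminus_diag, Rabs_R0. unfold Rdiv; lra.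
    - exists (K' + Rabs (a (S M))). intros z Hz.
      assert (Hz0 : 0 < z) by lra.
      rewrite tech5, Rplus_comm. unfold Rminus at 1. rewrite Rplus_assoc.
      eapply Rle_trans; [apply Rabs_triang|].
      rewrite Rdiv_plus_distr, Rplus_comm. apply Rplus_le_compat.
      + now apply IH.
      + unfold Rdiv. rewrite Rabs_mult, (Rabs_right (/ _)).
        * apply Rmult_le_compat_l; [apply Rabs_pos|]. apply pow_div_le; [lra|lia].
        * apply Rle_ge, Rlt_le, Rinv_0_lt_compat, pow_lt; lra. }
  destruct Htail as [K' HK']. exists (K + K'). intros z Hz.
  replace (f z - _) with ((f z - sum_f_R0 (fun k => a k / z ^ k) M)
    + (sum_f_R0 (fun k => a k / z ^ k) M - sum_f_R0 (fun k => a k / z ^ k) N)) by ring.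
  eapply Rle_trans; [apply Rabs_triang|].
  rewrite Rdiv_plus_distr. apply Rplus_le_compat; auto.
Qed.

Lemma expands_lincomb (c d : R) (a b : nat -> R) (f g : R -> R) :
  expands a f -> expands b g ->
  expands (fun k => c * a k + d * b k) (fun z => c * f z + d * g z).
Proof.
  intros Hf Hg N. destruct (Hf N) as [K HK], (Hg N) as [K' HK'].
  exists (Rabs c * K + Rabs d * K'). intros z Hz.
  assert (Hz0 : 0 < z) by lra.
  rewrite (sum_eq _ (fun k => a k / z ^ k * c + b k / z ^ k * d))
    by (intros; unfold Rdiv; ring).
  rewrite plus_sum, <- 2!scal_sum.
  replace (_ - _) with (c * (f z - sum_f_R0 (fun k => a k / z ^ k) N)
     + d * (g z - sum_f_R0 (fun k => b k / z ^ k) N)) by ring.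
  eapply Rle_trans; [apply Rabs_triang|]. rewrite 2!Rabs_mult.
  unfold Rdiv. rewrite Rmult_plus_distr_r, 2!Rmult_assoc.
  apply Rplus_le_compat; apply Rmult_le_compat_l; try apply Rabs_pos; auto.
Qed.

Lemma sum_shift (u : nat -> R) (n : nat) :
  sum_f_R0 u (S n) = u 0%nat + sum_f_R0 (fun k => u (S k)) n.
Proof. rewrite decomp_sum by lia. reflexivity. Qed.

Lemma expands_mul_z (a : nat -> R) (f : R -> R) : a 0%nat = 0 -> expands a f ->
  expands (fun k => a (S k)) (fun z => z * f z).
Proof.
  intros Ha Hf N. destruct (Hf (S N)) as [K HK]. exists K. intros z Hz.
  assert (Hz0 : z <> 0) by lra.
  assert (Hzp : 0 < z) by lra.
  specialize (HK z Hz). rewrite sum_shift, Ha in HK.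
  replace (z * f z - _) with (z * (f z - (0 / z ^ 0 + sum_f_R0 (fun k => a (S k) / z ^ S k) N))).
  - rewrite Rabs_mult, Rabs_right by lra.
    replace (K / z ^ S N) with (z * (K / z ^ S (S N)))
      by (simpl; field; split; [now apply pow_nonzero|easy]).
    apply Rmult_le_compat_l; lra.
  - rewrite Rmult_minus_distr_l, Rmult_plus_distr_l, scal_sum.
    unfold Rdiv at 1. rewrite Rmult_0_l, Rmult_0_r, Rplus_0_l. f_equal.
    apply sum_eq. intros i _. simpl. field. split; [now apply pow_nonzero|easy].
Qed.

Lemma expands_inv : expands delta1 (fun z => / z).
Proof.
  apply expands_of_longer. intros N. exists (S N), 0. split; [lia|]. intros z Hz.
  rewrite (sum_eq _ (fun k => / z ^ k * delta1 k)) by (intros; unfold Rdiv; ring).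
  rewrite sum_delta1, pow_1, Rminus_diag, Rabs_R0. unfold Rdiv; lra.
Qed.

Lemma is_lim_inv_pow (n : nat) : is_lim (fun z => / z ^ S n) p_infty 0.
Proof.
  apply (is_lim_ext (fun z => (/ z) ^ S n)); [intros; apply pow_inv|].
  induction n as [|n IH].
  - apply (is_lim_ext (fun z => / z)); [intros; simpl; ring|].
    replace (Finite 0) with (Rbar_inv p_infty) by reflexivity.
    apply is_lim_inv; [apply is_lim_id|easy].
  - apply (is_lim_ext (fun z => / z * (/ z) ^ S n)); [intros; reflexivity|].
    replace (Finite 0) with (Rbar_mult 0 0) by (simpl; f_equal; ring).
    apply is_lim_mult; [|exact IH|easy].
    replace (Finite 0) with (Rbar_inv p_infty) by reflexivity.
    apply is_lim_inv; [apply is_lim_id|easy].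
Qed.

Lemma expands_asymptotic (a : nat -> R) (f : R -> R) :
  expands a f -> asymptotic_expansion a f.
Proof.
  intros Hf N. destruct (Hf N) as [K HK].
  apply (is_lim_le_le_loc (fun z => - K * / z ^ 1) (fun z => K * / z ^ 1)).
  - exists 2. intros z Hz. assert (Hz2 : 2 <= z) by lra.
    specialize (HK z Hz2). apply Rabs_le_between in HK.
    assert (Hp : 0 < z ^ N) by (apply pow_lt; lra).
    assert (HE : z ^ N * (K / z ^ S N) = K * / z ^ 1) by (simpl; field; lra).
    split.
    + replace (- K * / z ^ 1) with (z ^ N * - (K / z ^ S N)) by (rewrite Ropp_mult_distr_r_reverse, HE; ring).
      apply Rmult_le_compat_l; lra.
    + rewrite <- HE. apply Rmult_le_compat_l; lra.
  - replace (Finite 0) with (Rbar_mult (- K) 0) by (simpl; f_equal; ring).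
    apply is_lim_scal_l, is_lim_inv_pow.
  - replace (Finite 0) with (Rbar_mult K 0) by (simpl; f_equal; ring).
    apply is_lim_scal_l, is_lim_inv_pow.
Qed.

(** * The polygamma sums *)

(** Induction on the exponent: multiplying by [1 - u] lowers the exponent by one
    and, by Pascal's rule, turns the truncated series into the lower one up to
    one monomial. *)
Lemma neg_binomial_remainder (r I : nat) : exists K, 0 <= K /\
  forall u, 0 <= u <= 1 / 2 ->
  Rabs ((/ (1 - u)) ^ S r - sum_f_R0 (fun i => Binomial.C (r + i) i * u ^ i) I)
  <= K * u ^ S I.
Proof.
  assert (Hstep : forall (x K u : R), 0 <= u <= 1 / 2 -> 0 <= K ->
    Rabs ((1 - u) * x) <= K * u ^ S I -> Rabs x <= 2 * K * u ^ S I).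
  { intros x K u Hu HK H. rewrite Rabs_mult, Rabs_right in H by lra.
    assert (0 <= Rabs x) by apply Rabs_pos. nra. }
  induction r as [|r [K [HK0 HK]]].
  - exists (2 * 1). split; [lra|]. intros u Hu.
    apply Hstep; [easy|lra|].
    rewrite (sum_eq _ (fun i => u ^ i)).
    + rewrite tech3 by lra.
      replace ((1 - u) * _) with (u ^ S I) by (field; lra).
      rewrite Rabs_right; [lra|]. apply Rle_ge, pow_le; lra.
    + intros i _. simpl Nat.add. rewrite binomial_diag; ring.
  - exists (2 * (K + Rabs (Binomial.C (S r + I) I))).
    assert (HB := Rabs_pos (Binomial.C (S r + I) I)). split; [lra|].
    intros u Hu. apply Hstep; [easy|lra|].
    assert (HS : (1 - u) * sum_f_R0 (fun i => Binomial.C (S r + i) i * u ^ i) I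
      = sum_f_R0 (fun i => Binomial.C (r + i) i * u ^ i) I
        - Binomial.C (S r + I) I * u ^ S I).
    { clear -Hu. induction I as [|I IH].
      - simpl. rewrite !Nat.add_0_r. unfold Binomial.C. rewrite !Nat.sub_0_r.
        change (fact 0) with 1%nat. simpl (INR 1). field. split; apply INR_fact_neq_0.
      - rewrite 2!tech5, Rmult_plus_distr_l, IH.
        assert (HP : Binomial.C (S r + S I) (S I)
           = Binomial.C (r + S I) (S I) + Binomial.C (S r + I) I).
        { replace (S r + S I)%nat with (S (S r + I)) by lia.
          replace (r + S I)%nat with (S r + I)%nat by lia.
          rewrite <- pascal by lia. ring. }
        rewrite HP. simpl pow. ring. }
    rewrite Rmult_minus_distr_l, HS.
    replace ((1 - u) * (/ (1 - u)) ^ S (S r)) with ((/ (1 - u)) ^ S r) by (simpl; field; lra).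
    replace (_ - (_ - _)) with (((/ (1 - u)) ^ S r - sum_f_R0 (fun i => Binomial.C (r + i) i * u ^ i) I)
       + Binomial.C (S r + I) I * u ^ S I) by ring.
    eapply Rle_trans; [apply Rabs_triang|].
    rewrite Rmult_plus_distr_r. apply Rplus_le_compat; [now apply HK|].
    rewrite Rabs_mult, (Rabs_right (u ^ S I)); [lra|]. apply Rle_ge, pow_le; lra.
Qed.

(** The coefficient of [z^(-(r+1+j))] in the expansion of
    [sum_n (n+z)^(-(r+2))]; the exponent is shifted by 2 so that the sum
    converges and no truncated subtraction occurs. *)
Definition polygamma_coef (r j : nat) : R :=
  bernoulli j * INR (fact (r + j)) / (INR (fact j) * INR (fact (r + 1))).

Definition polygamma_approx (r J : nat) (z : R) : R :=
  sum_f_R0 (fun j => polygamma_coef r j / z ^ (r + 1 + j)) J.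

Lemma polygamma_coef_binomial (r j i : nat) :
  polygamma_coef r j * Binomial.C (r + j + i) i
  = Binomial.C (j + i) j * bernoulli j
    * (INR (fact (r + (j + i))) / (INR (fact (j + i)) * INR (fact (r + 1)))).
Proof.
  unfold polygamma_coef, Binomial.C.
  replace (r + j + i - i)%nat with (r + j)%nat by lia.
  replace (j + i - j)%nat with i by lia.
  rewrite Nat.add_assoc. field. repeat split; apply INR_fact_neq_0.
Qed.

Lemma uniform_bound_sum (F G : nat -> R -> R) (e : R -> R) (P : R -> Prop) (n : nat) :
  (forall j, (j <= n)%nat -> exists K, 0 <= K /\
     forall z, P z -> Rabs (F j z - G j z) <= K * e z) ->
  exists K, 0 <= K /\ forall z, P z ->
    Rabs (sum_f_R0 (fun j => F j z) n - sum_f_R0 (fun j => G j z) n) <= K * e z.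
Proof.
  induction n as [|n IH]; intros H; [now apply (H 0%nat)|].
  destruct IH as [K [HK0 HK]]; [intros j Hj; apply H; lia|].
  destruct (H (S n)) as [K' [HK0' HK']]; [lia|].
  exists (K + K'). split; [lra|]. intros z Hz. rewrite 2!tech5.
  replace (_ - _) with ((sum_f_R0 (fun j => F j z) n - sum_f_R0 (fun j => G j z) n)
    + (F (S n) z - G (S n) z)) by ring.
  eapply Rle_trans; [apply Rabs_triang|]. rewrite Rmult_plus_distr_r.
  apply Rplus_le_compat; auto.
Qed.

(** [z^(-(r+2))] is the value at [z - 1] minus the value at [z] of the sum that
    is being expanded. Expanding the powers of [z - 1] by the binomial series and
    collecting the terms of equal degree gives the Bernoulli sums
    [sum_(j <= q) binom(q, j) B_j], which differ from [B_q] only for [q = 1]. *)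
Lemma polygamma_approx_difference (r J : nat) : (1 <= J)%nat -> exists K, 0 <= K /\
  forall z, 2 <= z ->
  Rabs (polygamma_approx r J (z - 1) - polygamma_approx r J z - / z ^ (r + 2)) <= K / z ^ (r + J + 2).
Proof.
  intros HJ.
  assert (HK : exists K, 0 <= K /\ forall z, 2 <= z ->
    Rabs (polygamma_approx r J (z - 1) - sum_f_R0 (fun j =>
       sum_f_R0 (fun i => polygamma_coef r j * Binomial.C (r + j + i) i / z ^ (r + 1 + (j + i))) (J - j)) J)
      <= K * / z ^ (r + J + 2)).
    (* The [j]-th power is expanded to order [J - j], so that all the errors
       have the same degree. *)
    { unfold polygamma_approx. apply (uniform_bound_sum (fun j z => polygamma_coef r j / (z - 1) ^ (r + 1 + j))).
      intros j Hj. destruct (neg_binomial_remainder (r + j) (J - j)) as [K [HK0 HK]].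
      exists (Rabs (polygamma_coef r j) * K). split; [apply Rmult_le_pos; [apply Rabs_pos|easy]|].
      intros z Hz.
      assert (Hu : 0 <= / z <= 1 / 2).
      { split; [apply Rlt_le, Rinv_0_lt_compat; lra|].
        replace (1 / 2) with (/ 2) by field. apply Rinv_le_contravar; lra. }
      specialize (HK (/ z) Hu).
      replace (_ - _) with (polygamma_coef r j * (/ z) ^ (r + 1 + j) *
        ((/ (1 - / z)) ^ S (r + j) - sum_f_R0 (fun i => Binomial.C (r + j + i) i * (/ z) ^ i) (J - j))).
      - rewrite 2!Rabs_mult, (Rabs_right ((/ z) ^ _)) by (apply Rle_ge, pow_le; lra).
        rewrite !Rmult_assoc. apply Rmult_le_compat_l; [apply Rabs_pos|].
        replace (K * / z ^ (r + J + 2)) with ((/ z) ^ (r + 1 + j) * (K * (/ z) ^ S (J - j))).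
        + apply Rmult_le_compat_l; [apply pow_le; lra|exact HK].
        + replace (r + J + 2)%nat with (r + 1 + j + S (J - j))%nat by lia.
          rewrite <- pow_inv, (pow_add (/ z) (r + 1 + j)). ring.
      - rewrite Rmult_minus_distr_l. f_equal.
        + replace (S (r + j)) with (r + 1 + j)%nat by lia.
          rewrite Rmult_assoc, <- Rpow_mult_distr.
          replace (/ z * / (1 - / z)) with (/ (z - 1)) by (field; lra).
          now rewrite pow_inv.
        + rewrite scal_sum. apply sum_eq. intros i _.
          unfold Rdiv. rewrite <- (pow_inv z (r + 1 + (j + i))).
          replace (r + 1 + (j + i))%nat with (r + 1 + j + i)%nat by lia.
          rewrite (pow_add (/ z) (r + 1 + j)). ring. }
  destruct HK as [K [HK0 HK]]. exists K. split; [easy|]. intros z Hz.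
  assert (Hz0 : z <> 0) by lra.
  replace (polygamma_approx r J (z - 1) - polygamma_approx r J z - / z ^ (r + 2)) with
   (polygamma_approx r J (z - 1) - sum_f_R0 (fun j =>
       sum_f_R0 (fun i => polygamma_coef r j * Binomial.C (r + j + i) i / z ^ (r + 1 + (j + i))) (J - j)) J);
    [now apply HK|].
  rewrite (sum_triangle (fun j i => polygamma_coef r j * Binomial.C (r + j + i) i / z ^ (r + 1 + (j + i)))).
  unfold Rminus. rewrite Rplus_assoc. f_equal.
  rewrite <- Ropp_plus_distr. f_equal.
  transitivity (sum_f_R0 (fun q => polygamma_coef r q / z ^ (r + 1 + q)
     + INR (fact (r + q)) / (INR (fact q) * INR (fact (r + 1))) / z ^ (r + 1 + q) * delta1 q) J).
  - apply sum_eq. intros q Hq.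
    rewrite (sum_eq _ (fun j => Binomial.C q j * bernoulli j
      * (INR (fact (r + q)) / (INR (fact q) * INR (fact (r + 1))) / z ^ (r + 1 + q)))).
    + rewrite <- scal_sum, bernoulli_binomial_sum. unfold polygamma_coef. field.
      repeat split; try apply INR_fact_neq_0; now apply pow_nonzero.
    + intros j Hj. rewrite polygamma_coef_binomial.
      replace (j + (q - j))%nat with q by lia. unfold Rdiv; ring.
  - rewrite plus_sum. unfold polygamma_approx. f_equal.
    destruct J as [|J]; [lia|]. rewrite sum_delta1.
    replace (r + 1 + 1)%nat with (r + 2)%nat by lia.
    change (fact 1) with 1%nat. simpl (INR 1). field.
    repeat split; [now apply pow_nonzero | apply INR_fact_neq_0].
Qed.

Lemma ex_series_dominated (a b : nat -> R) :
  (forall n, Rabs (a n) <= b n) -> ex_series b -> ex_series a.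
Proof. exact (@ex_series_le R_AbsRing R_CompleteNormedModule a b). Qed.

Lemma ex_series_inv_sq : ex_series (fun n => / INR (S n) ^ 2).
Proof.
  apply (ex_series_dominated _ (fun n => 2 * (/ INR (S n) - / INR (S (S n))))).
  - intros n.
    assert (Hn : 1 <= INR (S n)) by (rewrite S_INR; assert (H := pos_INR n); lra).
    rewrite Rabs_right by (apply Rle_ge, Rlt_le, Rinv_0_lt_compat, pow_lt; lra).
    rewrite (S_INR (S n)). set (x := INR (S n)) in *.
    replace (2 * (/ x - / (x + 1))) with (/ x ^ 2 * (2 * x / (x + 1))) by (field; lra).
    rewrite <- (Rmult_1_r (/ x ^ 2)) at 1.
    apply Rmult_le_compat_l; [apply Rlt_le, Rinv_0_lt_compat, pow_lt; lra|].
    apply (Rmult_le_reg_r (x + 1)); [lra|]. field_simplify; lra.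
  - apply (ex_series_scal 2 (fun n => / INR (S n) - / INR (S (S n)))).
    exists 1. change (is_lim_seq (sum_n (fun n => / INR (S n) - / INR (S (S n)))) 1).
    apply (is_lim_seq_ext (fun n => 1 - / INR (S (S n)))).
    + intros n. induction n as [|n IH].
      * rewrite sum_O. simpl; field.
      * rewrite sum_Sn, <- IH. unfold plus; simpl plus. cbn -[INR]. ring.
    + replace (Finite 1) with (Finite (1 - 0)) by (f_equal; ring).
      apply is_lim_seq_minus'; [apply is_lim_seq_const|].
      apply (is_lim_seq_incr_1 (fun n => / INR (S n)) 0), (is_lim_seq_incr_1 (fun n => / INR n) 0).
      replace (Finite 0) with (Rbar_inv p_infty) by reflexivity.
      apply is_lim_seq_inv; [apply is_lim_seq_INR|easy].
Qed.

Definition polygamma_sum (m : nat) (z : R) : R := Series (fun n => / (INR (S n) + z) ^ m).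

Lemma inv_shift_pow_le (m n : nat) (z : R) : (2 <= m)%nat -> 0 <= z ->
  0 <= / (INR (S n) + z) ^ m <= / INR (S n) ^ 2.
Proof.
  intros Hm Hz.
  assert (Hn : 1 <= INR (S n)) by (rewrite S_INR; assert (H := pos_INR n); lra).
  split; [apply Rlt_le, Rinv_0_lt_compat, pow_lt; lra|].
  apply Rinv_le_contravar; [apply pow_lt; lra|].
  apply Rle_trans with ((INR (S n) + z) ^ 2).
  - apply pow_incr; lra.
  - apply Rle_pow; [lra|easy].
Qed.

Lemma ex_polygamma_sum (m : nat) (z : R) : (2 <= m)%nat -> 0 <= z ->
  ex_series (fun n => / (INR (S n) + z) ^ m).
Proof.
  intros Hm Hz. apply (ex_series_dominated _ (fun n => / INR (S n) ^ 2)); [|apply ex_series_inv_sq].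
  intros n.
  rewrite Rabs_right by (apply Rle_ge, inv_shift_pow_le; easy).
  now apply inv_shift_pow_le.
Qed.

Lemma is_lim_seq_shift_inv_pow (z : R) (n : nat) : 
  is_lim_seq (fun M => / (z + INR M) ^ S n) 0.
Proof.
  apply (is_lim_comp_seq (fun x => / x ^ S n) _ p_infty 0).
  - apply is_lim_inv_pow.
  - now exists 0%nat.
  - apply (is_lim_seq_plus (fun _ => z) INR z p_infty p_infty); [apply is_lim_seq_const|apply is_lim_seq_INR|easy].
Qed.

Lemma is_lim_seq_polygamma_approx (r J : nat) (z : R) : is_lim_seq (fun M => polygamma_approx r J (z + INR M)) 0.
Proof.
  unfold polygamma_approx. induction J as [|J IH].
  - simpl sum_f_R0. replace (r + 1 + 0)%nat with (S r) by lia.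
    replace (Finite 0) with (Rbar_mult (polygamma_coef r 0) 0) by (simpl; f_equal; ring).
    apply is_lim_seq_scal_l, is_lim_seq_shift_inv_pow.
  - replace (Finite 0) with (Finite (0 + 0)) by (f_equal; ring).
    apply (is_lim_seq_plus' _ _ _ _ IH).
    replace (r + 1 + S J)%nat with (S (r + 1 + J)) by lia.
    replace (Finite 0) with (Rbar_mult (polygamma_coef r (S J)) 0) by (simpl; f_equal; ring).
    apply is_lim_seq_scal_l, is_lim_seq_shift_inv_pow.
Qed.

(** Telescoping: the difference equation is summed over [z + 1, z + 2, ...], where
    both functions tend to zero; one power of [z] is lost in summing the
    errors. *)
Lemma polygamma_sum_approx (r J : nat) : (1 <= J)%nat -> exists K, forall z, 2 <= z ->
  Rabs (polygamma_sum (r + 2) z - polygamma_approx r J z) <= K / z ^ (r + J + 1).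
Proof.
  intros HJ. destruct (polygamma_approx_difference r J HJ) as [K [HK0 HK]].
  exists K. intros z Hz.
  assert (Hpart : forall n,
    Rabs (sum_n (fun i => / (INR (S i) + z) ^ (r + 2)) n - (polygamma_approx r J z - polygamma_approx r J (z + INR (S n))))
    <= K / z ^ (r + J) * (/ z - / (z + INR (S n)))).
  { intros n.
    assert (Hstep : forall x, 0 <= x -> Rabs (/ (x + 1 + z) ^ (r + 2) - (polygamma_approx r J (z + x) - polygamma_approx r J (z + (x + 1))))
       <= K / z ^ (r + J) * (/ (z + x) - / (z + (x + 1)))).
    { intros x Hx. specialize (HK (z + (x + 1)) ltac:(lra)).
      rewrite Rabs_minus_sym.
      replace (polygamma_approx r J (z + x) - polygamma_approx r J (z + (x + 1)) - / (x + 1 + z) ^ (r + 2))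
        with (polygamma_approx r J (z + (x + 1) - 1) - polygamma_approx r J (z + (x + 1)) - / (z + (x + 1)) ^ (r + 2))
        by (f_equal; [do 2 f_equal; ring | do 2 f_equal; ring]).
      eapply Rle_trans; [exact HK|]. unfold Rdiv. rewrite Rmult_assoc.
      apply Rmult_le_compat_l; [easy|].
      rewrite pow_add, Rinv_mult.
      apply Rmult_le_compat.
      - apply Rlt_le, Rinv_0_lt_compat, pow_lt; lra.
      - apply Rlt_le, Rinv_0_lt_compat, pow_lt; lra.
      - apply Rinv_le_contravar; [apply pow_lt; lra|]. apply pow_incr; lra.
      - replace (/ (z + x) - / (z + (x + 1))) with (/ ((z + x) * (z + (x + 1)))) by (field; lra).
        apply Rinv_le_contravar; [nra|]. simpl; nra. }
    induction n as [|n IH].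
    - rewrite sum_O. assert (H := Hstep 0 ltac:(lra)).
      rewrite !Rplus_0_r, !Rplus_0_l in H. simpl INR in *. exact H.
    - rewrite sum_Sn. unfold plus; cbn -[INR sum_n polygamma_approx pow].
      assert (H := Hstep (INR (S n)) (pos_INR _)).
      rewrite <- S_INR in H.
      eapply Rle_trans; [|eapply Rle_trans; [exact (Rplus_le_compat _ _ _ _ IH H)|]].
      + eapply Rle_trans; [|apply Rabs_triang]. apply Req_le. f_equal. ring.
      + apply Req_le. ring. }
  assert (Hlim : is_lim_seq (fun n => Rabs (sum_n (fun i => / (INR (S i) + z) ^ (r + 2)) n
      - (polygamma_approx r J z - polygamma_approx r J (z + INR (S n))))) (Rabs (polygamma_sum (r + 2) z - (polygamma_approx r J z - 0)))).
  { apply (is_lim_seq_abs _ (polygamma_sum (r + 2) z - (polygamma_approx r J z - 0))).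
    apply is_lim_seq_minus'.
    - apply Series_correct. apply ex_polygamma_sum; [lia|lra].
    - apply is_lim_seq_minus'; [apply is_lim_seq_const|].
      apply (is_lim_seq_incr_1 (fun n => polygamma_approx r J (z + INR n))). apply is_lim_seq_polygamma_approx. }
  rewrite Rminus_0_r in Hlim.
  refine (is_lim_seq_le _ _ (Finite _) (Finite _) _ Hlim (is_lim_seq_const _)).
  intros n. eapply Rle_trans; [apply Hpart|].
  replace (K / z ^ (r + J + 1)) with (K / z ^ (r + J) * / z)
    by (rewrite (pow_add z (r + J)), pow_1; field; split; [lra|apply pow_nonzero; lra]).
  apply Rmult_le_compat_l.
  - apply Rmult_le_pos; [easy|]. apply Rlt_le, Rinv_0_lt_compat, pow_lt; lra.
  - assert (0 < / (z + INR (S n))); [|lra].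
    apply Rinv_0_lt_compat. assert (H := pos_INR (S n)); lra.
Qed.

(** Up to sign and a factorial, the sum is the polygamma function of order [r+1]
    at [z+1]. *)
Lemma expands_polygamma_sum (r : nat) :
  expands (fun k => if (k <? r + 1)%nat then 0 else polygamma_coef r (k - (r + 1))) (polygamma_sum (r + 2)).
Proof.
  set (a := fun k => if (k <? r + 1)%nat then 0 else polygamma_coef r (k - (r + 1))).
  assert (Ht : forall J z, sum_f_R0 (fun k => a k / z ^ k) (r + 1 + J) = polygamma_approx r J z).
  { intros J z. unfold polygamma_approx. induction J as [|J IH].
    - rewrite sum_last.
      + unfold a. rewrite (proj2 (Nat.ltb_ge _ _)) by lia. simpl.
        now replace (r + 1 + 0 - (r + 1))%nat with 0%nat by lia.
      + intros j Hj. unfold a. rewrite (proj2 (Nat.ltb_lt _ _)) by lia. unfold Rdiv; ring.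
    - replace (r + 1 + S J)%nat with (S (r + 1 + J)) by lia.
      rewrite 2!tech5, IH. replace (r + 1 + S J)%nat with (S (r + 1 + J)) by lia.
      f_equal. unfold a.
      rewrite (proj2 (Nat.ltb_ge _ _)) by lia.
      now replace (S (r + 1 + J) - (r + 1))%nat with (S J) by lia. }
  apply expands_of_longer. intros N.
  destruct (polygamma_sum_approx r (S N)) as [K HK]; [lia|].
  exists (r + 1 + S N)%nat, (Rabs K). split; [lia|]. intros z Hz.
  rewrite Ht. eapply Rle_trans; [now apply HK|].
  unfold Rdiv. apply Rle_trans with (Rabs K * / z ^ (r + S N + 1)).
  - apply Rmult_le_compat_r; [apply Rlt_le, Rinv_0_lt_compat, pow_lt; lra|]. apply Rle_abs.
  - apply Rmult_le_compat_l; [apply Rabs_pos|]. apply pow_div_le; [lra|lia].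
Qed.

(** * Termwise differentiation *)

Lemma mean_value (f df : R -> R) (x y : R) :
  (forall t, Rmin x y <= t <= Rmax x y -> is_derive f t (df t)) ->
  exists c, Rmin x y <= c <= Rmax x y /\ f y - f x = df c * (y - x).
Proof.
  intros H. destruct (MVT_gen f x y df) as [c Hc].
  - intros t Ht. apply H. lra.
  - intros t Ht. apply continuity_pt_filterlim.
    apply (ex_derive_continuous f t). exists (df t). now apply H.
  - exists c. exact Hc.
Qed.

(** Having the error quadratic in [y - x], with a constant, is what makes the
    derivative of a series computable by summing the errors. *)
Lemma is_derive_quadratic (f : R -> R) (x l K d : R) : 0 < d ->
  (forall y, Rabs (y - x) < d -> Rabs (f y - f x - (y - x) * l) <= K * (y - x) ^ 2) ->
  is_derive f x l.
Proof.
  intros Hd H. apply is_derive_Reals. intros eps Heps.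
  assert (HK : 0 < Rabs K + 1) by (assert (0 <= Rabs K) by apply Rabs_pos; lra).
  assert (Hm : 0 < Rmin d (eps / (Rabs K + 1))).
  { apply Rmin_pos; [easy|]. now apply Rdiv_lt_0_compat. }
  exists (mkposreal _ Hm). intros h Hh0 Hh. simpl in Hh.
  assert (H1 : Rabs h < d) by (eapply Rlt_le_trans; [exact Hh|apply Rmin_l]).
  assert (H2 : Rabs h < eps / (Rabs K + 1)) by (eapply Rlt_le_trans; [exact Hh|apply Rmin_r]).
  specialize (H (x + h)). replace (x + h - x) with h in H by ring.
  specialize (H H1).
  assert (Hp : 0 < Rabs h) by now apply Rabs_pos_lt.
  replace ((f (x + h) - f x) / h - l) with ((f (x + h) - f x - h * l) / h) by (field; easy).
  unfold Rdiv. rewrite Rabs_mult, Rabs_inv.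
  apply (Rmult_lt_reg_r (Rabs h)); [easy|].
  rewrite Rmult_assoc, Rinv_l, Rmult_1_r by lra.
  eapply Rle_lt_trans; [exact H|].
  rewrite <- (pow2_abs h).
  assert (Rabs h * (Rabs K + 1) < eps).
  { apply (Rmult_lt_compat_r (Rabs K + 1)) in H2; [|easy].
    unfold Rdiv in H2. rewrite Rmult_assoc, Rinv_l, Rmult_1_r in H2; lra. }
  assert (K <= Rabs K) by apply Rle_abs. simpl. nra.
Qed.

(** Summable bounds on the second derivatives give a quadratic bound for the
    remainder of the sum. *)
Lemma is_derive_Series (u v w : nat -> R -> R) (M : nat -> R) (a b x : R) :
  a < x < b ->
  (forall n y, a < y < b -> is_derive (u n) y (v n y)) ->
  (forall n y, a < y < b -> is_derive (v n) y (w n y)) ->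
  (forall n y, a < y < b -> Rabs (w n y) <= M n) ->
  ex_series M ->
  (forall y, a < y < b -> ex_series (fun n => u n y)) ->
  ex_series (fun n => v n x) ->
  is_derive (fun y => Series (fun n => u n y)) x (Series (fun n => v n x)).
Proof.
  intros Hx Hu Hv Hw HM Hcu Hcv.
  apply (is_derive_quadratic _ _ _ (Series M) (Rmin (x - a) (b - x))).
  { apply Rmin_pos; lra. }
  intros y Hy.
  assert (Hyab : a < y < b).
  { assert (H1 := Rmin_l (x - a) (b - x)). assert (H2 := Rmin_r (x - a) (b - x)).
    apply Rabs_lt_between in Hy. lra. }
  assert (Hin : forall t, Rmin x y <= t <= Rmax x y -> a < t < b /\ Rabs (t - x) <= Rabs (y - x)).
  { intros t. unfold Rmin, Rmax. destruct (Rle_dec x y) as [Hxy|Hxy]; intros Ht; (split; [lra|]).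
    - rewrite 2!Rabs_right by lra. lra.
    - rewrite 2!Rabs_left1 by lra. lra. }
  assert (Hterm : forall n, Rabs (u n y - u n x - (y - x) * v n x) <= M n * (y - x) ^ 2).
  { intros n.
    destruct (mean_value (u n) (v n) x y) as [c [Hc Ec]].
    { intros t Ht. apply Hu. now apply Hin. }
    destruct (mean_value (v n) (w n) x c) as [d [Hd Ed]].
    { intros t Ht. apply Hv. apply Hin. revert Ht Hc. unfold Rmin, Rmax.
      destruct (Rle_dec x y), (Rle_dec x c); lra. }
    assert (Hd' : a < d < b).
    { apply Hin. revert Hd Hc. unfold Rmin, Rmax.
      destruct (Rle_dec x y), (Rle_dec x c); lra. }
    replace (u n y - u n x - (y - x) * v n x) with ((v n c - v n x) * (y - x)) by lra.
    rewrite Ed, !Rabs_mult, <- (pow2_abs (y - x)).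
    replace (M n * Rabs (y - x) ^ 2) with (M n * Rabs (y - x) * Rabs (y - x)) by ring.
    apply Rmult_le_compat_r; [apply Rabs_pos|].
    apply Rmult_le_compat; try apply Rabs_pos; [now apply Hw|]. now apply Hin. }
  assert (E : ex_series (fun n => u n y - u n x - (y - x) * v n x)).
  { apply (ex_series_dominated _ (fun n => M n * (y - x) ^ 2)); [exact Hterm|].
    apply (ex_series_ext (fun n => (y - x) ^ 2 * M n)); [intros; simpl; ring|].
    now apply (ex_series_scal ((y - x) ^ 2) M). }
  replace (Series (fun n => u n y) - Series (fun n => u n x) - (y - x) * Series (fun n => v n x))
    with (Series (fun n => u n y - u n x - (y - x) * v n x)).
  - rewrite Rmult_comm, <- Series_scal_l.
    eapply Rle_trans; [apply Series_Rabs|].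
    + apply (ex_series_dominated _ (fun n => M n * (y - x) ^ 2)).
      * intros n. rewrite Rabs_Rabsolu. apply Hterm.
      * apply (ex_series_ext (fun n => (y - x) ^ 2 * M n)); [intros; simpl; ring|].
        now apply (ex_series_scal ((y - x) ^ 2) M).
    + apply Series_le.
      * intros n. split; [apply Rabs_pos|]. rewrite (Rmult_comm _ (M n)). apply Hterm.
      * now apply (ex_series_scal ((y - x) ^ 2) M).
  - rewrite Series_minus, Series_minus, Series_scal_l; auto.
    + apply (ex_series_minus (fun n => u n y) (fun n => u n x)); auto.
    + now apply (ex_series_scal (y - x) (fun n => v n x)).
Qed.

Lemma Derive_n_chain (F : nat -> R -> R) (f : R -> R) :
  (forall z, 0 < z -> f z = F 0%nat z) ->
  (forall n z, 0 < z -> is_derive (F n) z (F (S n) z)) ->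
  forall n z, 0 < z -> ex_derive_n f n z /\ Derive_n f n z = F n z.
Proof.
  intros H0 HS.
  assert (Hloc : forall z, 0 < z -> locally z (fun t => 0 < t)).
  { intros z Hz. now apply open_gt. }
  assert (HD : forall n z, 0 < z -> Derive_n f n z = F n z).
  { induction n as [|n IH]; intros z Hz; [now apply H0|].
    simpl. apply is_derive_unique.
    apply (is_derive_ext_loc (F n)); [|now apply HS].
    generalize (Hloc z Hz). apply filter_imp. intros t Ht. now rewrite IH. }
  intros n z Hz. split; [|now apply HD].
  destruct n as [|n]; [easy|]. simpl. exists (F (S n) z).
  apply (is_derive_ext_loc (F n)); [|now apply HS].
  generalize (Hloc z Hz). apply filter_imp. intros t Ht. now rewrite HD.
Qed.

(** * The derivatives of log G *)

(** Logarithm of the factor of index [n+1] of the Weierstrass product of [G]. *)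
Definition log_factor (n : nat) (z : R) : R :=
  INR (S n) * ln (1 + z / INR (S n)) - z + z ^ 2 / (2 * INR (S n)).
Definition log_factor_d1 (n : nat) (z : R) : R :=
  INR (S n) / (INR (S n) + z) - 1 + z / INR (S n).
Definition log_factor_d2 (n : nat) (z : R) : R :=
  / INR (S n) - INR (S n) / (INR (S n) + z) ^ 2.
Definition weighted_term (m n : nat) (z : R) : R := INR (S n) / (INR (S n) + z) ^ m.

Lemma INR_S_ge1 (n : nat) : 1 <= INR (S n).
Proof. rewrite S_INR. assert (H := pos_INR n). lra. Qed.

Lemma is_derive_log_factor (n : nat) (z : R) : -1 < z -> is_derive (log_factor n) z (log_factor_d1 n z).
Proof.
  intros Hz. assert (Hn := INR_S_ge1 n). unfold log_factor, log_factor_d1. set (x := INR (S n)) in *. clearbody x.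
  assert (0 < 1 + z / x).
  { replace (1 + z / x) with ((x + z) / x) by (field; lra). apply Rdiv_lt_0_compat; lra. }
  auto_derive; [repeat split; lra|]. field; split; [lra|]. lra.
Qed.

Lemma is_derive_log_factor_d1 (n : nat) (z : R) : -1 < z -> is_derive (log_factor_d1 n) z (log_factor_d2 n z).
Proof.
  intros Hz. assert (Hn := INR_S_ge1 n). unfold log_factor_d1, log_factor_d2. set (x := INR (S n)) in *. clearbody x.
  auto_derive; [lra|]. field; lra.
Qed.

Lemma is_derive_log_factor_d2 (n : nat) (z : R) : -1 < z -> is_derive (log_factor_d2 n) z (2 * weighted_term 3 n z).
Proof.
  intros Hz. assert (Hn := INR_S_ge1 n). unfold log_factor_d2, weighted_term. set (x := INR (S n)) in *. clearbody x.
  auto_derive; [apply Rmult_integral_contrapositive; lra|]. field; lra.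
Qed.

Lemma is_derive_weighted_term (m n : nat) (z : R) : -1 < z ->
  is_derive (weighted_term m n) z (- INR m * weighted_term (S m) n z).
Proof.
  intros Hz. assert (Hn := INR_S_ge1 n). unfold weighted_term. set (x := INR (S n)) in *. clearbody x.
  assert (Hp : forall k, (x + z) ^ k <> 0) by (intros k; apply pow_nonzero; lra).
  destruct m as [|m].
  - apply (is_derive_ext (fun _ => x)); [intros; simpl; field|].
    replace (- INR 0 * _) with 0 by (simpl; ring). apply @is_derive_const.
  - auto_derive; [apply (Hp (S m))|]. change (match m with | 0%nat => 1 | S _ => INR m + 1 end) with (INR (S m)).
    simpl pred. simpl pow.
    field. repeat split; try apply Hp; lra.
Qed.

Lemma log_factor_d1_bound (n : nat) (z : R) : 0 <= z -> 0 <= log_factor_d1 n z <= z ^ 2 * / INR (S n) ^ 2.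
Proof.
  intros Hz. assert (Hn := INR_S_ge1 n). unfold log_factor_d1. set (x := INR (S n)) in *. clearbody x.
  replace (x / (x + z) - 1 + z / x) with (z ^ 2 * / (x * (x + z))) by (field; lra).
  split.
  - apply Rmult_le_pos; [nra|]. apply Rlt_le, Rinv_0_lt_compat; nra.
  - apply Rmult_le_compat_l; [nra|]. apply Rinv_le_contravar; nra.
Qed.

Lemma log_factor_bound (n : nat) (z : R) : 0 <= z -> Rabs (log_factor n z) <= z ^ 3 * / INR (S n) ^ 2.
Proof.
  intros Hz. destruct (mean_value (log_factor n) (log_factor_d1 n) 0 z) as [c [Hc Ec]].
  { intros t. rewrite Rmin_left, Rmax_right by lra. intros Ht. apply is_derive_log_factor; lra. }
  rewrite Rmin_left, Rmax_right in Hc by lra.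
  assert (H0 : log_factor n 0 = 0).
  { unfold log_factor. assert (Hn := INR_S_ge1 n).
    replace (1 + 0 / INR (S n)) with 1 by (field; lra). rewrite ln_1. field; lra. }
  rewrite H0, 2!Rminus_0_r in Ec. rewrite Ec, Rabs_mult, (Rabs_right z) by lra.
  assert (Hb := log_factor_d1_bound n c ltac:(lra)).
  rewrite Rabs_right by lra.
  assert (Hn := INR_S_ge1 n).
  assert (Hi : 0 < / INR (S n) ^ 2) by (apply Rinv_0_lt_compat, pow_lt; lra).
  replace (z ^ 3 * / INR (S n) ^ 2) with (z ^ 2 * / INR (S n) ^ 2 * z) by ring.
  apply Rmult_le_compat_r; [easy|]. eapply Rle_trans; [apply Hb|].
  apply Rmult_le_compat_r; [lra|]. apply pow_incr; lra.
Qed.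

Lemma log_factor_d2_bound (n : nat) (z : R) : 0 <= z ->
  0 <= log_factor_d2 n z <= (2 * z + z ^ 2) * / INR (S n) ^ 2.
Proof.
  intros Hz. assert (Hn := INR_S_ge1 n). unfold log_factor_d2. set (x := INR (S n)) in *. clearbody x.
  replace (/ x - x / (x + z) ^ 2) with ((2 * z + z ^ 2 / x) * / (x + z) ^ 2) by (field; lra).
  assert (Hd : 0 <= z ^ 2 / x <= z ^ 2).
  { split; [apply Rmult_le_pos; [nra|]; apply Rlt_le, Rinv_0_lt_compat; lra|].
    apply (Rmult_le_reg_r x); [lra|]. unfold Rdiv. rewrite Rmult_assoc, Rinv_l by lra. nra. }
  assert (Hi : 0 < / (x + z) ^ 2) by (apply Rinv_0_lt_compat, pow_lt; lra).
  split; [nra|]. apply Rmult_le_compat; [lra|lra|lra|].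
  apply Rinv_le_contravar; [apply pow_lt; lra|]. apply pow_incr; lra.
Qed.

Lemma weighted_term_bound (m n : nat) (z : R) : (3 <= m)%nat -> 0 <= z ->
  0 <= weighted_term m n z <= / INR (S n) ^ 2.
Proof.
  intros Hm Hz. assert (Hn := INR_S_ge1 n). unfold weighted_term. set (x := INR (S n)) in *. clearbody x.
  destruct m as [|m]; [lia|]. simpl pow.
  replace (x / ((x + z) * (x + z) ^ m)) with (x / (x + z) * / (x + z) ^ m)
    by (field; split; [apply pow_nonzero; lra|lra]).
  assert (Hq : 0 <= x / (x + z) <= 1).
  { split; [apply Rmult_le_pos; [lra|]; apply Rlt_le, Rinv_0_lt_compat; lra|].
    apply (Rmult_le_reg_r (x + z)); [lra|]. unfold Rdiv. rewrite Rmult_assoc, Rinv_l by lra. lra. }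
  assert (Hi : 0 < / (x + z) ^ m) by (apply Rinv_0_lt_compat, pow_lt; lra).
  split; [nra|].
  apply Rle_trans with (/ (x + z) ^ m); [nra|].
  apply Rinv_le_contravar; [nra|]. apply Rle_trans with ((x + z) ^ 2); [simpl; nra|].
  apply Rle_pow; [lra|lia].
Qed.

Lemma ex_series_scal_inv_sq (c : R) : ex_series (fun n => c * / INR (S n) ^ 2).
Proof. apply (ex_series_scal c (fun n => / INR (S n) ^ 2)), ex_series_inv_sq. Qed.

Lemma ex_series_log_factor (z : R) : 0 <= z -> ex_series (fun n => log_factor n z).
Proof.
  intros Hz. apply (ex_series_dominated _ _ (fun n => log_factor_bound n z Hz)), ex_series_scal_inv_sq.
Qed.

Lemma ex_series_log_factor_d1 (z : R) : 0 <= z -> ex_series (fun n => log_factor_d1 n z).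
Proof.
  intros Hz. apply (ex_series_dominated _ (fun n => z ^ 2 * / INR (S n) ^ 2)); [|apply ex_series_scal_inv_sq].
  intros n. assert (H := log_factor_d1_bound n z Hz). rewrite Rabs_right; lra.
Qed.

Lemma ex_series_log_factor_d2 (z : R) : 0 <= z -> ex_series (fun n => log_factor_d2 n z).
Proof.
  intros Hz. apply (ex_series_dominated _ (fun n => (2 * z + z ^ 2) * / INR (S n) ^ 2)); [|apply ex_series_scal_inv_sq].
  intros n. assert (H := log_factor_d2_bound n z Hz). rewrite Rabs_right; lra.
Qed.

Lemma ex_series_weighted_term (m : nat) (z : R) : (3 <= m)%nat -> 0 <= z -> ex_series (fun n => weighted_term m n z).
Proof.
  intros Hm Hz. apply (ex_series_dominated _ (fun n => / INR (S n) ^ 2)); [|apply ex_series_inv_sq].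
  intros n. assert (H := weighted_term_bound m n z Hm Hz). rewrite Rabs_right; lra.
Qed.

Definition weighted_sum (m : nat) (z : R) : R := Series (fun n => weighted_term m n z).

(** The successive derivatives of [log G(z+1)]; the prefactor and the
    counterterms of the product have disappeared from the third one on. *)
Definition logG_der (n : nat) (z : R) : R :=
  match n with
  | O => z / 2 * ln (2 * PI) - z * (z + 1) / 2 - euler_gamma * z ^ 2 / 2
         + Series (fun n => log_factor n z)
  | S O => 1 / 2 * ln (2 * PI) - z - 1 / 2 - euler_gamma * z + Series (fun n => log_factor_d1 n z)
  | S (S O) => - 1 - euler_gamma + Series (fun n => log_factor_d2 n z)
  | S m => (-1) ^ m * INR (fact m) * weighted_sum (S m) z
  end.

Lemma is_derive_logG_der (n : nat) (z : R) : 0 < z ->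
  is_derive (logG_der n) z (logG_der (S n) z).
Proof.
  intros Hz. 
  destruct n as [|[|[|m]]].
  - assert (H : is_derive (fun y => Series (fun n => log_factor n y)) z (Series (fun n => log_factor_d1 n z))).
    { apply (is_derive_Series log_factor log_factor_d1 log_factor_d2 (fun n => (2 * (z + 1) + (z + 1) ^ 2) * / INR (S n) ^ 2) 0 (z + 1)); try lra.
      - intros; apply is_derive_log_factor; lra.
      - intros; apply is_derive_log_factor_d1; lra.
      - intros n y Hy. assert (H := log_factor_d2_bound n y ltac:(lra)). rewrite Rabs_right by lra.
        eapply Rle_trans; [apply H|]. apply Rmult_le_compat_r; [|nra].
        apply Rlt_le, Rinv_0_lt_compat, pow_lt. assert (Hn := INR_S_ge1 n). lra.
      - apply ex_series_scal_inv_sq.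
      - intros y Hy; apply ex_series_log_factor; lra.
      - apply ex_series_log_factor_d1; lra. }
    simpl logG_der. 
    apply (is_derive_plus (fun z => z / 2 * ln (2 * PI) - z * (z + 1) / 2 - euler_gamma * z ^ 2 / 2)
       (fun z => Series (fun n => log_factor n z)) z (1 / 2 * ln (2 * PI) - z - 1 / 2 - euler_gamma * z)); [|exact H].
    auto_derive; [easy|]. field.
  - assert (H : is_derive (fun y => Series (fun n => log_factor_d1 n y)) z (Series (fun n => log_factor_d2 n z))).
    { apply (is_derive_Series log_factor_d1 log_factor_d2 (fun n y => 2 * weighted_term 3 n y) (fun n => 2 * / INR (S n) ^ 2) 0 (z + 1)); try lra.
      - intros; apply is_derive_log_factor_d1; lra.
      - intros; apply is_derive_log_factor_d2; lra.
      - intros n y Hy. assert (H := weighted_term_bound 3 n y ltac:(lia) ltac:(lra)). rewrite Rabs_right by lra. lra.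
      - apply ex_series_scal_inv_sq.
      - intros y Hy; apply ex_series_log_factor_d1; lra.
      - apply ex_series_log_factor_d2; lra. }
    simpl logG_der. 
    apply (is_derive_plus (fun z => 1 / 2 * ln (2 * PI) - z - 1 / 2 - euler_gamma * z)
       (fun z => Series (fun n => log_factor_d1 n z)) z (-1 - euler_gamma)); [|exact H].
    auto_derive; [easy|]. field.
  - assert (H : is_derive (fun y => Series (fun n => log_factor_d2 n y)) z (Series (fun n => 2 * weighted_term 3 n z))).
    { apply (is_derive_Series log_factor_d2 (fun n y => 2 * weighted_term 3 n y) (fun n y => 2 * (- INR 3 * weighted_term 4 n y)) (fun n => 6 * / INR (S n) ^ 2) 0 (z + 1)); try lra.
      - intros; apply is_derive_log_factor_d2; lra.
      - intros; apply is_derive_scal, is_derive_weighted_term; lra.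
      - intros n y Hy. assert (H := weighted_term_bound 4 n y ltac:(lia) ltac:(lra)).
        simpl (INR 3). rewrite Rabs_left1; lra.
      - apply ex_series_scal_inv_sq.
      - intros y Hy; apply ex_series_log_factor_d2; lra.
      - apply (ex_series_scal 2 (fun n => weighted_term 3 n z)), ex_series_weighted_term; [lia|lra]. }
    rewrite Series_scal_l in H. unfold logG_der, weighted_sum.
    replace ((-1) ^ 2 * INR (fact 2) * _) with (0 + 2 * Series (fun n => weighted_term 3 n z)) by (simpl; ring).
    apply (is_derive_plus (fun _ => -1 - euler_gamma) _ z 0); [|exact H].
    apply @is_derive_const.
  - assert (H : is_derive (weighted_sum (3 + m)) z (Series (fun n => - INR (3 + m) * weighted_term (4 + m) n z))).
    { apply (is_derive_Series (weighted_term (3 + m)) (fun n y => - INR (3 + m) * weighted_term (4 + m) n y)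
         (fun n y => - INR (3 + m) * (- INR (4 + m) * weighted_term (5 + m) n y))
         (fun n => INR (3 + m) * INR (4 + m) * / INR (S n) ^ 2) 0 (z + 1)); try lra.
      - intros; apply is_derive_weighted_term; lra.
      - intros; apply is_derive_scal, is_derive_weighted_term; lra.
      - intros n y Hy. assert (H := weighted_term_bound (5 + m) n y ltac:(lia) ltac:(lra)).
        assert (H3 := pos_INR (3 + m)). assert (H4 := pos_INR (4 + m)).
        replace (- INR (3 + m) * (- INR (4 + m) * weighted_term (5 + m) n y))
          with (INR (3 + m) * INR (4 + m) * weighted_term (5 + m) n y) by ring.
        assert (H5 : 0 <= INR (3 + m) * INR (4 + m)) by now apply Rmult_le_pos.
        rewrite Rabs_right by (apply Rle_ge, Rmult_le_pos; lra).
        apply Rmult_le_compat_l; lra.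
      - apply ex_series_scal_inv_sq.
      - intros y Hy; apply ex_series_weighted_term; [lia|lra].
      - apply (ex_series_scal (- INR (3 + m)) (fun n => weighted_term (4 + m) n z)), ex_series_weighted_term; [lia|lra]. }
    rewrite Series_scal_l in H.
    change (logG_der (S (S (S m)))) with (fun z => (-1) ^ (2 + m) * INR (fact (2 + m)) * weighted_sum (3 + m) z).
    replace (logG_der (S (S (S (S m)))) z) with
      ((-1) ^ (2 + m) * INR (fact (2 + m)) * (- INR (3 + m) * Series (fun n => weighted_term (4 + m) n z))).
    + now apply is_derive_scal.
    + change (logG_der (S (S (S (S m)))) z) with ((-1) ^ (3 + m) * INR (fact (3 + m)) * weighted_sum (4 + m) z).
      unfold weighted_sum. change (fact (3 + m)) with ((3 + m) * fact (2 + m))%nat.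
      rewrite (mult_INR (3 + m)). change ((-1) ^ (3 + m)) with (-1 * (-1) ^ (2 + m)). ring.
Qed.

Lemma barnesG_exp (z : R) : 0 <= z -> barnesG (z + 1) = exp (logG_der 0 z).
Proof.
  intros Hz. unfold barnesG, barnesG_succ.
  replace (z + 1 - 1) with z by ring.
  assert (HP : forall N, prod_f_R0 (fun k => barnes_factor z (S k)) N = exp (sum_n (fun n => log_factor n z) N)).
  { assert (Hf : forall k, barnes_factor z (S k) = exp (log_factor k z)).
    { intros k. unfold barnes_factor, log_factor. assert (Hn := INR_S_ge1 k).
      assert (Hp : 0 < 1 + z / INR (S k)).
      { assert (0 <= z / INR (S k)); [|lra]. apply Rmult_le_pos; [easy|]. apply Rlt_le, Rinv_0_lt_compat; lra. }
      rewrite <- (Rpower_pow (S k)) by easy. unfold Rpower. rewrite <- exp_plus.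
      f_equal. ring. }
    induction N as [|N IH].
    - rewrite sum_O. apply Hf.
    - rewrite sum_Sn. simpl prod_f_R0. rewrite IH, Hf, <- exp_plus. reflexivity. }
  rewrite (is_lim_seq_unique _ (exp (Series (fun n => log_factor n z)))).
  - simpl real. unfold Rpower. rewrite <- 2!exp_plus. f_equal. unfold logG_der. field.
  - apply (is_lim_seq_ext (fun N => exp (sum_n (fun n => log_factor n z) N))); [intros; now rewrite HP|].
    apply is_lim_seq_continuous; [apply derivable_continuous_pt, derivable_pt_exp|].
    apply Series_correct, ex_series_log_factor, Hz.
Qed.

Lemma logG_succ_eq (z : R) : 0 <= z -> logG_succ z = logG_der 0 z.
Proof. intros Hz. unfold logG_succ. rewrite barnesG_exp by easy. apply ln_exp. Qed.

Lemma Derive_n_logG_succ (n : nat) (z : R) : 0 < z ->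
  ex_derive_n logG_succ n z /\ Derive_n logG_succ n z = logG_der n z.
Proof.
  intros Hz. apply Derive_n_chain; [|apply is_derive_logG_der|easy].
  intros t Ht. apply logG_succ_eq. lra.
Qed.

(** * The coefficients of the series V *)

(** The series [V n] without reference to the genus: the summand at
    [2g = k + 2 - n], for indices of both parities. *)
Definition vcoef (n k : nat) : R :=
  match k with
  | O => 0
  | S k' => if (k + 2 <? n)%nat then 0 else
     (-1) ^ n * ((INR (k + 2 - n) - 1) * bernoulli (k + 2 - n) / INR (fact (k + 2 - n))) * INR (fact k')
  end.

Lemma sum_n_m_single (c : R) (g0 a b : nat) :
  sum_n_m (fun g => if (g =? g0)%nat then c else 0) a b
  = if (andb (a <=? g0) (g0 <=? b))%nat then c else 0.
Proof.
  destruct (Nat.leb_spec a g0) as [Ha|Ha]; [destruct (Nat.leb_spec g0 b) as [Hb|Hb]|]; simpl.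
  - induction Hb as [|b Hb IH].
    + destruct (Nat.eq_dec a g0) as [->|Hne].
      * rewrite sum_n_n, Nat.eqb_refl. reflexivity.
      * destruct g0 as [|g0]; [lia|]. rewrite sum_n_Sm by lia.
        rewrite (sum_n_m_ext_loc _ (fun _ => 0)), sum_n_m_const, Nat.eqb_refl.
        -- change (INR (S g0 - a) * 0 + c = c). ring.
        -- intros k Hk. rewrite (proj2 (Nat.eqb_neq _ _)); [easy|lia].
    + rewrite sum_n_Sm by lia. rewrite IH, (proj2 (Nat.eqb_neq _ _)) by lia.
      change (c + 0 = c). ring.
  - rewrite (sum_n_m_ext_loc _ (fun _ => 0)), sum_n_m_const; [ring|].
    intros k Hk. rewrite (proj2 (Nat.eqb_neq _ _)); [easy|lia].
  - rewrite (sum_n_m_ext_loc _ (fun _ => 0)), sum_n_m_const; [ring|].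
    intros k Hk. rewrite (proj2 (Nat.eqb_neq _ _)); [easy|lia].
Qed.

(** The two cutoffs agree because the summands excluded by [gmin] all have
    [k = 0]. An odd index [j] contributes nothing, since [(j - 1) B_j = 0]. *)
Lemma V_vcoef (n k : nat) : V n k = vcoef n k.
Proof.
  unfold V.
  destruct (Nat.ltb_spec (k + 2) n) as [Hlt|Hge].
  { rewrite (sum_n_m_ext_loc _ (fun _ => 0)), sum_n_m_const.
    - rewrite Rmult_0_r. unfold vcoef. destruct k; [easy|].
      now rewrite (proj2 (Nat.ltb_lt _ _)) by lia.
    - intros g Hg. rewrite (proj2 (Nat.eqb_neq _ _)); [easy|lia]. }
  assert (Hv : forall k', k = S k' -> vcoef n k = (-1) ^ n * ((INR (k + 2 - n) - 1) *
     bernoulli (k + 2 - n) / INR (fact (k + 2 - n))) * INR (fact k')).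
  { intros k' ->. unfold vcoef. rewrite (proj2 (Nat.ltb_ge _ _)); [easy|lia]. }
  destruct (Nat.Even_or_Odd (k + 2 - n)) as [[g0 Hg]|[g0 Hg]].
  - rewrite (sum_n_m_ext_loc _ (fun g => if (g =? g0)%nat then chi g0 n else 0)).
    + rewrite sum_n_m_single.
      rewrite (proj2 (Nat.leb_le g0 (k + 2))) by lia.
      destruct k as [|k].
      * destruct (Nat.leb_spec (gmin n) g0) as [Hm|Hm]; [exfalso|easy].
        revert Hm. unfold gmin. destruct n as [|[|[|n]]]; lia.
      * rewrite (Hv k) by easy. rewrite Hg.
        destruct (Nat.leb_spec (gmin n) g0) as [Hm|Hm]; cbn [andb].
        -- unfold chi. replace (2 * g0 + n - 3)%nat with k by lia.
           rewrite mult_INR. change (INR 2) with 2. reflexivity.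
        -- exfalso. revert Hm. unfold gmin. destruct n as [|[|[|n]]]; lia.
    + intros g Hg'. destruct (Nat.eqb_spec (2 * g + n) (k + 2)) as [He|He].
      * replace g with g0 by lia. now rewrite Nat.eqb_refl.
      * rewrite (proj2 (Nat.eqb_neq _ _)); [easy|lia].
  - rewrite (sum_n_m_ext_loc _ (fun _ => 0)), sum_n_m_const.
    + rewrite Rmult_0_r. destruct k as [|k]; [easy|]. rewrite (Hv k) by easy. rewrite Hg.
      destruct g0 as [|g0].
      * simpl. unfold Rdiv. ring.
      * rewrite bernoulli_odd; [unfold Rdiv; ring| |lia].
        apply Nat.odd_spec. now exists (S g0).
    + intros g Hg'. rewrite (proj2 (Nat.eqb_neq _ _)); [easy|lia].
Qed.

(** [V (n+1)] is the formal derivative of [V n], apart from its coefficient of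
    [1/z]. *)
Lemma V_derivative (n k : nat) : (1 <= k)%nat -> V (S n) (S k) = - INR k * V n k.
Proof.
  intros Hk. rewrite 2!V_vcoef. destruct k as [|k]; [lia|]. unfold vcoef.
  replace (S (S k) + 2 - S n)%nat with (S k + 2 - n)%nat by lia.
  change (S (S k) + 2 <? S n)%nat with (S k + 2 <? n)%nat.
  destruct (S k + 2 <? n)%nat; [ring|].
  rewrite (fact_simpl k), mult_INR. simpl pow. ring.
Qed.

(** [k/(k+z)^n = (k+z)^(-(n-1)) - z (k+z)^(-n)] reduces the sum to two polygamma
    sums; the two coefficients combine to the factor [j - 1], [j = 2g], of the
    Harer-Zagier formula. *)
Lemma expands_logG_der (n : nat) : (3 <= n)%nat -> expands (V n) (logG_der n).
Proof.
  intros Hn. destruct n as [|[|[|r]]]; try lia. clear Hn.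
  assert (H1 := expands_polygamma_sum r). assert (H2 := expands_polygamma_sum (S r)).
  apply expands_mul_z in H2.
  2: { rewrite (proj2 (Nat.ltb_lt _ _)); [easy|lia]. }
  set (c := (-1) ^ (r + 2) * INR (fact (r + 2))).
  apply (expands_lincomb c (- c) _ _ _ _ H1) in H2. revert H2. apply expands_ext.
  - intros k. rewrite V_vcoef. unfold vcoef.
    destruct k as [|k].
    + rewrite (proj2 (Nat.ltb_lt 0 (r + 1))) by lia.
      rewrite (proj2 (Nat.ltb_lt 1 (S r + 1))) by lia. ring.
    + destruct (Nat.ltb_spec (S k) (r + 1)) as [Hk|Hk].
      * rewrite (proj2 (Nat.ltb_lt (S (S k)) (S r + 1))) by lia.
        rewrite (proj2 (Nat.ltb_lt (S k + 2) _)) by lia. ring.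
      * rewrite (proj2 (Nat.ltb_ge (S (S k)) (S r + 1))) by lia.
        rewrite (proj2 (Nat.ltb_ge (S k + 2) _)) by lia.
        replace (S (S k) - (S r + 1))%nat with (S k - (r + 1))%nat by lia.
        replace (S k + 2 - S (S (S r)))%nat with (S k - (r + 1))%nat by lia.
        set (j := (S k - (r + 1))%nat).
        replace k with (r + j)%nat by (unfold j; lia). clearbody j. clear Hk k.
        unfold polygamma_coef, c. replace (S r + j)%nat with (S (r + j)) by lia.
        replace (S r + 1)%nat with (S (r + 1)) by lia. replace (r + 2)%nat with (S (r + 1)) by lia.
        replace (S (S (S r))) with (S (S (r + 1))) by lia.
        rewrite (fact_simpl (r + j)), (fact_simpl (r + 1)), !mult_INR, !S_INR, !plus_INR.
        simpl (INR 1). simpl pow. field.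
        assert (Hr := pos_INR r). repeat split; try apply INR_fact_neq_0; lra.
  - intros z Hz. change (logG_der (S (S (S r))) z) with ((-1) ^ (2 + r) * INR (fact (2 + r)) * weighted_sum (3 + r) z).
    unfold c. replace (r + 2)%nat with (2 + r)%nat by lia.
    replace (S r + 2)%nat with (3 + r)%nat by lia.
    replace (weighted_sum (3 + r) z) with (polygamma_sum (2 + r) z - z * polygamma_sum (3 + r) z); [ring|].
    unfold weighted_sum, polygamma_sum. rewrite <- Series_scal_l, <- Series_minus.
    + apply Series_ext. intros n. unfold weighted_term. assert (Hx := INR_S_ge1 n).
      change (3 + r)%nat with (S (2 + r)). rewrite <- (tech_pow_Rmult _ (2 + r)). field.
      split; [apply pow_nonzero; lra|lra].
    + apply ex_polygamma_sum; [lia|lra].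
    + apply (ex_series_scal z (fun n => / (INR (S n) + z) ^ (3 + r))), ex_polygamma_sum; [lia|lra].
Qed.

(** * Integration of expansions *)

Lemma is_derive_tail_sum (a : nat -> R) (N : nat) (z : R) : 0 < z -> a 0%nat = 0 -> a 1%nat = 0 ->
  is_derive (fun z => sum_f_R0 (fun k => - a (S k) / INR k / z ^ k) N) z
    (sum_f_R0 (fun k => a k / z ^ k) (S N)).
Proof.
  intros Hz H0 H1. induction N as [|N IH].
  - simpl. rewrite H0, H1. replace (0 / 1 + 0 / (z * 1)) with 0 by (field; lra).
    apply @is_derive_const.
  - rewrite (tech5 _ (S N)).
    apply (is_derive_ext (fun z => sum_f_R0 (fun k => - a (S k) / INR k / z ^ k) N
      + - a (S (S N)) / INR (S N) / z ^ S N)); [intros; reflexivity|].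
    apply (is_derive_plus (fun z => sum_f_R0 (fun k => - a (S k) / INR k / z ^ k) N)); [exact IH|].
    assert (HN : INR (S N) <> 0) by (apply not_0_INR; lia).
    assert (Hp : forall k, z ^ k <> 0) by (intros; apply pow_nonzero; lra).
    auto_derive; [apply (Hp (S N))|].
    change (match N with | 0%nat => 1 | S _ => INR N + 1 end) with (INR (S N)).
    simpl pred. simpl (z ^ _). field. repeat split; try apply Hp; lra.
Qed.

(** Integration of an expansion from [+oo]. If the derivative of the remainder is
    at most [K z^(-N-2)] in absolute value, then the remainder plus or minus
    [K/(N+1) z^(-N-1)] is monotone with limit zero. A limit along the integers is
    enough to fix the constant of integration. *)
Lemma expands_integrate (a : nat -> R) (F f : R -> R) :
  (forall z, 0 < z -> is_derive F z (f z)) ->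
  a 0%nat = 0 -> a 1%nat = 0 -> expands a f ->
  is_lim_seq (fun n => F (INR n)) 0 ->
  expands (fun k => - a (S k) / INR k) F.
Proof.
  intros HF H0 H1 Hf Hlim N. destruct (Hf (S N)) as [K HK].
  set (rem := fun z => F z - sum_f_R0 (fun k => - a (S k) / INR k / z ^ k) N).
  set (r := fun z => f z - sum_f_R0 (fun k => a k / z ^ k) (S N)).
  assert (HR : forall z, 0 < z -> is_derive rem z (r z)).
  { intros z Hz. apply @is_derive_minus; [now apply HF|]. now apply is_derive_tail_sum. }
  assert (HRlim : is_lim_seq (fun n => rem (INR n)) 0).
  { replace (Finite 0) with (Finite (0 - 0)) by (f_equal; ring).
    apply is_lim_seq_minus'; [exact Hlim|]. clear -H1.
    induction N as [|N IH].
    - simpl. apply (is_lim_seq_ext (fun _ => 0)); [|apply is_lim_seq_const].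
      intros n. rewrite H1. unfold Rdiv; ring.
    - apply (is_lim_seq_ext (fun n => sum_f_R0 (fun k => - a (S k) / INR k / INR n ^ k) N
        + - a (S (S N)) / INR (S N) * / INR n ^ S N)); [intros; reflexivity|].
      replace (Finite 0) with (Finite (0 + 0)) by (f_equal; ring).
      apply is_lim_seq_plus'; [exact IH|].
      replace (Finite 0) with (Rbar_mult (- a (S (S N)) / INR (S N)) 0) by (simpl; f_equal; ring).
      apply is_lim_seq_scal_l.
      apply (is_lim_seq_ext (fun n => / (0 + INR n) ^ S N)); [intros; now rewrite Rplus_0_l|].
      apply is_lim_seq_shift_inv_pow. }
  set (c := K / INR (S N)).
  assert (HN : 0 < INR (S N)) by (apply lt_0_INR; lia).
  assert (Hc : forall s z, (s = 1 \/ s = -1) -> 2 <= z -> 0 <= s * rem z + c / z ^ S N).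
  { intros s z Hs Hz.
    assert (Hlim' : is_lim_seq (fun n => s * rem (INR n) + c * / INR n ^ S N) 0).
    { replace (Finite 0) with (Finite (s * 0 + c * 0)) by (f_equal; ring).
      apply is_lim_seq_plus'.
      - apply (is_lim_seq_scal_l _ s 0 HRlim).
      - apply (is_lim_seq_scal_l _ c 0).
        apply (is_lim_seq_ext (fun n => / (0 + INR n) ^ S N)); [intros; now rewrite Rplus_0_l|].
        apply is_lim_seq_shift_inv_pow. }
    destruct (nfloor_ex z) as [n0 Hn0]; [lra|].
    refine (is_lim_seq_le_loc _ _ (Finite _) (Finite _) _ Hlim' (is_lim_seq_const _)).
    exists (S n0). intros n Hn.
    assert (Hzn : z < INR n).
    { apply le_INR in Hn. rewrite S_INR in Hn. lra. }
    destruct (mean_value (fun z => s * rem z + c / z ^ S N)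
       (fun z => s * r z - K / z ^ S (S N)) z (INR n)) as [d [Hd Ed]].
    - intros t. rewrite Rmin_left, Rmax_right by lra. intros Ht.
      apply (is_derive_plus (fun z => s * rem z) (fun z => c / z ^ S N) t (s * r t) (- (K / t ^ S (S N)))).
      + apply is_derive_scal, HR. lra.
      + assert (Hp : forall k, t ^ k <> 0) by (intros; apply pow_nonzero; lra).
        auto_derive; [apply (Hp (S N))|].
        change (match N with | 0%nat => 1 | S _ => INR N + 1 end) with (INR (S N)).
        unfold c. simpl pred. simpl (t ^ _). field. repeat split; try apply Hp; lra.
    - rewrite Rmin_left, Rmax_right in Hd by lra.
      assert (Hb := HK d ltac:(lra)). fold (r d) in Hb. apply Rabs_le_between in Hb.
      assert (s * r d - K / d ^ S (S N) <= 0) by (destruct Hs as [-> | ->]; lra).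
      assert ((s * r d - K / d ^ S (S N)) * (INR n - z) <= 0) by nra.
      unfold Rdiv at 1 in Ed. lra. }
  exists c. intros z Hz. fold (rem z).
  assert (Hp := Hc 1 z (or_introl eq_refl) Hz). assert (Hm := Hc (-1) z (or_intror eq_refl) Hz).
  apply Rabs_le. lra.
Qed.

(** * Euler-Maclaurin summation *)

(** The Bernoulli polynomial [B_3]. *)
Definition bern3 (y : R) : R := y ^ 3 - 3 / 2 * y ^ 2 + / 2 * y.

Lemma bern3_bound (y : R) : 0 <= y <= 1 -> Rabs (bern3 y) <= 1.
Proof.
  intros Hy. unfold bern3. apply Rabs_le.
  assert (0 <= y ^ 2 <= 1) by nra. assert (0 <= y ^ 3 <= 1) by (simpl in *; nra). split; nra.
Qed.

Lemma is_derive_prod (f g : R -> R) (x df dg : R) :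
  is_derive f x df -> is_derive g x dg ->
  is_derive (fun t => f t * g t) x (df * g x + f x * dg).
Proof.
  intros Hf Hg. apply (is_derive_mult f g x df dg Hf Hg). exact Rmult_comm.
Qed.

(** Three integrations by parts, here in the form of an explicit antiderivative
    built from the Bernoulli polynomials [B_1, B_2, B_3]. *)
Lemma euler_maclaurin_unit (F f f1 f2 f3 : R -> R) (k : R) :
  (forall x, k <= x <= k + 1 -> is_derive F x (f x)) ->
  (forall x, k <= x <= k + 1 -> is_derive f x (f1 x)) ->
  (forall x, k <= x <= k + 1 -> is_derive f1 x (f2 x)) ->
  (forall x, k <= x <= k + 1 -> is_derive f2 x (f3 x)) ->
  (forall x, k <= x <= k + 1 -> continuous f3 x) ->
  is_RInt (fun y => bern3 y * f3 (k + y)) 0 1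
    (6 * (/ 2 * (f k + f (k + 1)) - (F (k + 1) - F k) - / 12 * (f1 (k + 1) - f1 k))).
Proof.
  intros HF Hf Hf1 Hf2 Hf3.
  assert (Hsh : forall (g : R -> R) (dg : R -> R) y, 0 <= y <= 1 ->
     (forall x, k <= x <= k + 1 -> is_derive g x (dg x)) -> is_derive (fun y => g (k + y)) y (dg (k + y))).
  { intros g dg y Hy Hg.
    replace (dg (k + y)) with (1 * dg (k + y)) by ring.
    apply (is_derive_comp g (fun y => k + y)); [apply Hg; lra|].
    auto_derive; [easy|ring]. }
  set (G := fun y => bern3 y * f2 (k + y) + ((-3 * (y ^ 2 - y + / 6)) * f1 (k + y)
     + ((6 * (y - / 2)) * f (k + y) + -6 * F (k + y)))).
  replace (6 * _) with (minus (G 1) (G 0)).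
  - apply (is_RInt_derive G).
    + intros y. rewrite Rmin_left, Rmax_right by lra. intros Hy. unfold G.
      replace (bern3 y * f3 (k + y)) with ((3 * y ^ 2 - 3 * y + / 2) * f2 (k + y) + bern3 y * f3 (k + y)
        + ((-3 * (2 * y - 1) * f1 (k + y) + (-3 * (y ^ 2 - y + / 6)) * f2 (k + y))
        + ((6 * f (k + y) + 6 * (y - / 2) * f1 (k + y)) + -6 * f (k + y)))) by field.
      apply @is_derive_plus; [|apply @is_derive_plus; [|apply @is_derive_plus]].
      * apply (is_derive_prod bern3 (fun y => f2 (k + y))); [unfold bern3; auto_derive; [easy|field]|now apply (Hsh f2 f3)].
      * apply (is_derive_prod (fun y => -3 * (y ^ 2 - y + / 6)) (fun y => f1 (k + y))); [auto_derive; [easy|field]|now apply (Hsh f1 f2)].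
      * apply (is_derive_prod (fun y => 6 * (y - / 2)) (fun y => f (k + y))); [auto_derive; [easy|field]|now apply (Hsh f f1)].
      * apply is_derive_scal. now apply (Hsh F f).
    + intros y. rewrite Rmin_left, Rmax_right by lra. intros Hy.
      apply (continuous_mult bern3 (fun y => f3 (k + y))).
      * apply (ex_derive_continuous bern3). unfold bern3. auto_derive. easy.
      * apply (continuous_comp (fun y => k + y) f3); [|apply Hf3; lra].
        apply (ex_derive_continuous (fun y => k + y)). auto_derive. easy.
  - unfold G, bern3, minus, plus, opp; simpl. rewrite Rplus_0_r. field.
Qed.

Lemma inv_cube_telescope (x : R) : 1 <= x -> / x ^ 3 <= 2 * (/ x ^ 2 - / (x + 1) ^ 2).
Proof.
  intros Hx. replace (2 * (/ x ^ 2 - / (x + 1) ^ 2))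
    with (/ x ^ 3 * (2 * (2 * x + 1) * x / (x + 1) ^ 2)) by (field; lra).
  rewrite <- (Rmult_1_r (/ x ^ 3)) at 1. apply Rmult_le_compat_l.
  - apply Rlt_le, Rinv_0_lt_compat, pow_lt; lra.
  - apply (Rmult_le_reg_r ((x + 1) ^ 2)); [apply pow_lt; lra|].
    unfold Rdiv. rewrite Rmult_assoc, Rinv_l by (apply pow_nonzero; lra). nra.
Qed.

Lemma is_lim_seq_inv_S_pow (n : nat) : is_lim_seq (fun k => / INR (S k) ^ S n) 0.
Proof.
  apply (is_lim_seq_incr_1 (fun k => / INR k ^ S n)).
  apply (is_lim_seq_ext (fun k => / (0 + INR k) ^ S n)); [intros; now rewrite Rplus_0_l|].
  apply is_lim_seq_shift_inv_pow.
Qed.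

(** [s n - 2K/(n+1)^2] increases and [s n + 2K/(n+1)^2] decreases, so the limit
    lies between them. *)
Lemma lim_of_cubic_increments (s : nat -> R) (K : R) :
  (forall n, Rabs (s (S n) - s n) <= K * / INR (S n) ^ 3) ->
  exists l, is_lim_seq s (Finite l) /\ forall n, Rabs (s n - l) <= 2 * K * / INR (S n) ^ 2.
Proof.
  intros Hs.
  assert (HK : 0 <= K).
  { specialize (Hs 0%nat). assert (H := Rabs_pos (s 1%nat - s 0%nat)). 
    change (INR 1) with 1 in Hs. rewrite pow1, Rinv_1 in Hs. lra. }
  assert (Ha : forall n, s n - 2 * K * / INR (S n) ^ 2 <= s (S n) - 2 * K * / INR (S (S n)) ^ 2
    /\ s (S n) + 2 * K * / INR (S (S n)) ^ 2 <= s n + 2 * K * / INR (S n) ^ 2).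
  { intros n. specialize (Hs n). apply Rabs_le_between in Hs.
    assert (H := inv_cube_telescope (INR (S n)) (INR_S_ge1 n)). rewrite <- S_INR in H.
    apply (Rmult_le_compat_l K) in H; [|easy]. split; lra. }
  assert (Hp : forall n, 0 <= 2 * K * / INR (S n) ^ 2).
  { intros n. apply Rmult_le_pos; [lra|]. apply Rlt_le, Rinv_0_lt_compat, pow_lt.
    assert (H := INR_S_ge1 n). lra. }
  assert (Hd : forall n, s n + 2 * K * / INR (S n) ^ 2 <= s 0%nat + 2 * K * / INR 1 ^ 2).
  { induction n as [|n IH]; [lra|]. eapply Rle_trans; [apply Ha|apply IH]. }
  destruct (ex_finite_lim_seq_incr (fun n => s n - 2 * K * / INR (S n) ^ 2)
     (s 0%nat + 2 * K * / INR 1 ^ 2)) as [l Hl].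
  { intros n. apply Ha. }
  { intros n. specialize (Hd n). specialize (Hp n). lra. }
  assert (Hz : is_lim_seq (fun n => 2 * K * / INR (S n) ^ 2) 0).
  { replace (Finite 0) with (Finite (2 * K * 0)) by (f_equal; ring).
    apply (is_lim_seq_scal_l _ (2 * K) 0). apply is_lim_seq_inv_S_pow. }
  exists l. split.
  - replace (Finite l) with (Finite (l + 0)) by (f_equal; ring).
    apply (is_lim_seq_ext (fun n => (s n - 2 * K * / INR (S n) ^ 2) + 2 * K * / INR (S n) ^ 2)); [intros; ring|].
    now apply is_lim_seq_plus'.
  - intros n.
    assert (H1 := is_lim_seq_incr_compare _ _ Hl (fun n => proj1 (Ha n)) n). cbv beta in H1.
    assert (Hl2 : is_lim_seq (fun n => s n + 2 * K * / INR (S n) ^ 2) l).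
    { replace (Finite l) with (Finite (l + (0 + 0))) by (f_equal; ring).
      apply (is_lim_seq_ext (fun n => (s n - 2 * K * / INR (S n) ^ 2) +
         (2 * K * / INR (S n) ^ 2 + 2 * K * / INR (S n) ^ 2))); [intros; ring|].
      apply is_lim_seq_plus'; [easy|]. now apply is_lim_seq_plus'. }
    assert (H2 := is_lim_seq_decr_compare _ _ Hl2 (fun n => proj2 (Ha n)) n). cbv beta in H2.
    apply Rabs_le. lra.
Qed.

Definition harmonic (n : nat) : R := sum_f_R0 (fun k => / INR (S k)) n.
Definition lnfact (n : nat) : R := ln (INR (fact n)).

Lemma lnfact_S (n : nat) : lnfact (S n) = ln (INR (S n)) + lnfact n.
Proof.
  unfold lnfact. rewrite fact_simpl, mult_INR. apply ln_mult.
  - apply lt_0_INR; lia.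
  - apply INR_fact_lt_0.
Qed.

Lemma euler_maclaurin_unit_bound (F f f1 f2 f3 : R -> R) (k M : R) :
  (forall x, k <= x <= k + 1 -> is_derive F x (f x)) ->
  (forall x, k <= x <= k + 1 -> is_derive f x (f1 x)) ->
  (forall x, k <= x <= k + 1 -> is_derive f1 x (f2 x)) ->
  (forall x, k <= x <= k + 1 -> is_derive f2 x (f3 x)) ->
  (forall x, k <= x <= k + 1 -> continuous f3 x) ->
  (forall x, k <= x <= k + 1 -> Rabs (f3 x) <= M) ->
  Rabs (/ 2 * (f k + f (k + 1)) - (F (k + 1) - F k) - / 12 * (f1 (k + 1) - f1 k)) <= M / 6.
Proof.
  intros HF Hf Hf1 Hf2 Hf3 HM.
  assert (HI := euler_maclaurin_unit F f f1 f2 f3 k HF Hf Hf1 Hf2 Hf3).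
  apply (norm_RInt_le_const _ 0 1 _ M) in HI; [|lra|].
  - change (norm ?x) with (Rabs x) in HI. rewrite Rabs_mult, (Rabs_right 6) in HI; lra.
  - intros y Hy. change (norm ?x) with (Rabs x). rewrite Rabs_mult.
    replace M with (1 * M) by ring.
    apply Rmult_le_compat; try apply Rabs_pos; [now apply bern3_bound|apply HM; lra].
Qed.

(** Stirling's formula with an unknown constant: the increments are
    Euler-Maclaurin errors for the logarithm. *)
Lemma lnfact_expansion_constant : exists c K, forall n,
  Rabs (lnfact (S n) - (INR (S n) + / 2) * ln (INR (S n)) + INR (S n) - / (12 * INR (S n)) - c)
  <= K * / INR (S n) ^ 2.
Proof.
  destruct (lim_of_cubic_increments (fun n => lnfact (S n) - (INR (S n) + / 2) * ln (INR (S n))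
     + INR (S n) - / (12 * INR (S n))) (1 / 3)) as [c [_ Hc]]; [|now exists c, (2 * (1 / 3))].
  intros n. rewrite (lnfact_S (S n)), (S_INR (S n)). assert (Hx := INR_S_ge1 n).
  generalize dependent (INR (S n)). intros x Hx.
  replace (1 / 3 * / x ^ 3) with (2 * / x ^ 3 / 6) by (field; lra).
  replace (_ - _) with (/ 2 * (ln x + ln (x + 1)) - (((x + 1) * ln (x + 1) - (x + 1)) - (x * ln x - x))
      - / 12 * (/ (x + 1) - / x)) by (field; lra).
  apply (euler_maclaurin_unit_bound (fun t => t * ln t - t) ln (fun t => / t) (fun t => - / t ^ 2) (fun t => 2 * / t ^ 3));
   intros t Ht.
  - auto_derive; [lra|field; lra].
  - auto_derive; [lra|field; lra].
  - auto_derive; [lra|field; lra].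
  - auto_derive; [nra|field; lra].
  - apply (ex_derive_continuous (fun t => 2 * / t ^ 3)). auto_derive. 
    apply (pow_nonzero t 3); lra.
  - rewrite Rabs_right.
    + apply Rmult_le_compat_l; [lra|]. apply Rinv_le_contravar; [apply pow_lt; lra|].
      apply pow_incr; lra.
    + apply Rle_ge, Rmult_le_pos; [lra|]. apply Rlt_le, Rinv_0_lt_compat, pow_lt; lra.
Qed.

(** The limit of [H_n - ln n] is the defining limit of [euler_gamma], so the
    constant is known here. *)
Lemma harmonic_expansion : exists K, forall n,
  Rabs (harmonic n - ln (INR (S n)) - / (2 * INR (S n)) - euler_gamma) <= K * / INR (S n) ^ 2.
Proof.
  destruct (lim_of_cubic_increments (fun n => harmonic n - ln (INR (S n)) - / (2 * INR (S n))) 2)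
    as [c [Hlim Hc]].
  - intros n. unfold harmonic. rewrite tech5, (S_INR (S n)). assert (Hx := INR_S_ge1 n).
    generalize dependent (INR (S n)). intros x Hx.
    assert (HE : Rabs (/ 2 * (/ x + / (x + 1)) - (ln (x + 1) - ln x)
      - / 12 * (- / (x + 1) ^ 2 - (- / x ^ 2))) <= 6 * / x ^ 4 / 6).
    { apply (euler_maclaurin_unit_bound ln (fun t => / t) (fun t => - / t ^ 2) (fun t => 2 * / t ^ 3)
        (fun t => -6 * / t ^ 4)); intros t Ht.
      - auto_derive; [lra|field; lra].
      - auto_derive; [lra|field; lra].
      - auto_derive; [nra|field; lra].
      - auto_derive; [apply (pow_nonzero t 3); lra|field; lra].
      - apply (ex_derive_continuous (fun t => -6 * / t ^ 4)). auto_derive. 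
        apply (pow_nonzero t 4); lra.
      - rewrite Rabs_mult, Rabs_left, Rabs_right by
         (try lra; apply Rle_ge, Rlt_le, Rinv_0_lt_compat, pow_lt; lra).
        apply Rmult_le_compat; [lra| |lra|].
        + apply Rlt_le, Rinv_0_lt_compat, pow_lt; lra.
        + apply Rinv_le_contravar; [apply pow_lt; lra|]. apply pow_incr; lra. }
    assert (H4 : 6 * / x ^ 4 / 6 <= / x ^ 3).
    { replace (6 * / x ^ 4 / 6) with (/ x ^ 4) by (field; lra).
      apply pow_div_le; [lra|lia]. }
    assert (H2 : 0 <= / x ^ 2 - / (x + 1) ^ 2 <= 3 * / x ^ 3).
    { split.
      - assert (/ (x + 1) ^ 2 <= / x ^ 2); [|lra].
        apply Rinv_le_contravar; [apply pow_lt; lra|]. apply pow_incr; lra.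
      - replace (/ x ^ 2 - / (x + 1) ^ 2) with (/ x ^ 3 * ((2 * x + 1) * x / (x + 1) ^ 2)) by (field; lra).
        rewrite Rmult_comm. apply Rmult_le_compat_r; [apply Rlt_le, Rinv_0_lt_compat, pow_lt; lra|].
        apply (Rmult_le_reg_r ((x + 1) ^ 2)); [apply pow_lt; lra|].
        unfold Rdiv. rewrite Rmult_assoc, Rinv_l by (apply pow_nonzero; lra). nra. }
    replace (_ - _) with ((/ 2 * (/ x + / (x + 1)) - (ln (x + 1) - ln x)
      - / 12 * (- / (x + 1) ^ 2 - (- / x ^ 2))) + / 12 * (/ x ^ 2 - / (x + 1) ^ 2)) by (field; lra).
    apply Rabs_le_between in HE. apply Rabs_le. lra.
  - exists (2 * 2). replace euler_gamma with c; [exact Hc|].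
    unfold euler_gamma. rewrite (is_lim_seq_unique _ c); [reflexivity|].
    replace (Finite c) with (Finite (c + / 2 * 0)) by (f_equal; ring).
    apply (is_lim_seq_ext (fun n => (harmonic n - ln (INR (S n)) - / (2 * INR (S n)))
      + / 2 * / INR (S n) ^ 1)).
    + intros n. fold (harmonic n). assert (Hx := INR_S_ge1 n). field. lra.
    + apply is_lim_seq_plus'; [exact Hlim|].
      apply (is_lim_seq_scal_l _ (/ 2) 0). apply is_lim_seq_inv_S_pow.
Qed.

(** * Wallis' product and Stirling's formula *)

Definition wallis (n : nat) : R := RInt (fun x => sin x ^ n) 0 (PI / 2).

Lemma ex_wallis (n : nat) : ex_RInt (fun x => sin x ^ n) 0 (PI / 2).
Proof.
  apply (ex_RInt_continuous (V := R_CompleteNormedModule)). intros x _.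
  apply (ex_derive_continuous (fun x => sin x ^ n)). auto_derive. easy.
Qed.

(** Integration by parts: [- cos x * sin x ^ (n+1)] vanishes at both ends. *)
Lemma wallis_rec (n : nat) : INR (n + 2) * wallis (n + 2) = INR (n + 1) * wallis n.
Proof.
  assert (H : is_RInt (fun x => INR (n + 2) * sin x ^ (n + 2) - INR (n + 1) * sin x ^ n) 0 (PI / 2)
    (minus (- cos (PI / 2) * sin (PI / 2) ^ (n + 1)) (- cos 0 * sin 0 ^ (n + 1)))).
  { apply (is_RInt_derive (fun x => - cos x * sin x ^ (n + 1))).
    - intros x _. auto_derive; [easy|].
      replace (n + 2)%nat with (S (S n)) by lia. replace (n + 1)%nat with (S n) by lia.
      rewrite (S_INR (S n)). simpl pred. 
      assert (Hc : cos x * cos x = 1 - sin x * sin x).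
      { assert (H := sin2_cos2 x). unfold Rsqr in H. lra. }
      change (match n with | 0%nat => 1 | S _ => INR n + 1 end) with (INR (S n)).
      simpl pow. replace (- cos x * (INR (S n) * (1 * cos x) * sin x ^ n)) with
        (- (INR (S n) * sin x ^ n) * (cos x * cos x)) by ring.
      ring_simplify. replace (cos x ^ 2) with (1 - sin x * sin x) by (rewrite <- Hc; ring). ring.
    - intros x _. 
      apply (ex_derive_continuous (fun x => INR (n + 2) * sin x ^ (n + 2) - INR (n + 1) * sin x ^ n)).
      auto_derive. easy. }
  assert (H' : is_RInt (fun x => INR (n + 2) * sin x ^ (n + 2) - INR (n + 1) * sin x ^ n) 0 (PI / 2)
    (INR (n + 2) * wallis (n + 2) - INR (n + 1) * wallis n)).
  { apply (is_RInt_minus (V := R_NormedModule)).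
    - apply (is_RInt_scal (V := R_NormedModule)). apply (RInt_correct (V := R_CompleteNormedModule)), ex_wallis.
    - apply (is_RInt_scal (V := R_NormedModule)). apply (RInt_correct (V := R_CompleteNormedModule)), ex_wallis. }
  apply (is_RInt_unique (V := R_CompleteNormedModule)) in H, H'. rewrite H in H'.
  unfold minus, plus, opp in H'; simpl in H'. rewrite cos_PI2, sin_0 in H'.
  rewrite pow_i in H' by lia. lra.
Qed.

Lemma wallis_0 : wallis 0 = PI / 2.
Proof.
  unfold wallis. rewrite (RInt_ext _ (fun _ => 1)) by (intros; reflexivity).
  rewrite RInt_const. unfold scal; simpl. unfold mult; simpl. ring.
Qed.

Lemma wallis_1 : wallis 1 = 1.
Proof.
  unfold wallis. apply (is_RInt_unique (V := R_CompleteNormedModule)).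
  replace 1 with (minus (- cos (PI / 2)) (- cos 0)).
  - apply (is_RInt_derive (fun x => - cos x)).
    + intros x _. auto_derive; [easy|ring].
    + intros x _. apply (ex_derive_continuous (fun x => sin x ^ 1)). auto_derive. easy.
  - rewrite cos_PI2, cos_0. unfold minus, plus, opp; simpl. ring.
Qed.

Lemma wallis_decr (n : nat) : 0 <= wallis (S n) <= wallis n.
Proof.
  assert (HPI := PI_RGT_0).
  assert (Hs : forall x, 0 < x < PI / 2 -> 0 <= sin x <= 1).
  { intros x Hx. split; [apply sin_ge_0; lra|apply SIN_bound]. }
  split.
  - apply RInt_ge_0; [lra|apply ex_wallis|]. intros x Hx. apply pow_le. now apply Hs.
  - apply RInt_le; [lra|apply ex_wallis|apply ex_wallis|].
    intros x Hx. specialize (Hs x Hx). simpl.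
    assert (0 <= sin x ^ n) by now apply pow_le. nra.
Qed.

Lemma wallis_product (n : nat) : INR (S n) * wallis (S n) * wallis n = PI / 2.
Proof.
  induction n as [|n IH].
  - rewrite wallis_0, wallis_1. simpl. ring.
  - assert (H := wallis_rec n). replace (n + 2)%nat with (S (S n)) in H by lia.
    replace (n + 1)%nat with (S n) in H by lia. rewrite H. rewrite <- IH. ring.
Qed.

Lemma wallis_even (n : nat) :
  wallis (2 * n) = PI / 2 * (INR (fact (2 * n)) / (4 ^ n * INR (fact n) ^ 2)).
Proof.
  induction n as [|n IH].
  - simpl (2 * 0)%nat. rewrite wallis_0. simpl. field.
  - assert (H := wallis_rec (2 * n)). replace (2 * S n)%nat with (2 * n + 2)%nat by lia.
    rewrite IH in H.
    assert (Hn : INR (2 * n + 2) <> 0) by (apply not_0_INR; lia).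
    apply (Rmult_eq_reg_l (INR (2 * n + 2))); [|easy]. rewrite H.
    replace (2 * n + 2)%nat with (S (S (2 * n))) by lia.
    rewrite (fact_simpl (S (2 * n))), (fact_simpl (2 * n)), (fact_simpl n), !mult_INR.
    replace (2 * n + 1)%nat with (S (2 * n)) by lia.
    replace (INR (S (S (2 * n)))) with (2 * INR (S n)) by (rewrite !S_INR, mult_INR; simpl; ring).
    assert (Hx : INR (S n) <> 0) by (apply not_0_INR; lia).
    assert (H4 : 4 ^ n <> 0) by (apply pow_nonzero; lra).
    rewrite <- (tech_pow_Rmult 4 n). field. repeat split; try apply INR_fact_neq_0; easy.
Qed.

(** Wallis' product in logarithmic form. With
    [p = (2n)!/(4^n n!^2) = 2/pi * int sin^(2n)], monotonicity of the integrals
    squeezes [n p^2] between two sequences of limit [1/pi]. *)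
Lemma ln_fact_ratio_lim : is_lim_seq (fun n =>
  2 * (lnfact (2 * S n) - INR (2 * S n) * ln 2 - 2 * lnfact (S n)) + ln (INR (S n))) (- ln PI).
Proof.
  assert (HPI := PI_RGT_0).
  assert (Hp : forall n, 0 < INR (fact (2 * S n)) / (4 ^ S n * INR (fact (S n)) ^ 2)).
  { intros n. apply Rdiv_lt_0_compat; [apply INR_fact_lt_0|].
    apply Rmult_lt_0_compat; [apply pow_lt; lra|]. apply pow_lt, INR_fact_lt_0. }
  assert (Hl : forall n, 2 * (lnfact (2 * S n) - INR (2 * S n) * ln 2 - 2 * lnfact (S n)) + ln (INR (S n))
    = ln (INR (S n) * (INR (fact (2 * S n)) / (4 ^ S n * INR (fact (S n)) ^ 2)) ^ 2)).
  { intros n. rewrite ln_mult; [|apply lt_0_INR; lia|apply pow_lt, Hp].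
    rewrite ln_pow by apply Hp. 
    rewrite ln_div; [|apply INR_fact_lt_0|].
    2: { apply Rmult_lt_0_compat; [apply pow_lt; lra|]. apply pow_lt, INR_fact_lt_0. }
    rewrite ln_mult; [|apply pow_lt; lra|apply pow_lt, INR_fact_lt_0].
    rewrite ln_pow by lra. rewrite ln_pow by apply INR_fact_lt_0.
    replace 4 with (2 * 2) by ring. rewrite ln_mult by lra. rewrite mult_INR. unfold lnfact.
    simpl (INR 2). ring. }
  apply (is_lim_seq_ext _ _ _ (fun n => eq_sym (Hl n))).
  replace (- ln PI) with (ln (/ PI)) by (now rewrite ln_Rinv).
  apply (is_lim_seq_continuous ln _ (/ PI)).
  { apply derivable_continuous_pt. exists (/ / PI). apply derivable_pt_lim_ln. now apply Rinv_0_lt_compat. }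
  apply (is_lim_seq_le_le (fun n => / PI - / PI * / INR (S n) ^ 1) _ (fun n => / PI)).
  - intros n. set (p := INR (fact (2 * S n)) / (4 ^ S n * INR (fact (S n)) ^ 2)).
    assert (Hw := wallis_even (S n)). fold p in Hw. specialize (Hp n). fold p in Hp.
    assert (H1 := wallis_product (2 * S n)).
    assert (H2 := wallis_product (2 * n + 1)).
    replace (S (2 * n + 1)) with (2 * S n)%nat in H2 by lia.
    assert (D1 := wallis_decr (2 * S n)).
    assert (D2 := wallis_decr (2 * n + 1)).
    replace (S (2 * n + 1)) with (2 * S n)%nat in D2 by lia.
    rewrite Hw in *. rewrite S_INR, mult_INR in H1. rewrite mult_INR in H2.
    simpl (INR 2) in *. assert (Hx := INR_S_ge1 n). set (x := INR (S n)) in *.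
    clearbody p x.
    assert (Hq : 0 < PI / 2 * p) by (apply Rmult_lt_0_compat; lra).
    (* [PI/2 * p] is the integral of index [2(n+1)], compared with its two
       neighbours in the product [(m+1) W_(m+1) W_m = pi/2]. *)
    assert (U : (1 + 1) * x * (PI / 2 * p) * (PI / 2 * p) <= PI / 2).
    { apply Rle_trans with ((1 + 1) * x * (PI / 2 * p) * wallis (2 * n + 1)); [|lra].
      apply Rmult_le_compat_l; [nra|lra]. }
    assert (L : PI / 2 <= ((1 + 1) * x + 1) * (PI / 2 * p) * (PI / 2 * p)).
    { apply Rle_trans with (((1 + 1) * x + 1) * wallis (S (2 * S n)) * (PI / 2 * p)); [lra|].
      apply Rmult_le_compat_r; [lra|]. apply Rmult_le_compat_l; lra. }
    assert (E : x * p ^ 2 * PI = 2 / PI * ((1 + 1) * x * (PI / 2 * p) * (PI / 2 * p))) by (field; lra).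
    assert (Hi : 0 < 2 / PI) by (apply Rdiv_lt_0_compat; lra).
    assert (E1 : 2 / PI * (PI / 2) = 1) by (field; lra).
    assert (U' : x * p ^ 2 * PI <= 1) 
      by (rewrite E; apply Rle_trans with (2 / PI * (PI / 2)); [apply Rmult_le_compat_l; lra|lra]).
    assert (L' : 1 <= 2 / PI * (((1 + 1) * x + 1) * (PI / 2 * p) * (PI / 2 * p)))
      by (apply Rle_trans with (2 / PI * (PI / 2)); [lra|apply Rmult_le_compat_l; lra]).
    replace (2 / PI * (((1 + 1) * x + 1) * (PI / 2 * p) * (PI / 2 * p)))
      with (x * p ^ 2 * PI * (1 + / (2 * x))) in L' by (field; lra).
    assert (Hxi : 0 < / x) by (apply Rinv_0_lt_compat; lra).
    assert (Hx2 : / (2 * x) = / 2 * / x) by (field; lra). rewrite Hx2 in L'.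
    assert (L'' : 1 - / x <= x * p ^ 2 * PI) by nra.
    assert (HPi : 0 < / PI) by now apply Rinv_0_lt_compat.
    rewrite pow_1. split.
    + apply (Rmult_le_reg_r PI); [easy|]. 
      replace ((/ PI - / PI * / x) * PI) with (1 - / x) by (field; lra). exact L''.
    + apply (Rmult_le_reg_r PI); [easy|]. rewrite Rinv_l by lra. exact U'.
  - replace (Finite (/ PI)) with (Finite (/ PI - / PI * 0)) by (f_equal; ring).
    apply is_lim_seq_minus'; [apply is_lim_seq_const|].
    apply (is_lim_seq_scal_l _ (/ PI) 0), is_lim_seq_inv_S_pow.
  - apply is_lim_seq_const.
Qed.

Lemma is_lim_seq_of_bound (u : nat -> R) (l K : R) (m : nat) :
  (forall n, Rabs (u n - l) <= K * / INR (S n) ^ S m) -> is_lim_seq u l.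
Proof.
  intros H.
  apply (is_lim_seq_le_le (fun n => l - K * / INR (S n) ^ S m) _ (fun n => l + K * / INR (S n) ^ S m)).
  - intros n. specialize (H n). apply Rabs_le_between in H. lra.
  - replace (Finite l) with (Finite (l - K * 0)) by (f_equal; ring).
    apply is_lim_seq_minus'; [apply is_lim_seq_const|]. apply (is_lim_seq_scal_l _ K 0), is_lim_seq_inv_S_pow.
  - replace (Finite l) with (Finite (l + K * 0)) by (f_equal; ring).
    apply is_lim_seq_plus'; [apply is_lim_seq_const|]. apply (is_lim_seq_scal_l _ K 0), is_lim_seq_inv_S_pow.
Qed.

Definition stirling_error (n : nat) : R :=
  lnfact n - (INR n + / 2) * ln (INR n) + INR n - / (12 * INR n) - / 2 * ln (2 * PI).

(** If the constant is [c], the logarithm of Wallis' ratio tends to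
    [ln 2 - 2c], which identifies [c] as [ln(2 pi)/2]. *)
Lemma stirling : exists K, forall n, Rabs (stirling_error (S n)) <= K * / INR (S n) ^ 2.
Proof.
  destruct lnfact_expansion_constant as (c & K & H). exists K.
  enough (Hc : c = / 2 * ln (2 * PI)) by (intros n; unfold stirling_error; rewrite <- Hc; apply H).
  set (s := fun n => lnfact (S n) - (INR (S n) + / 2) * ln (INR (S n)) + INR (S n) - / (12 * INR (S n))).
  assert (L1 : is_lim_seq s c) by (apply (is_lim_seq_of_bound s c K 1); exact H).
  assert (L2 : is_lim_seq (fun n => s (2 * n + 1)%nat) c).
  { apply (is_lim_seq_subseq s c (fun n => (2 * n + 1)%nat)); [|exact L1].
    apply eventually_subseq. intros n; lia. }
  assert (L3 : is_lim_seq (fun n =>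
     2 * (lnfact (2 * S n) - INR (2 * S n) * ln 2 - 2 * lnfact (S n)) + ln (INR (S n)))
     (2 * (c - 2 * c - (/ 8) * 0) + ln 2)).
  { apply (is_lim_seq_ext (fun n => 2 * (s (2 * n + 1)%nat - 2 * s n - / 8 * / INR (S n) ^ 1) + ln 2)).
    - intros n. unfold s. replace (S (2 * n + 1)) with (2 * S n)%nat by lia.
      rewrite mult_INR. assert (Hx := INR_S_ge1 n). simpl (INR 2).
      rewrite ln_mult by lra. replace (1 + 1) with 2 by ring. field. lra.
    - apply is_lim_seq_plus'; [|apply is_lim_seq_const].
      apply (is_lim_seq_scal_l _ 2 (c - 2 * c - / 8 * 0)).
      apply is_lim_seq_minus'.
      + apply is_lim_seq_minus'; [exact L2|]. apply (is_lim_seq_scal_l _ 2 c L1).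
      + apply (is_lim_seq_scal_l _ (/ 8) 0), is_lim_seq_inv_S_pow. }
  apply is_lim_seq_unique in L3. rewrite (is_lim_seq_unique _ _ ln_fact_ratio_lim) in L3.
  injection L3. assert (HPI := PI_RGT_0). rewrite ln_mult by lra. lra.
Qed.

(** * The values at the integers *)

Lemma ln_le_sub_1 (x : R) : 0 < x -> ln x <= x - 1.
Proof.
  intros Hx. assert (H := exp_ineq1_le (ln x)). rewrite exp_ln in H by easy. lra.
Qed.

Lemma ln_ratio_lim (c : R) : 0 <= c ->
  is_lim_seq (fun n => ln (INR (S n) + c) - ln (INR (S n))) 0.
Proof.
  intros Hc. apply (is_lim_seq_of_bound _ _ c 0). intros n. assert (Hx := INR_S_ge1 n).
  set (x := INR (S n)) in *. clearbody x. rewrite <- ln_div, Rminus_0_r, pow_1 by lra.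
  assert (H := ln_le_sub_1 ((x + c) / x) ltac:(apply Rdiv_lt_0_compat; lra)).
  replace ((x + c) / x - 1) with (c * / x) in H by (field; lra).
  rewrite Rabs_right; [easy|]. apply Rle_ge. rewrite <- ln_1. apply ln_le; [lra|].
  apply (Rmult_le_reg_r x); [lra|]. unfold Rdiv. rewrite Rmult_assoc, Rinv_l; lra.
Qed.

Lemma harmonic_lim : is_lim_seq (fun n => harmonic n - ln (INR (S n))) euler_gamma.
Proof.
  destruct harmonic_expansion as [K HK].
  replace (Finite euler_gamma) with (Finite (euler_gamma + / 2 * 0)) by (f_equal; ring).
  apply (is_lim_seq_ext (fun n => (harmonic n - ln (INR (S n)) - / (2 * INR (S n)))
      + / 2 * / INR (S n) ^ 1)).
  - intros n. assert (Hx := INR_S_ge1 n). field. lra.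
  - apply is_lim_seq_plus'; [apply (is_lim_seq_of_bound _ _ K 1); exact HK|].
    apply (is_lim_seq_scal_l _ (/ 2) 0), is_lim_seq_inv_S_pow.
Qed.

Lemma harmonic_telescope (N : nat) :
  is_series (fun n => / INR (S n) - / (INR (S n) + INR (S N))) (harmonic N).
Proof.
  assert (Hstep : forall N, is_series (fun n => / (INR (S n) + INR N) - / (INR (S n) + INR (S N))) (/ INR (S N))).
  { intros M. change (is_lim_seq (sum_n (fun n => / (INR (S n) + INR M) - / (INR (S n) + INR (S M)))) (/ INR (S M))).
    replace (Finite (/ INR (S M))) with (Finite (/ INR (S M) - 0)) by (f_equal; ring).
    apply (is_lim_seq_ext (fun n => / INR (S M) - / (INR (S M) + INR (S n)) ^ 1)).
    - intros n. assert (HM := pos_INR M). induction n as [|n IH].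
      + rewrite sum_O, pow_1. rewrite !S_INR. simpl (INR 0). field. lra.
      + rewrite sum_Sn, <- IH, 2!pow_1. assert (Hx := INR_S_ge1 n).
        rewrite (S_INR (S n)). change (plus ?a ?b) with (a + b). rewrite (S_INR M).
        field. lra.
    - apply is_lim_seq_minus'; [apply is_lim_seq_const|].
      apply (is_lim_seq_incr_1 (fun n => / (INR (S M) + INR n) ^ 1)).
      apply is_lim_seq_shift_inv_pow. }
  induction N as [|N IH].
  - unfold harmonic. simpl sum_f_R0. generalize (Hstep 0%nat). apply is_series_ext.
    intros n. simpl (INR 0). now rewrite Rplus_0_r.
  - unfold harmonic. rewrite tech5. fold (harmonic N).
    assert (E : forall n, (/ INR (S n) - / (INR (S n) + INR (S N)))
        + (/ (INR (S n) + INR (S N)) - / (INR (S n) + INR (S (S N))))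
        = / INR (S n) - / (INR (S n) + INR (S (S N)))) by (intros; ring).
    apply (is_series_ext (V := R_NormedModule) _ _ _ E).
    apply (is_series_plus (V := R_NormedModule)); [exact IH|apply Hstep].
Qed.

Lemma second_der_at_integers :
  is_lim_seq (fun n => logG_der 2 (INR (S n)) - ln (INR (S n))) 0.
Proof.
  destruct (polygamma_sum_approx 0 1 ltac:(lia)) as [K HK]. simpl Nat.add in HK.
  assert (Hp : is_lim_seq (fun n => INR (S n) * polygamma_sum 2 (INR (S n))) 1).
  { replace (Finite 1) with (Finite (0 + (1 + polygamma_coef 0 1 * 0))) by (f_equal; ring).
    apply (is_lim_seq_ext (fun n => INR (S n) * (polygamma_sum 2 (INR (S n)) - polygamma_approx 0 1 (INR (S n)))
      + (1 + polygamma_coef 0 1 * / INR (S n) ^ 1))).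
    - intros n. assert (Hx := INR_S_ge1 n). set (x := INR (S n)) in *. clearbody x.
      unfold polygamma_approx. simpl sum_f_R0.
      replace (polygamma_coef 0 0) with 1 by (unfold polygamma_coef; rewrite bernoulli_0; simpl; field).
      change (0 + 1 + 0)%nat with 1%nat. change (0 + 1 + 1)%nat with 2%nat. field. lra.
    - apply is_lim_seq_plus'.
      + apply is_lim_seq_incr_1.
        apply (is_lim_seq_of_bound _ _ K 0). intros n.
        rewrite Rminus_0_r, Rabs_mult.
        assert (Hx : 2 <= INR (S (S n))) by (rewrite S_INR; assert (H := INR_S_ge1 n); lra).
        assert (H := HK _ Hx).
        assert (HK0 : 0 <= K).
        { assert (Ha := Rabs_pos (polygamma_sum 2 (INR (S (S n))) - polygamma_approx 0 1 (INR (S (S n))))).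
          assert (Hi : 0 < INR (S (S n)) ^ 2) by (apply pow_lt; lra).
          apply Rnot_lt_le. intros Hlt. 
          assert (K / INR (S (S n)) ^ 2 < 0); [|lra].
          apply Rmult_neg_pos; [easy|]. now apply Rinv_0_lt_compat. }
        rewrite (Rabs_right (INR _)) by lra.
        apply Rle_trans with (K * / INR (S (S n))).
        * replace (K * / INR (S (S n))) with (INR (S (S n)) * (K / INR (S (S n)) ^ 2)) by (field; lra).
          apply Rmult_le_compat_l; [lra|exact H].
        * apply Rmult_le_compat_l; [easy|]. rewrite pow_1. apply Rinv_le_contravar.
          -- assert (H1 := INR_S_ge1 n). lra.
          -- rewrite (S_INR (S n)). lra.
      + apply is_lim_seq_plus'; [apply is_lim_seq_const|].
        apply (is_lim_seq_scal_l _ (polygamma_coef 0 1) 0), is_lim_seq_inv_S_pow. }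
  replace (Finite 0) with (Finite (-1 - euler_gamma + (euler_gamma + 1))) by (f_equal; ring).
  apply (is_lim_seq_ext (fun n => -1 - euler_gamma + ((harmonic n - ln (INR (S n))) + INR (S n) * polygamma_sum 2 (INR (S n))))).
  - intros n. unfold logG_der. replace (Series (fun k => log_factor_d2 k (INR (S n))))
      with (harmonic n + INR (S n) * polygamma_sum 2 (INR (S n))); [ring|].
    assert (Hx := INR_S_ge1 n). unfold polygamma_sum. rewrite <- Series_scal_l.
    rewrite <- (is_series_unique _ _ (harmonic_telescope n)), <- Series_plus.
    + apply Series_ext. intros k. unfold log_factor_d2. assert (Hy := INR_S_ge1 k). field. lra.
    + exists (harmonic n). apply harmonic_telescope.
    + apply (ex_series_scal (INR (S n)) (fun k => / (INR (S k) + INR (S n)) ^ 2)), ex_polygamma_sum; [lia|lra].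
  - apply is_lim_seq_plus'; [apply is_lim_seq_const|].
    apply is_lim_seq_plus'; [apply harmonic_lim|exact Hp].
Qed.

Lemma first_der_at_integers :
  is_lim_seq (fun n => logG_der 1 (INR (S n)) - 1 / 2 * ln (2 * PI)
     - INR (S n) * ln (INR (S n)) + INR (S n)) 0.
Proof.
  destruct harmonic_expansion as [K HK].
  apply (is_lim_seq_of_bound _ _ K 0). intros n. specialize (HK n).
  replace (logG_der 1 (INR (S n)) - 1 / 2 * ln (2 * PI)
     - INR (S n) * ln (INR (S n)) + INR (S n) - 0) with
    (INR (S n) * (harmonic n - ln (INR (S n)) - / (2 * INR (S n)) - euler_gamma)).
  - assert (Hx := INR_S_ge1 n). rewrite Rabs_mult, Rabs_right by lra.
    replace (K * / INR (S n) ^ 1) with (INR (S n) * (K * / INR (S n) ^ 2)) by (field; lra).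
    apply Rmult_le_compat_l; [lra|exact HK].
  - unfold logG_der. replace (Series (fun k => log_factor_d1 k (INR (S n)))) with (INR (S n) * harmonic n).
    + assert (Hx := INR_S_ge1 n). field. lra.
    + rewrite <- (is_series_unique _ _ (harmonic_telescope n)), <- Series_scal_l.
      apply Series_ext. intros k. unfold log_factor_d1. assert (Hy := INR_S_ge1 k). assert (Hx := INR_S_ge1 n).
      field. lra.
Qed.

(** Abel summation: the terms [n (ln(n+N+1) - ln(n+N))] telescope to a boundary
    term and a logarithm of factorials. *)
Lemma log_factor_increment_sum (N M : nat) :
  sum_n (fun n => log_factor n (INR (S N)) - log_factor n (INR N)) M
  = INR (S M) * ln (INR (S M) + INR N + 1) - lnfact (S M + N) + lnfact N
    - INR (S M) + (INR N + / 2) * harmonic M.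
Proof.
  assert (Hterm : forall n, log_factor n (INR (S N)) - log_factor n (INR N)
    = INR (S n) * (ln (INR (S n) + INR N + 1) - ln (INR (S n) + INR N)) - 1 + (INR N + / 2) * / INR (S n)).
  { intros n. unfold log_factor. assert (Hx := INR_S_ge1 n). assert (HN := pos_INR N).
    rewrite (S_INR N). set (x := INR (S n)) in *. set (y := INR N) in *. clearbody x y.
    replace (1 + (y + 1) / x) with ((x + y + 1) / x) by (field; lra).
    replace (1 + y / x) with ((x + y) / x) by (field; lra).
    rewrite 2!ln_div by lra. field. lra. }
  match goal with |- @eq _ ?a ?b => change (@eq R a b) end.
  induction M as [|M IH].
  - rewrite sum_O, Hterm. unfold harmonic. simpl sum_f_R0.
    change (1 + N)%nat with (S N). rewrite lnfact_S, (S_INR N).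
    simpl (INR 1). replace (1 + INR N) with (INR N + 1) by ring. field.
  - rewrite sum_Sn, IH, Hterm. unfold harmonic. rewrite tech5. fold (harmonic M).
    change (plus ?a ?b) with (a + b). change (S (S M) + N)%nat with (S (S M + N)).
    rewrite lnfact_S. replace (INR (S (S M + N))) with (INR (S (S M)) + INR N)
      by (change (S (S M + N)) with (S (S M) + N)%nat; now rewrite plus_INR).
    replace (INR (S (S M)) + INR N) with (INR (S M) + INR N + 1) by (rewrite (S_INR (S M)); ring).
    rewrite (S_INR (S M)). ring.
Qed.

(** The functional equation [G(N+2) = N! G(N+1)]. As [M] grows, the partial sum of
    the previous lemma is evaluated with Stirling's formula at [M + N + 1] and
    the definition of [gamma]; the powers of [2 pi], [e] and [gamma] in front of
    the product cancel the result. *)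
Lemma logG_increment (N : nat) :
  logG_der 0 (INR (S N)) - logG_der 0 (INR N) = lnfact N.
Proof.
  destruct stirling as [K HK].
  assert (HN := pos_INR N).
  assert (HY : forall M, INR (S (M + N)) = INR (S M) + INR N) by (intros M; now rewrite <- plus_INR).
  (* [X (ln(X+N+1) - ln(X+N))] lies between [X/(X+N+1)] and [X/(X+N)]. *)
  assert (Hratio : is_lim_seq (fun M => INR (S M) * (ln (INR (S M) + INR N + 1) - ln (INR (S M) + INR N))) 1).
  { apply (is_lim_seq_of_bound _ _ (INR N + 1) 0). intros M. assert (Hx := INR_S_ge1 M).
    set (x := INR (S M)) in *. set (y := INR N) in *. clearbody x y. rewrite pow_1.
    rewrite <- ln_div by lra.
    assert (U := ln_le_sub_1 ((x + y + 1) / (x + y)) ltac:(apply Rdiv_lt_0_compat; lra)).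
    assert (L := ln_le_sub_1 (/ ((x + y + 1) / (x + y))) ltac:(apply Rinv_0_lt_compat, Rdiv_lt_0_compat; lra)).
    rewrite ln_Rinv in L by (apply Rdiv_lt_0_compat; lra).
    set (l := ln ((x + y + 1) / (x + y))) in *.
    replace ((x + y + 1) / (x + y) - 1) with (/ (x + y)) in U by (field; lra).
    replace (/ ((x + y + 1) / (x + y)) - 1) with (- / (x + y + 1)) in L by (field; lra).
    assert (U' : x * l <= 1).
    { apply Rle_trans with (x * / (x + y)); [apply Rmult_le_compat_l; lra|].
      apply (Rmult_le_reg_r (x + y)); [lra|]. rewrite Rmult_assoc, Rinv_l by lra. lra. }
    assert (L' : 1 - (y + 1) * / x <= x * l).
    { apply Rle_trans with (x * / (x + y + 1)); [|apply Rmult_le_compat_l; lra].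
      apply (Rmult_le_reg_r ((x + y + 1) * x)); [nra|].
      replace (x * / (x + y + 1) * ((x + y + 1) * x)) with (x * x) by (field; lra).
      replace ((1 - (y + 1) * / x) * ((x + y + 1) * x)) with (x * x - (y + 1) ^ 2) by (field; lra). nra. }
    assert (0 <= (y + 1) * / x) by (apply Rmult_le_pos; [lra|]; apply Rlt_le, Rinv_0_lt_compat; lra).
    apply Rabs_le. lra. }
  assert (Herr : is_lim_seq (fun M => stirling_error (S (M + N))) 0).
  { apply (is_lim_seq_incr_n (fun M => stirling_error (S M)) N).
    apply (is_lim_seq_of_bound _ _ K 1). intros n. rewrite Rminus_0_r. apply HK. }
  assert (Hlim : is_lim_seq (sum_n (fun n => log_factor n (INR (S N)) - log_factor n (INR N)))
     (lnfact N + (1 - (INR N + / 2) * 0 + (INR N + / 2) * euler_gamma + INR N - / 2 * ln (2 * PI) - 0 - / 12 * 0))).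
  { apply (is_lim_seq_ext (fun M => lnfact N + (
       INR (S M) * (ln (INR (S M) + INR N + 1) - ln (INR (S M) + INR N))
       - (INR N + / 2) * (ln (INR (S M) + INR N) - ln (INR (S M)))
       + (INR N + / 2) * (harmonic M - ln (INR (S M)))
       + INR N - / 2 * ln (2 * PI) - stirling_error (S (M + N)) - / 12 * / (INR N + INR (S M)) ^ 1))).
    - intros M. rewrite log_factor_increment_sum. unfold stirling_error.
      change (S M + N)%nat with (S (M + N)). rewrite HY.
      assert (Hx := INR_S_ge1 M). field. lra.
    - apply is_lim_seq_plus'; [apply is_lim_seq_const|].
      repeat apply is_lim_seq_minus'.
      + apply is_lim_seq_plus'; [|apply is_lim_seq_const].
        apply is_lim_seq_plus'; [apply is_lim_seq_minus'; [exact Hratio|]|].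
        * apply (is_lim_seq_scal_l _ (INR N + / 2) 0), ln_ratio_lim, HN.
        * apply (is_lim_seq_scal_l _ (INR N + / 2) euler_gamma), harmonic_lim.
      + apply is_lim_seq_const.
      + exact Herr.
      + apply (is_lim_seq_scal_l _ (/ 12) 0).
        apply (is_lim_seq_incr_1 (fun M => / (INR N + INR M) ^ 1)), is_lim_seq_shift_inv_pow. }
  assert (HS := Series_correct _ (ex_series_minus _ _ (ex_series_log_factor (INR (S N)) (pos_INR _)) (ex_series_log_factor (INR N) HN))).
  change (is_lim_seq (sum_n (fun n => log_factor n (INR (S N)) - log_factor n (INR N)))
    (Series (fun n => log_factor n (INR (S N)) - log_factor n (INR N)))) in HS.
  apply is_lim_seq_unique in HS. apply is_lim_seq_unique in Hlim. rewrite HS in Hlim.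
  apply (f_equal real) in Hlim. cbv beta iota delta [real] in Hlim.
  rewrite Series_minus in Hlim by (apply ex_series_log_factor, pos_INR).
  unfold logG_der. 
  replace (Series (fun n => log_factor n (INR (S N)))) with
    (Series (fun n => log_factor n (INR N)) + (Series (fun n => log_factor n (INR (S N))) - Series (fun n => log_factor n (INR N)))) by ring.
  rewrite Hlim, (S_INR N). field.
Qed.

Definition sum_k_ln_k (n : nat) : R := sum_f_R0 (fun k => INR (S k) * ln (INR (S k))) n.

Lemma logG_integer (n : nat) :
  logG_der 0 (INR (S n)) = INR (S n) * lnfact (S n) - sum_k_ln_k n.
Proof.
  induction n as [|n IH].
  - assert (H := logG_increment 0). 
    assert (H0 : logG_der 0 (INR 0) = 0).
    { unfold logG_der. simpl (INR 0). rewrite (Series_ext _ (fun _ => 0 * 0)).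
      - rewrite Series_scal_l. field.
      - intros k. unfold log_factor. assert (Hx := INR_S_ge1 k).
        replace (1 + 0 / INR (S k)) with 1 by (field; lra). rewrite ln_1. field. lra. }
    rewrite H0 in H. unfold sum_k_ln_k. simpl sum_f_R0. unfold lnfact in *. simpl in *. rewrite ln_1 in *. lra.
  - assert (H := logG_increment (S n)). rewrite IH in H.
    unfold sum_k_ln_k in *. rewrite tech5. rewrite (lnfact_S (S n)).
    rewrite (S_INR (S n)) in *. lra.
Qed.

(** The Euler-Maclaurin error of [x ln x] on the unit interval starting at [k+1],
    up to the factor [-1/6]. *)
Definition kinkelin_term (k : nat) : R := RInt (fun y => bern3 y * / (INR (S k) + y) ^ 2) 0 1.

Lemma sum_k_ln_k_expansion (n : nat) :
  sum_k_ln_k (S n) = (INR (S (S n)) ^ 2 / 2 + INR (S (S n)) / 2 + / 12) * ln (INR (S (S n)))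
    - INR (S (S n)) ^ 2 / 4 + / 4 - / 6 * sum_f_R0 kinkelin_term n.
Proof.
  assert (Hem : forall k, let x := INR (S k) in
     / 2 * (x * ln x + (x + 1) * ln (x + 1))
     - (((x + 1) ^ 2 / 2 * ln (x + 1) - (x + 1) ^ 2 / 4) - (x ^ 2 / 2 * ln x - x ^ 2 / 4))
     - / 12 * (ln (x + 1) - ln x) = - / 6 * kinkelin_term k).
  { intros k x. assert (Hx := INR_S_ge1 k). fold x in Hx.
    assert (H : is_RInt (fun y => bern3 y * - / (x + y) ^ 2) 0 1
      (6 * (/ 2 * (x * ln x + (x + 1) * ln (x + 1))
     - (((x + 1) ^ 2 / 2 * ln (x + 1) - (x + 1) ^ 2 / 4) - (x ^ 2 / 2 * ln x - x ^ 2 / 4))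
     - / 12 * (ln (x + 1) + 1 - (ln x + 1))))).
    { apply (euler_maclaurin_unit (fun t => t ^ 2 / 2 * ln t - t ^ 2 / 4) (fun t => t * ln t)
         (fun t => ln t + 1) (fun t => / t) (fun t => - / t ^ 2)); intros t Ht.
      - auto_derive; [lra|field; lra].
      - auto_derive; [lra|field; lra].
      - auto_derive; [lra|field; lra].
      - auto_derive; [lra|field; lra].
      - apply (ex_derive_continuous (fun t => - / t ^ 2)). auto_derive. nra. }
    apply (is_RInt_opp (V := R_NormedModule)) in H.
    assert (E : kinkelin_term k = opp (6 * (/ 2 * (x * ln x + (x + 1) * ln (x + 1))
     - (((x + 1) ^ 2 / 2 * ln (x + 1) - (x + 1) ^ 2 / 4) - (x ^ 2 / 2 * ln x - x ^ 2 / 4))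
     - / 12 * (ln (x + 1) + 1 - (ln x + 1))))).
    { unfold kinkelin_term. fold x. apply (is_RInt_unique (V := R_CompleteNormedModule)).
      revert H. apply (is_RInt_ext (V := R_NormedModule)).
      intros y _. change (- (bern3 y * - / (x + y) ^ 2) = bern3 y * / (x + y) ^ 2). ring. }
    rewrite E. change (opp ?a) with (- a). field. }
  unfold sum_k_ln_k. induction n as [|n IH].
  - specialize (Hem 0%nat). simpl in Hem. simpl sum_f_R0. simpl (INR 1) in *. simpl (INR 2).
    rewrite ln_1 in *. lra.
  - rewrite tech5, IH, tech5. specialize (Hem (S n)). cbv zeta in Hem.
    rewrite <- S_INR in Hem. rewrite (S_INR (S (S n))) in *. nra.
Qed.

(** * The complex exponential *)

Lemma exp_le_mono (x y : R) : x <= y -> exp x <= exp y.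
Proof. intros [H| ->]; [now apply Rlt_le, exp_increasing|apply Rle_refl]. Qed.

Lemma Cexp_plus (z w : C) : Cexp (z + w)%C = (Cexp z * Cexp w)%C.
Proof.
  destruct z as [a b], w as [c d]. unfold Cexp, Cmult, Cplus; simpl.
  rewrite exp_plus, cos_plus, sin_plus. f_equal; ring.
Qed.

Lemma Cmod_Cexp (z : C) : Cmod (Cexp z) = exp (Re z).
Proof.
  destruct z as [a b]. unfold Cexp, Cmod; simpl.
  replace (_ + _) with ((exp a) ^ 2).
  - rewrite sqrt_pow2; [easy|]. apply Rlt_le, exp_pos.
  - assert (H := sin2_cos2 b). unfold Rsqr in H.
    transitivity (exp a ^ 2 * (sin b * sin b + cos b * cos b)); [rewrite H; ring|ring].
Qed.

(** Bounds on complex integrals, series and Taylor remainders are all reduced to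
    real ones by this duality: take [c] to be the conjugate of [z]. *)
Lemma Cmod_le_of_Re (z : C) (M : R) : 0 <= M ->
  (forall c, Re (c * z)%C <= Cmod c * M) -> Cmod z <= M.
Proof.
  intros HM H. specialize (H (Cconj z)). rewrite Cmod_conj in H.
  destruct (Rle_lt_dec (Cmod z) 0) as [Hz|Hz]; [lra|].
  apply (Rmult_le_reg_l (Cmod z)); [easy|]. eapply Rle_trans; [|exact H].
  apply Req_le. replace (Cmod z * Cmod z) with (Cmod z ^ 2) by ring.
  rewrite Cmod2_alt. destruct z as [a b]; simpl. ring.
Qed.

Lemma C_eq_of_Re (z w : C) : (forall c, Re (c * z)%C = Re (c * w)%C) -> z = w.
Proof.
  intros H. assert (H1 := H (RtoC 1)). assert (H2 := H (- Ci)%C).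
  destruct z as [a b], w as [c d]; simpl in *. f_equal; lra.
Qed.

Lemma im_le_Cmod (z : C) : Rabs (Im z) <= Cmod z.
Proof.
  eapply Rle_trans; [|apply Rmax_Cmod]. apply Rmax_r.
Qed.

Lemma Cmod_le_Re_Im (z : C) : Cmod z <= Rabs (Re z) + Rabs (Im z).
Proof.
  apply Rsqr_incr_0_var; [|assert (H1 := Rabs_pos (Re z)); assert (H2 := Rabs_pos (Im z)); lra].
  unfold Rsqr. replace (Cmod z * Cmod z) with (Cmod z ^ 2) by ring. rewrite Cmod2_alt.
  rewrite <- (pow2_abs (Re z)), <- (pow2_abs (Im z)).
  assert (H1 := Rabs_pos (Re z)). assert (H2 := Rabs_pos (Im z)). nra.
Qed.

(** The sum of the first [N] terms of a power series; unlike [sum_n] it can be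
    empty, which lets bounds on [f] itself be the case [N = 0] of bounds on Taylor
    remainders. *)
Fixpoint cpoly (A : nat -> C) (h : C) (N : nat) : C :=
  match N with
  | O => 0
  | S n => (cpoly A h n + A n * h ^ n)%C
  end.

Lemma is_derive_pow_fact (n : nat) (t : R) :
  is_derive (fun t => t ^ S n / INR (fact (S n))) t (t ^ n / INR (fact n)).
Proof.
  assert (HF : INR (fact (S n)) = INR (S n) * INR (fact n)) by now rewrite fact_simpl, mult_INR.
  assert (Hn := INR_fact_neq_0 n). assert (HS : INR (S n) <> 0) by (apply not_0_INR; lia).
  set (F := INR (fact (S n))) in *. clearbody F. auto_derive; [easy|].
  change (match n with | 0%nat => 1 | S _ => INR n + 1 end) with (INR (S n)). simpl pred.
  rewrite HF. field. easy.
Qed.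

Lemma pow_fact_le_exp (n : nat) (x : R) : 0 <= x -> x ^ n / INR (fact n) <= exp x.
Proof.
  revert x. induction n as [|n IH]; intros x Hx.
  - simpl. assert (H := exp_ineq1_le x). lra.
  - destruct (mean_value (fun t => exp t - t ^ S n / INR (fact (S n)))
       (fun t => exp t - t ^ n / INR (fact n)) 0 x) as [c [Hc Ec]].
    + intros t _. apply (is_derive_minus exp (fun t => t ^ S n / INR (fact (S n))));
        [apply is_derive_exp|apply is_derive_pow_fact].
    + rewrite Rmin_left, Rmax_right in Hc by lra.
      rewrite exp_0, pow_i in Ec by lia. specialize (IH c ltac:(lra)).
      assert (0 <= (exp c - c ^ n / INR (fact n)) * (x - 0)) by (apply Rmult_le_pos; lra).
      unfold Rdiv at 2 in Ec. lra.
Qed.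

Lemma derivative_bound (g dg b db : R -> R) (t : R) : 0 <= t ->
  (forall u, 0 <= u <= t -> is_derive g u (dg u)) ->
  (forall u, 0 <= u <= t -> is_derive b u (db u)) ->
  (forall u, 0 <= u <= t -> dg u <= db u) ->
  g 0 <= b 0 -> g t <= b t.
Proof.
  intros Ht Hg Hb Hd H0.
  destruct (mean_value (fun u => b u - g u) (fun u => db u - dg u) 0 t) as [c [Hc Ec]].
  - intros u. rewrite Rmin_left, Rmax_right by lra. intros Hu.
    apply (is_derive_minus b g u (db u) (dg u)); auto.
  - rewrite Rmin_left, Rmax_right in Hc by lra. specialize (Hd c Hc).
    assert (0 <= (db c - dg c) * (t - 0)) by (apply Rmult_le_pos; lra). lra.
Qed.

Definition cexp_term (n : nat) : C := RtoC (/ INR (fact n)).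

Lemma is_derive_Re_Cexp (c w : C) (t : R) :
  is_derive (fun t => Re (c * Cexp (RtoC t * w))%C) t (Re (c * (w * Cexp (RtoC t * w)))%C).
Proof.
  destruct c as [c1 c2], w as [w1 w2].
  assert (E : forall t, Cexp (RtoC t * (w1, w2)) = (exp (t * w1) * cos (t * w2), exp (t * w1) * sin (t * w2))).
  { intros u. unfold Cexp, Re, Im, Cmult, RtoC; simpl.
    replace (u * w1 - 0 * w2) with (u * w1) by ring.
    now replace (u * w2 + 0 * w1) with (u * w2) by ring. }
  rewrite E. apply (is_derive_ext (fun t => c1 * (exp (t * w1) * cos (t * w2)) - c2 * (exp (t * w1) * sin (t * w2)))).
  - intros u. rewrite E. reflexivity.
  - unfold Cmult, Re; simpl. auto_derive; [easy|]. ring.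
Qed.

Lemma Re_pow_scal (c w : C) (n : nat) (t : R) :
  Re (c * (RtoC t * w) ^ n)%C = t ^ n * Re (c * w ^ n)%C.
Proof.
  assert (H : ((RtoC t * w) ^ n = RtoC (t ^ n) * w ^ n)%C).
  { now rewrite Cpow_mult_l, RtoC_pow. }
  rewrite H. destruct c as [c1 c2], (w ^ n)%C as [w1 w2]. unfold Re, Cmult, RtoC; simpl. ring.
Qed.

Lemma is_derive_Re_cpoly_exp (c w : C) (N : nat) (t : R) :
  is_derive (fun t => Re (c * cpoly cexp_term (RtoC t * w) (S N))%C) t
    (Re (c * (w * cpoly cexp_term (RtoC t * w) N))%C).
Proof.
  induction N as [|N IH].
  - apply (is_derive_ext (fun _ => Re c)).
    + intros u. simpl. destruct c as [c1 c2]. unfold cexp_term, Re, Cmult, Cplus, RtoC; simpl. field.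
    + replace (Re (c * (w * cpoly cexp_term (RtoC t * w) 0))%C) with 0; [apply @is_derive_const|].
      destruct c as [c1 c2]. unfold Re, Cmult; simpl. ring.
  - apply (is_derive_ext (fun t => Re (c * cpoly cexp_term (RtoC t * w) (S N))%C
      + t ^ S N / INR (fact (S N)) * Re (c * w ^ S N)%C)).
    + intros u. replace (u ^ S N / INR (fact (S N)) * Re (c * w ^ S N)%C) with
        (/ INR (fact (S N)) * (u ^ S N * Re (c * w ^ S N)%C)) by (unfold Rdiv; ring).
      rewrite <- Re_pow_scal. cbn [cpoly]. unfold cexp_term at 3.
      set (P := (cpoly _ _ _ + _)%C). generalize ((RtoC u * w) ^ S N)%C. intros Q.
      destruct c as [c1 c2], P as [p1 p2], Q as [q1 q2]. unfold Re, Cmult, Cplus, RtoC; simpl. ring.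
    + replace (Re (c * (w * cpoly cexp_term (RtoC t * w) (S N)))%C) with
        (Re (c * (w * cpoly cexp_term (RtoC t * w) N))%C + t ^ N / INR (fact N) * Re (c * w ^ S N)%C).
      * apply (is_derive_plus (fun t => Re (c * cpoly cexp_term (RtoC t * w) (S N))%C)); [exact IH|].
        apply (is_derive_ext (fun t => Re (c * w ^ S N)%C * (t ^ S N / INR (fact (S N))))); [intros; apply Rmult_comm|].
        rewrite (Rmult_comm _ (Re _)). apply is_derive_scal, is_derive_pow_fact.
      * cbn [cpoly]. 
        replace (c * (w * (cpoly cexp_term (RtoC t * w) N + cexp_term N * (RtoC t * w) ^ N)))%C
         with (c * (w * cpoly cexp_term (RtoC t * w) N) + RtoC (/ INR (fact N)) * (c * w * (RtoC t * w) ^ N))%C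
         by (unfold cexp_term; ring).
        assert (E := Re_pow_scal (c * w)%C w N t).
        replace (Re (c * w ^ S N)%C) with (Re (c * w * w ^ N)%C) by (rewrite Cpow_S; f_equal; ring).
        replace (t ^ N / INR (fact N) * Re (c * w * w ^ N)%C) with (/ INR (fact N) * (t ^ N * Re (c * w * w ^ N)%C))
          by (unfold Rdiv; ring).
        rewrite <- E. generalize (c * w * (RtoC t * w) ^ N)%C. intros Q.
        generalize (c * (w * cpoly cexp_term (RtoC t * w) N))%C. intros P.
        destruct P as [p1 p2], Q as [q1 q2]. unfold Re, Cmult, Cplus, RtoC; simpl. ring.
Qed.

Lemma Re_minus (c z w : C) : Re (c * (z - w))%C = Re (c * z)%C - Re (c * w)%C.
Proof. destruct c, z, w. unfold Re, Cmult, Cminus, Cplus, Copp; simpl. ring. Qed.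

Lemma Re_mult_le (c z : C) : Re (c * z)%C <= Cmod c * Cmod z.
Proof.
  eapply Rle_trans; [apply Rle_abs|]. eapply Rle_trans; [apply re_le_Cmod|].
  rewrite Cmod_mult. lra.
Qed.

(** Taylor's inequality for the complex exponential. Along the ray from [0] to
    [w] the derivative of the [N+1]-st remainder is [w] times the [N]-th one, so the
    bounds follow by successive integration. *)
Lemma Cexp_remainder_ray (w : C) (N : nat) (t : R) : 0 <= t <= 1 ->
  Cmod (Cexp (RtoC t * w) - cpoly cexp_term (RtoC t * w) N)%C
  <= Cmod w ^ N * t ^ N / INR (fact N) * exp (Cmod w).
Proof.
  assert (Hw := Cmod_ge_0 w). assert (Hew := exp_pos (Cmod w)).
  revert t. induction N as [|N IH]; intros t Ht.
  - simpl cpoly. replace (Cexp (RtoC t * w) - 0)%C with (Cexp (RtoC t * w)) by ring.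
    rewrite Cmod_Cexp. simpl. replace (1 * 1 / 1 * exp (Cmod w)) with (exp (Cmod w)) by field.
    assert (Re (RtoC t * w)%C <= Cmod w).
    { eapply Rle_trans; [apply Re_mult_le|]. rewrite Cmod_R, Rabs_right by lra. nra. }
    now apply exp_le_mono.
  - assert (Hf := INR_fact_lt_0 (S N)).
    apply Cmod_le_of_Re.
    { apply Rmult_le_pos; [|lra]. apply Rmult_le_pos; [|apply Rlt_le, Rinv_0_lt_compat; lra].
      apply Rmult_le_pos; apply pow_le; lra. }
    intros c. rewrite Re_minus.
    apply (derivative_bound (fun t => Re (c * Cexp (RtoC t * w))%C - Re (c * cpoly cexp_term (RtoC t * w) (S N))%C)
      (fun t => Re (c * (w * Cexp (RtoC t * w)))%C - Re (c * (w * cpoly cexp_term (RtoC t * w) N))%C)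
      (fun t => Cmod c * (Cmod w ^ S N * t ^ S N / INR (fact (S N)) * exp (Cmod w)))
      (fun t => Cmod c * (Cmod w * (Cmod w ^ N * t ^ N / INR (fact N) * exp (Cmod w))))); [lra| | | |].
    + intros u _. apply @is_derive_minus; [apply is_derive_Re_Cexp|apply is_derive_Re_cpoly_exp].
    + intros u _.
      apply (is_derive_ext (fun t => Cmod c * Cmod w ^ S N * exp (Cmod w) * (t ^ S N / INR (fact (S N)))));
        [intros v; match goal with |- @eq _ ?a ?b => change (@eq R a b) end; unfold Rdiv; ring|].
      replace (Cmod c * (Cmod w * (Cmod w ^ N * u ^ N / INR (fact N) * exp (Cmod w)))) with
        (Cmod c * Cmod w ^ S N * exp (Cmod w) * (u ^ N / INR (fact N))) by (simpl; unfold Rdiv; ring).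
      apply is_derive_scal, is_derive_pow_fact.
    + intros u Hu. rewrite <- Re_minus.
      replace (w * Cexp (RtoC u * w) - w * cpoly cexp_term (RtoC u * w) N)%C
        with (w * (Cexp (RtoC u * w) - cpoly cexp_term (RtoC u * w) N))%C by ring.
      eapply Rle_trans; [apply Re_mult_le|].
      apply Rmult_le_compat_l; [apply Cmod_ge_0|]. rewrite Cmod_mult.
      apply Rmult_le_compat_l; [easy|]. apply IH. lra.
    + rewrite <- Re_minus. rewrite pow_i by lia.
      replace (RtoC 0 * w)%C with (RtoC 0) by ring.
      assert (H0 : forall n, cpoly cexp_term 0 (S n) = RtoC 1).
      { induction n as [|n IHn].
        - unfold cpoly, cexp_term; simpl. rewrite Rinv_1. ring.
        - cbn [cpoly] in *. rewrite IHn. simpl. ring. }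
      rewrite H0. replace (Cexp 0) with (RtoC 1).
      * apply Req_le. unfold Rdiv. destruct c. unfold Re, Cmult, Cminus, Cplus, Copp, RtoC; simpl. ring.
      * unfold Cexp; simpl. rewrite exp_0, cos_0, sin_0. unfold RtoC. f_equal; ring.
Qed.

Lemma Cexp_remainder (w : C) (N : nat) :
  Cmod (Cexp w - cpoly cexp_term w N)%C <= Cmod w ^ N / INR (fact N) * exp (Cmod w).
Proof.
  assert (H := Cexp_remainder_ray w N 1 ltac:(lra)).
  replace (RtoC 1 * w)%C with w in H by ring. rewrite pow1, Rmult_1_r in H. exact H.
Qed.

(** * Integrals and series of complex functions *)

Definition CInt (f : R -> C) : C :=
  (RInt (fun y => Re (f y)) 0 1, RInt (fun y => Im (f y)) 0 1).

Definition ccont (f : R -> C) : Prop := forall y, 0 <= y <= 1 ->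
  continuous (fun y => Re (f y)) y /\ continuous (fun y => Im (f y)) y.

Lemma ccont_ex (f : R -> C) : ccont f ->
  ex_RInt (fun y => Re (f y)) 0 1 /\ ex_RInt (fun y => Im (f y)) 0 1.
Proof.
  intros H. split; apply (ex_RInt_continuous (V := R_CompleteNormedModule));
    rewrite Rmin_left, Rmax_right by lra; intros y Hy; now apply H.
Qed.

Lemma ccont_plus (f g : R -> C) : ccont f -> ccont g -> ccont (fun y => f y + g y)%C.
Proof.
  intros Hf Hg y Hy. destruct (Hf y Hy), (Hg y Hy). split.
  - now apply (continuous_plus (fun y => Re (f y)) (fun y => Re (g y))).
  - now apply (continuous_plus (fun y => Im (f y)) (fun y => Im (g y))).
Qed.

Lemma ccont_mult (f g : R -> C) : ccont f -> ccont g -> ccont (fun y => f y * g y)%C.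
Proof.
  intros Hf Hg y Hy. destruct (Hf y Hy), (Hg y Hy). split.
  - apply (continuous_minus (fun y => Re (f y) * Re (g y)) (fun y => Im (f y) * Im (g y)));
    now apply @continuous_mult.
  - apply (continuous_plus (fun y => Re (f y) * Im (g y)) (fun y => Im (f y) * Re (g y)));
    now apply @continuous_mult.
Qed.

Lemma ccont_real (u : R -> R) : (forall y, 0 <= y <= 1 -> continuous u y) -> ccont (fun y => RtoC (u y)).
Proof.
  intros Hu y Hy. split; [now apply Hu|]. apply (continuous_const 0).
Qed.

Lemma ccont_const (c : C) : ccont (fun _ => c).
Proof. intros y Hy. split; apply @continuous_const. Qed.

Lemma CInt_ext (f g : R -> C) : (forall y, 0 <= y <= 1 -> f y = g y) -> CInt f = CInt g.
Proof.
  intros H. unfold CInt. f_equal; apply RInt_ext; intros y; rewrite Rmin_left, Rmax_right by lra;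
    intros Hy; rewrite H; easy || lra.
Qed.

Lemma CInt_plus (f g : R -> C) : ccont f -> ccont g ->
  CInt (fun y => f y + g y)%C = (CInt f + CInt g)%C.
Proof.
  intros Hf Hg. apply ccont_ex in Hf, Hg. unfold CInt, Cplus; simpl. f_equal.
  - apply (RInt_plus (V := R_CompleteNormedModule)); easy.
  - apply (RInt_plus (V := R_CompleteNormedModule)); easy.
Qed.

Lemma CInt_scal (c : C) (f : R -> C) : ccont f -> CInt (fun y => c * f y)%C = (c * CInt f)%C.
Proof.
  intros Hf. apply ccont_ex in Hf. destruct Hf as [H1 H2].
  apply (RInt_correct (V := R_CompleteNormedModule)) in H1, H2.
  destruct c as [a b]. unfold CInt, Cmult; simpl. f_equal;
    apply (is_RInt_unique (V := R_CompleteNormedModule)).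
  - apply (is_RInt_minus (V := R_NormedModule) (fun y => a * Re (f y)) (fun y => b * Im (f y)));
      now apply (is_RInt_scal (V := R_NormedModule)).
  - apply (is_RInt_plus (V := R_NormedModule) (fun y => a * Im (f y)) (fun y => b * Re (f y)));
      now apply (is_RInt_scal (V := R_NormedModule)).
Qed.

Lemma CInt_bound (f : R -> C) (M : R) : ccont f ->
  (forall y, 0 <= y <= 1 -> Cmod (f y) <= M) -> Cmod (CInt f) <= M.
Proof.
  intros Hf HM. apply Cmod_le_of_Re.
  { eapply Rle_trans; [apply (Cmod_ge_0 (f 0))|]. apply HM. lra. }
  intros c. rewrite <- CInt_scal by easy.
  assert (Hc : ccont (fun y => c * f y)%C) by (apply ccont_mult; [apply ccont_const|easy]).
  destruct (ccont_ex _ Hc) as [He _].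
  change (RInt (fun y => Re (c * f y)%C) 0 1 <= Cmod c * M).
  replace (Cmod c * M) with (RInt (fun _ => Cmod c * M) 0 1).
  - apply RInt_le; [lra|exact He|apply ex_RInt_const|].
    intros y Hy. eapply Rle_trans; [apply Re_mult_le|].
    apply Rmult_le_compat_l; [apply Cmod_ge_0|]. apply HM. lra.
  - rewrite RInt_const. unfold scal; simpl. unfold mult; simpl. ring.
Qed.

Definition csum (u : nat -> C) : C :=
  (Series (fun k => Re (u k)), Series (fun k => Im (u k))).

(** Absolute convergence, by comparison with a real series. *)
Definition csummable (u : nat -> C) : Prop :=
  exists M : nat -> R, ex_series M /\ forall k, Cmod (u k) <= M k.

Lemma csummable_ex (u : nat -> C) : csummable u ->
  ex_series (fun k => Re (u k)) /\ ex_series (fun k => Im (u k)).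
Proof.
  intros (M & HM & H). split; apply (ex_series_dominated _ M); try easy; intros k;
    (eapply Rle_trans; [|apply H]); [apply re_le_Cmod|apply im_le_Cmod].
Qed.

Lemma csummable_plus (u v : nat -> C) : csummable u -> csummable v ->
  csummable (fun k => u k + v k)%C.
Proof.
  intros (M & HM & H) (M' & HM' & H'). exists (fun k => M k + M' k). split.
  - now apply (ex_series_plus M M').
  - intros k. eapply Rle_trans; [apply Cmod_triangle|]. now apply Rplus_le_compat.
Qed.

Lemma csummable_scal (c : C) (u : nat -> C) : csummable u -> csummable (fun k => c * u k)%C.
Proof.
  intros (M & HM & H). exists (fun k => Cmod c * M k). split.
  - now apply (ex_series_scal (Cmod c) M).
  - intros k. rewrite Cmod_mult. apply Rmult_le_compat_l; [apply Cmod_ge_0|apply H].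
Qed.

Lemma csum_ext (u v : nat -> C) : (forall k, u k = v k) -> csum u = csum v.
Proof. intros H. unfold csum. f_equal; apply Series_ext; intros k; now rewrite H. Qed.

Lemma csum_plus (u v : nat -> C) : csummable u -> csummable v ->
  csum (fun k => u k + v k)%C = (csum u + csum v)%C.
Proof.
  intros Hu Hv. apply csummable_ex in Hu, Hv. unfold csum, Cplus; simpl.
  f_equal; now apply Series_plus.
Qed.

Lemma csum_scal (c : C) (u : nat -> C) : csummable u -> csum (fun k => c * u k)%C = (c * csum u)%C.
Proof.
  intros Hu. apply csummable_ex in Hu. destruct Hu as [H1 H2], c as [a b].
  unfold csum, Cmult; simpl. rewrite <- !Series_scal_l. f_equal.
  - apply (Series_minus (fun k => a * Re (u k)) (fun k => b * Im (u k)));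
      now apply (ex_series_scal (V := R_NormedModule)).
  - apply (Series_plus (fun k => a * Im (u k)) (fun k => b * Re (u k)));
      now apply (ex_series_scal (V := R_NormedModule)).
Qed.

Lemma csum_bound (u : nat -> C) (M : nat -> R) : ex_series M ->
  (forall k, Cmod (u k) <= M k) -> Cmod (csum u) <= Series M.
Proof.
  intros HM H.
  assert (Hu : csummable u) by now exists M.
  assert (HM0 : forall k, 0 <= M k) by (intros k; eapply Rle_trans; [apply Cmod_ge_0|apply H]).
  apply Cmod_le_of_Re.
  { rewrite <- (Rmult_0_l (Series (fun _ => 0))), <- Series_scal_l.
    apply Series_le; [|easy]. intros n. rewrite Rmult_0_l. split; [lra|easy]. }
  intros c. rewrite <- csum_scal, <- Series_scal_l by easy.
  destruct (csummable_ex _ (csummable_scal c u Hu)) as [He _].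
  change (Series (fun k => Re (c * u k)%C) <= Series (fun k => Cmod c * M k)).
  apply Rle_trans with (Series (fun k => Rabs (Re (c * u k)%C))).
  - eapply Rle_trans; [apply Rle_abs|]. apply Series_Rabs.
    apply (ex_series_dominated _ (fun k => Cmod c * M k)); [|now apply (ex_series_scal (Cmod c) M)].
    intros k. rewrite Rabs_Rabsolu. eapply Rle_trans; [apply re_le_Cmod|]. rewrite Cmod_mult.
    apply Rmult_le_compat_l; [apply Cmod_ge_0|apply H].
  - apply Series_le; [|now apply (ex_series_scal (Cmod c) M)].
    intros k. split; [apply Rabs_pos|]. eapply Rle_trans; [apply re_le_Cmod|]. rewrite Cmod_mult.
    apply Rmult_le_compat_l; [apply Cmod_ge_0|apply H].
Qed.

(** * The Euler-Maclaurin error term of the zeta function *)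

(** [x^(-s)] for a positive real [x]; the sign is that of the Dirichlet series. *)
Definition cpow (x : R) (s : C) : C := Cexp (- (s * RtoC (ln x)))%C.

Lemma cpow_plus (x : R) (s h : C) :
  cpow x (s + h)%C = (cpow x s * Cexp (RtoC (- ln x) * h))%C.
Proof.
  unfold cpow. rewrite <- Cexp_plus. f_equal. rewrite RtoC_opp. ring.
Qed.

Lemma Cmod_cpow (x : R) (s : C) : Cmod (cpow x s) = exp (- (Re s * ln x)).
Proof.
  unfold cpow. rewrite Cmod_Cexp. f_equal. destruct s as [a b]. unfold Re, Copp, Cmult, RtoC; simpl. ring.
Qed.

Lemma cpow_shift1 (x : R) (s : C) : 0 < x -> cpow x (s + 1)%C = (RtoC (/ x) * cpow x s)%C.
Proof.
  intros Hx. rewrite cpow_plus, Cmult_comm. f_equal.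
  replace (RtoC (- ln x) * 1)%C with (RtoC (- ln x)) by ring.
  unfold Cexp, RtoC; simpl. rewrite cos_0, sin_0, exp_Ropp, exp_ln by easy. f_equal; ring.
Qed.

Lemma is_derive_Re_cpow (c s : C) (x : R) : 0 < x ->
  is_derive (fun x => Re (c * cpow x s)%C) x (Re (- (c * s) * cpow x (s + 1))%C).
Proof.
  intros Hx. rewrite cpow_shift1 by easy. destruct c as [a b], s as [p q].
  assert (E : forall x, cpow x (p, q) = (exp (- (p * ln x)) * cos (- (q * ln x)), exp (- (p * ln x)) * sin (- (q * ln x)))).
  { intros u. unfold cpow, Cexp, Re, Im, Copp, Cmult, RtoC; simpl.
    replace (p * ln u - q * 0) with (p * ln u) by ring.
    now replace (p * 0 + q * ln u) with (q * ln u) by ring. }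
  rewrite E. apply (is_derive_ext (fun x => a * (exp (- (p * ln x)) * cos (- (q * ln x)))
     - b * (exp (- (p * ln x)) * sin (- (q * ln x))))).
  - intros u. rewrite E. reflexivity.
  - unfold Cmult, Copp, RtoC, Re; simpl. auto_derive; [easy|]. ring.
Qed.

Lemma ccont_cpow (k : nat) (s : C) : ccont (fun y => cpow (INR (S k) + y) s).
Proof.
  intros y Hy. assert (Hk := INR_S_ge1 k).
  assert (H : forall c, continuous (fun y => Re (c * cpow (INR (S k) + y) s)%C) y).
  { intros c. apply (continuous_comp (fun y => INR (S k) + y) (fun x => Re (c * cpow x s)%C)).
    - apply (ex_derive_continuous (fun y => INR (S k) + y)). auto_derive. easy.
    - apply (ex_derive_continuous (fun x => Re (c * cpow x s)%C)).
      eexists. apply is_derive_Re_cpow. lra. }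
  split.
  - generalize (H (RtoC 1)). apply continuous_ext. intros t. now rewrite Cmult_1_l.
  - generalize (H (- Ci)%C). apply continuous_ext. intros t.
    destruct (cpow _ _). unfold Re, Im, Cmult, Copp, Ci; simpl. ring.
Qed.

Lemma ccont_bern3 : ccont (fun y => RtoC (bern3 y)).
Proof.
  apply ccont_real. intros y _. apply (ex_derive_continuous bern3). unfold bern3. auto_derive. easy.
Qed.

(** The Euler-Maclaurin error of [x^(-s)] on the unit interval starting at [k+1],
    without its polynomial factor in [s]. *)
Definition phi (k : nat) (s : C) : C :=
  CInt (fun y => RtoC (bern3 y) * cpow (INR (S k) + y) (s + 3))%C.

Definition Psi (s : C) : C := csum (fun k => phi k s).

(** The [n]-th Taylor coefficient of [phi k] at [s], from the exponential series
    of [x^(-h)] under the integral. *)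
Definition phi_coef (s : C) (k n : nat) : C :=
  CInt (fun y => RtoC (bern3 y) * cpow (INR (S k) + y) (s + 3)
     * (cexp_term n * RtoC (- ln (INR (S k) + y)) ^ n))%C.

Lemma ccont_phi_coef (s : C) (k n : nat) :
  ccont (fun y => RtoC (bern3 y) * cpow (INR (S k) + y) (s + 3)
     * (cexp_term n * RtoC (- ln (INR (S k) + y)) ^ n))%C.
Proof.
  apply ccont_mult; [apply ccont_mult; [apply ccont_bern3|apply ccont_cpow]|].
  apply ccont_mult; [apply ccont_const|].
  intros y Hy. assert (H := ccont_real (fun y => (- ln (INR (S k) + y)) ^ n)).
  assert (Hk := INR_S_ge1 k).
  destruct (H ltac:(intros t Ht; apply (ex_derive_continuous (fun y => (- ln (INR (S k) + y)) ^ n));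
     auto_derive; change (match k with | 0%nat => 1 | S _ => INR k + 1 end) with (INR (S k)); lra) y Hy) as [H1 H2].
  split.
  - revert H1. apply continuous_ext. intros t. now rewrite RtoC_pow.
  - revert H2. apply continuous_ext. intros t. now rewrite RtoC_pow.
Qed.

Definition power_weight (d : R) (k : nat) : R := exp (- ((1 + d) * ln (INR (S k)))).

(** By the mean value theorem the terms are dominated by the increments of
    [k^(-d)], which telescope. *)
Lemma ex_series_power_weight (d : R) : 0 < d -> ex_series (power_weight d).
Proof.
  intros Hd. apply ex_series_incr_1.
  apply (ex_series_dominated _ (fun k => / d * (exp (- (d * ln (INR (S k)))) - exp (- (d * ln (INR (S (S k)))))))).
  - intros k. rewrite Rabs_right by (apply Rle_ge, Rlt_le, exp_pos).
    assert (Hk := INR_S_ge1 k). unfold power_weight. rewrite (S_INR (S k)). set (x := INR (S k)) in *. clearbody x.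
    destruct (mean_value (fun t => exp (- (d * ln t))) (fun t => - d * exp (- ((1 + d) * ln t))) x (x + 1)) as [c [Hc Ec]].
    + intros t. rewrite Rmin_left, Rmax_right by lra. intros Ht. auto_derive; [lra|].
      replace (- ((1 + d) * ln t)) with (- (d * ln t) + - ln t) by ring.
      rewrite exp_plus, (exp_Ropp (ln t)), exp_ln by lra. ring.
    + rewrite Rmin_left, Rmax_right in Hc by lra.
      apply (Rmult_le_reg_l d); [easy|]. rewrite <- Rmult_assoc, Rinv_r, Rmult_1_l by lra.
      replace (exp (- (d * ln x)) - exp (- (d * ln (x + 1)))) with (d * exp (- ((1 + d) * ln c))) by lra.
      apply Rmult_le_compat_l; [lra|]. apply exp_le_mono.
      assert (ln c <= ln (x + 1)) by (apply ln_le; lra). nra.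
  - apply (ex_series_scal (/ d) (fun k => exp (- (d * ln (INR (S k)))) - exp (- (d * ln (INR (S (S k))))))).
    destruct (ex_finite_lim_seq_incr (fun n => 1 - exp (- (d * ln (INR (S (S n)))))) 1) as [l Hl].
    + intros n. assert (Hk := INR_S_ge1 n). 
      assert (exp (- (d * ln (INR (S (S (S n)))))) <= exp (- (d * ln (INR (S (S n)))))); [|lra].
      apply exp_le_mono. rewrite (S_INR (S (S n))). assert (Hk2 := INR_S_ge1 (S n)).
      assert (ln (INR (S (S n))) <= ln (INR (S (S n)) + 1)) by (apply ln_le; lra). nra.
    + intros n. assert (H := exp_pos (- (d * ln (INR (S (S n)))))). lra.
    + exists l. change (is_lim_seq (sum_n (fun k => exp (- (d * ln (INR (S k)))) - exp (- (d * ln (INR (S (S k))))))) l).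
      revert Hl. apply is_lim_seq_ext. intros n. induction n as [|n IH].
      * rewrite sum_O. simpl (INR 1). rewrite ln_1, Rmult_0_r, Ropp_0, exp_0. reflexivity.
      * rewrite sum_Sn, <- IH. change (plus ?a ?b) with (a + b). ring.
Qed.

(** The bound behind both the convergence of the Taylor coefficients and the
    decay of the remainders. With [L = ln x], the factor [x^(-(Re s + 3))] absorbs
    [e^(rL) >= (rL)^n/n!] and [e^(tL)], provided that [r] is a quarter of the
    distance from [s] to the line [Re s = -2]; a summable power of [k] is left. *)
Lemma phi_weight (s : C) (k n : nat) (r y t : R) : 0 < r -> Re s + 2 = 4 * r ->
  0 <= y <= 1 -> 0 <= t <= r ->
  Cmod (RtoC (bern3 y) * cpow (INR (S k) + y) (s + 3))%C
    * ((t * ln (INR (S k) + y)) ^ n / INR (fact n) * exp (t * ln (INR (S k) + y)))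
  <= (t / r) ^ n * power_weight (2 * r) k.
Proof.
  intros Hr Hs Hy Ht. assert (Hk := INR_S_ge1 k).
  rewrite Cmod_mult, Cmod_R, Cmod_cpow.
  replace (Re (s + 3)%C) with (1 + 4 * r) by (destruct s; simpl in *; lra).
  unfold power_weight. assert (Hx : ln (INR (S k)) <= ln (INR (S k) + y)) by (apply ln_le; lra).
  assert (HL0 : 0 <= ln (INR (S k))) by (rewrite <- ln_1; apply ln_le; lra).
  set (L0 := ln (INR (S k))) in *. set (L := ln (INR (S k) + y)) in *. clearbody L0 L.
  assert (HL : 0 <= L) by lra.
  replace ((t * L) ^ n / INR (fact n)) with ((t / r) ^ n * ((r * L) ^ n / INR (fact n))).
  2: { unfold Rdiv. rewrite <- Rmult_assoc, <- Rpow_mult_distr. do 2 f_equal. field. lra. }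
  assert (Hq : 0 <= (t / r) ^ n) by (apply pow_le, Rmult_le_pos; [lra|]; apply Rlt_le, Rinv_0_lt_compat, Hr).
  assert (Hp := pow_fact_le_exp n (r * L) ltac:(nra)).
  assert (Hb := bern3_bound y Hy). assert (Hb0 := Rabs_pos (bern3 y)).
  assert (Hf0 : 0 <= (r * L) ^ n / INR (fact n)).
  { apply Rmult_le_pos; [apply pow_le; nra|]. apply Rlt_le, Rinv_0_lt_compat, INR_fact_lt_0. }
  replace (_ * _ * (_ * _ * _)) with ((t / r) ^ n *
    (Rabs (bern3 y) * (exp (- ((1 + 4 * r) * L)) * ((r * L) ^ n / INR (fact n) * exp (t * L))))) by ring.
  apply Rmult_le_compat_l; [easy|].
  assert (HE : exp (- ((1 + 4 * r) * L)) * ((r * L) ^ n / INR (fact n) * exp (t * L)) <= exp (- ((1 + 2 * r) * L0))).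
  { apply Rle_trans with (exp (- ((1 + 4 * r) * L)) * (exp (r * L) * exp (t * L))).
    - apply Rmult_le_compat_l; [apply Rlt_le, exp_pos|]. apply Rmult_le_compat_r; [apply Rlt_le, exp_pos|easy].
    - rewrite <- !exp_plus. apply exp_le_mono. nra. }
  assert (HE0 : 0 <= exp (- ((1 + 4 * r) * L)) * ((r * L) ^ n / INR (fact n) * exp (t * L))).
  { apply Rmult_le_pos; [apply Rlt_le, exp_pos|]. apply Rmult_le_pos; [easy|apply Rlt_le, exp_pos]. }
  nra.
Qed.

Lemma phi_coef_bound (s : C) (k n : nat) (r : R) : 0 < r -> Re s + 2 = 4 * r ->
  Cmod (phi_coef s k n) <= (/ r) ^ n * power_weight (2 * r) k.
Proof.
  intros Hr Hs. apply CInt_bound; [apply ccont_phi_coef|]. intros y Hy.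
  assert (H := phi_weight s k n r y r Hr Hs Hy ltac:(lra)).
  assert (Hk := INR_S_ge1 k).
  assert (HL : 0 <= ln (INR (S k) + y)) by (rewrite <- ln_1; apply ln_le; lra).
  rewrite Cmod_mult. set (P := Cmod (_ * cpow _ _)%C) in *.
  assert (HP : 0 <= P) by apply Cmod_ge_0.
  unfold cexp_term. rewrite Cmod_mult, Cmod_R, Cmod_pow, Cmod_R, Rabs_Ropp, 2!Rabs_right;
    [|lra|apply Rle_ge, Rlt_le, Rinv_0_lt_compat, INR_fact_lt_0].
  set (L := ln (INR (S k) + y)) in *.
  replace (r / r) with 1 in H by (field; lra). rewrite pow1, Rmult_1_l in H.
  rewrite pow_inv. apply (Rmult_le_reg_l (r ^ n)); [now apply pow_lt|].
  rewrite <- (Rmult_assoc _ (/ r ^ n)), Rinv_r, Rmult_1_l by (apply pow_nonzero; lra).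
  eapply Rle_trans; [|exact H].
  replace (r ^ n * (P * (/ INR (fact n) * L ^ n))) with (P * ((r * L) ^ n / INR (fact n) * 1))
    by (rewrite Rpow_mult_distr; unfold Rdiv; ring).
  apply Rmult_le_compat_l; [easy|]. apply Rmult_le_compat_l.
  - apply Rmult_le_pos; [apply pow_le; nra|]. apply Rlt_le, Rinv_0_lt_compat, INR_fact_lt_0.
  - assert (He := exp_ineq1_le (r * L)). nra.
Qed.

Lemma cpoly_CInt (g : nat -> R -> C) (h : C) (N : nat) : (forall n, ccont (g n)) ->
  ccont (fun y => cpoly (fun n => g n y) h N) /\
  cpoly (fun n => CInt (g n)) h N = CInt (fun y => cpoly (fun n => g n y) h N).
Proof.
  intros Hg. induction N as [|N [IH1 IH2]]; simpl.
  - split; [apply ccont_const|].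
    rewrite (CInt_ext _ (fun y => 0 * RtoC 0)%C) by (intros; ring).
    rewrite CInt_scal by apply ccont_const. ring.
  - assert (Hc : ccont (fun y => g N y * h ^ N)%C) by (apply ccont_mult; [easy|apply ccont_const]).
    split; [now apply ccont_plus|].
    rewrite CInt_plus by easy. rewrite IH2. f_equal.
    rewrite Cmult_comm, <- CInt_scal by easy. apply CInt_ext. intros; ring.
Qed.

Lemma cpoly_csum (a : nat -> nat -> C) (h : C) (N : nat) : (forall n, csummable (fun k => a k n)) ->
  csummable (fun k => cpoly (a k) h N) /\
  cpoly (fun n => csum (fun k => a k n)) h N = csum (fun k => cpoly (a k) h N).
Proof.
  intros Ha. induction N as [|N [IH1 IH2]]; simpl.
  - assert (H0 : csummable (fun _ => RtoC 0)).
    { exists (fun k => 0 * / INR (S k) ^ 2). split; [apply ex_series_scal_inv_sq|].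
      intros k. rewrite Cmod_0. lra. }
    split; [exact H0|].
    rewrite (csum_ext _ (fun k => 0 * RtoC 0)%C) by (intros; ring).
    rewrite csum_scal by exact H0. ring.
  - assert (Hc : csummable (fun k => a k N * h ^ N)%C).
    { destruct (csummable_scal (h ^ N)%C _ (Ha N)) as (M & HM & H). exists M. split; [easy|].
      intros k. rewrite Cmult_comm. apply H. }
    split; [now apply csummable_plus|].
    rewrite csum_plus by easy. rewrite IH2. f_equal.
    rewrite Cmult_comm, <- csum_scal by easy. apply csum_ext. intros; ring.
Qed.

Lemma cpoly_factor (P w h : C) (N : nat) :
  cpoly (fun n => P * (cexp_term n * w ^ n))%C h N = (P * cpoly cexp_term (w * h) N)%C.
Proof.
  induction N as [|N IH]; simpl; [ring|]. rewrite IH, Cpow_mult_l. ring.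
Qed.

Lemma phi_remainder (s h : C) (k N : nat) (r : R) : 0 < r -> Re s + 2 = 4 * r -> Cmod h <= r ->
  Cmod (phi k (s + h)%C - cpoly (phi_coef s k) h N)%C <= (Cmod h / r) ^ N * power_weight (2 * r) k.
Proof.
  intros Hr Hs Hh.
  destruct (cpoly_CInt (fun n y => RtoC (bern3 y) * cpow (INR (S k) + y) (s + 3)
     * (cexp_term n * RtoC (- ln (INR (S k) + y)) ^ n))%C h N (ccont_phi_coef s k)) as [Hc E].
  unfold phi_coef. rewrite E. clear E.
  assert (Hc1 : ccont (fun y => RtoC (bern3 y) * cpow (INR (S k) + y) (s + h + 3))%C).
  { apply ccont_mult; [apply ccont_bern3|apply ccont_cpow]. }
  unfold phi. replace (_ - _)%C with (CInt (fun y => RtoC (bern3 y) * cpow (INR (S k) + y) (s + h + 3)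
     + - RtoC 1 * cpoly (fun n => RtoC (bern3 y) * cpow (INR (S k) + y) (s + 3)
     * (cexp_term n * RtoC (- ln (INR (S k) + y)) ^ n)) h N)%C).
  2: { rewrite CInt_plus; [|easy|apply ccont_mult; [apply ccont_const|easy]].
       rewrite CInt_scal by easy. ring. }
  apply CInt_bound.
  { apply ccont_plus; [easy|]. apply ccont_mult; [apply ccont_const|easy]. }
  intros y Hy. assert (Hk := INR_S_ge1 k).
  assert (HL : 0 <= ln (INR (S k) + y)) by (rewrite <- ln_1; apply ln_le; lra).
  eapply Rle_trans; [|apply (phi_weight s k N r y (Cmod h) Hr Hs Hy)]; [|split; [apply Cmod_ge_0|easy]].
  rewrite cpoly_factor. replace (s + h + 3)%C with (s + 3 + h)%C by ring. rewrite cpow_plus.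
  replace (_ + _)%C with (RtoC (bern3 y) * cpow (INR (S k) + y) (s + 3) *
    (Cexp (RtoC (- ln (INR (S k) + y)) * h) - cpoly cexp_term (RtoC (- ln (INR (S k) + y)) * h) N))%C by ring.
  rewrite Cmod_mult. apply Rmult_le_compat_l; [apply Cmod_ge_0|].
  eapply Rle_trans; [apply Cexp_remainder|].
  rewrite Cmod_mult, Cmod_R, Rabs_Ropp, Rabs_right by lra.
  rewrite (Rmult_comm (ln _)). lra.
Qed.

(** * Analytic functions and the identity theorem *)

(** Analyticity at a point, as geometric decay of the Taylor remainders. Unlike
    convergence of the power series, these bounds add up over an infinite series
    of functions without exchanging two limits. *)
Definition taylor_at (f : C -> C) (s : C) : Prop :=
  exists (A : nat -> C) (r B : R), 0 < r /\ 0 <= B /\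
    forall h N, Cmod h <= r / 2 -> Cmod (f (s + h)%C - cpoly A h N)%C <= B * (Cmod h / r) ^ N.

(** Remainder bounds of the form [q^N * w k], with [w] summable, are summed
    over [k]. *)
Lemma taylor_Psi (s : C) : -2 < Re s -> taylor_at Psi s.
Proof.
  intros Hs. set (r := (Re s + 2) / 4).
  assert (Hr : 0 < r) by (unfold r; lra). assert (Hs4 : Re s + 2 = 4 * r) by (unfold r; field).
  assert (Hb := ex_series_power_weight (2 * r) ltac:(lra)).
  assert (Ha : forall n, csummable (fun k => phi_coef s k n)).
  { intros n. exists (fun k => (/ r) ^ n * power_weight (2 * r) k). split.
    - now apply (ex_series_scal ((/ r) ^ n) (power_weight (2 * r))).
    - intros k. now apply phi_coef_bound. }
  exists (fun n => csum (fun k => phi_coef s k n)), r, (Series (power_weight (2 * r))).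
  split; [easy|]. split.
  { rewrite <- (Rmult_0_l (Series (fun _ => 0))), <- Series_scal_l.
    apply Series_le; [|easy]. intros n. rewrite Rmult_0_l. split; [lra|apply Rlt_le, exp_pos]. }
  intros h N Hh. destruct (cpoly_csum (phi_coef s) h N Ha) as [Hc E]. rewrite E.
  assert (Hp : csummable (fun k => phi k (s + h)%C)).
  { exists (fun k => power_weight (2 * r) k). split; [easy|]. intros k.
    assert (H := phi_remainder s h k 0 r Hr Hs4 ltac:(lra)). simpl in H.
    rewrite Rmult_1_l in H. replace (phi k (s + h) - 0)%C with (phi k (s + h)%C) in H by ring. exact H. }
  unfold Psi. replace (_ - _)%C with
    (csum (fun k => phi k (s + h) + - RtoC 1 * cpoly (phi_coef s k) h N)%C).
  2: { rewrite csum_plus; [|easy|now apply csummable_scal]. rewrite csum_scal by easy. ring. }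
  rewrite Rmult_comm, <- Series_scal_l. apply csum_bound.
  - now apply (ex_series_scal _ (power_weight (2 * r))).
  - intros k. replace (_ + _)%C with (phi k (s + h) - cpoly (phi_coef s k) h N)%C by ring.
    apply phi_remainder; easy || lra.
Qed.

Lemma pow_div_radius (x r r' : R) (N : nat) : 0 <= x -> 0 < r' <= r -> (x / r) ^ N <= (x / r') ^ N.
Proof.
  intros Hx Hr. apply pow_incr. split.
  - apply Rmult_le_pos; [easy|]. apply Rlt_le, Rinv_0_lt_compat; lra.
  - apply Rmult_le_compat_l; [easy|]. apply Rinv_le_contravar; lra.
Qed.

Lemma cpoly_plus (A A' : nat -> C) (h : C) (N : nat) :
  cpoly (fun n => A n + A' n)%C h N = (cpoly A h N + cpoly A' h N)%C.
Proof. induction N as [|N IH]; simpl; [ring|]. rewrite IH. ring. Qed.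

Lemma taylor_plus (f g : C -> C) (s : C) : taylor_at f s -> taylor_at g s ->
  taylor_at (fun z => f z + g z)%C s.
Proof.
  intros (A & r & B & Hr & HB & H) (A' & r' & B' & Hr' & HB' & H').
  exists (fun n => A n + A' n)%C, (Rmin r r'), (B + B').
  assert (Hm : 0 < Rmin r r') by now apply Rmin_pos.
  assert (Hm1 := Rmin_l r r'). assert (Hm2 := Rmin_r r r').
  split; [easy|]. split; [lra|]. intros h N Hh. rewrite cpoly_plus.
  replace (_ - _)%C with ((f (s + h) - cpoly A h N) + (g (s + h) - cpoly A' h N))%C by ring.
  eapply Rle_trans; [apply Cmod_triangle|]. rewrite Rmult_plus_distr_r.
  assert (Hh0 := Cmod_ge_0 h).
  apply Rplus_le_compat.
  - eapply Rle_trans; [apply H; lra|]. apply Rmult_le_compat_l; [easy|]. apply pow_div_radius; lra.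
  - eapply Rle_trans; [apply H'; lra|]. apply Rmult_le_compat_l; [easy|]. apply pow_div_radius; lra.
Qed.

Lemma cpoly_const (c h : C) (N : nat) :
  cpoly (fun n => if (n =? 0)%nat then c else 0) h (S N) = c.
Proof. 
  induction N as [|N IH]; [simpl; ring|]. cbn [cpoly] in *. rewrite IH. simpl. ring.
Qed.

Lemma taylor_const (c s : C) : taylor_at (fun _ => c) s.
Proof.
  exists (fun n => if (n =? 0)%nat then c else 0), 1, (Cmod c).
  split; [lra|]. split; [apply Cmod_ge_0|]. intros h N Hh. destruct N as [|N].
  - simpl. rewrite Rmult_1_r. apply Req_le. f_equal. ring.
  - rewrite cpoly_const. replace (c - c)%C with (RtoC 0) by ring. rewrite Cmod_0.
    apply Rmult_le_pos; [apply Cmod_ge_0|]. apply pow_le.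
    apply Rmult_le_pos; [apply Cmod_ge_0|lra].
Qed.

Lemma cpoly_mul_linear (A : nat -> C) (c h : C) (N : nat) :
  cpoly (fun n => c * A n + match n with O => 0 | S m => A m end)%C h (S N)
  = (c * cpoly A h (S N) + h * cpoly A h N)%C.
Proof.
  induction N as [|N IH]; [simpl; ring|]. cbn [cpoly] in *. rewrite IH. simpl. ring.
Qed.

Lemma taylor_mul_linear (f : C -> C) (a s : C) : taylor_at f s -> taylor_at (fun z => (z + a) * f z)%C s.
Proof.
  intros (A & r & B & Hr & HB & H).
  exists (fun n => (s + a) * A n + match n with O => 0 | S m => A m end)%C, r, ((Cmod (s + a)%C + r) * B).
  assert (Hc := Cmod_ge_0 (s + a)%C).
  split; [easy|]. split; [apply Rmult_le_pos; lra|]. intros h N Hh. assert (Hh0 := Cmod_ge_0 h).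
  assert (Hq : forall n, 0 <= (Cmod h / r) ^ n).
  { intros n. apply pow_le, Rmult_le_pos; [easy|]. now apply Rlt_le, Rinv_0_lt_compat. }
  destruct N as [|N].
  - specialize (H h 0%nat Hh). simpl in *.
    replace ((s + h + a) * f (s + h) - 0)%C with ((s + a + h) * (f (s + h) - 0))%C by ring.
    rewrite Cmod_mult, Rmult_1_r in *. apply Rmult_le_compat; try apply Cmod_ge_0; [|easy].
    eapply Rle_trans; [apply Cmod_triangle|]. lra.
  - rewrite cpoly_mul_linear.
    replace (_ - _)%C with ((s + a) * (f (s + h) - cpoly A h (S N)) + h * (f (s + h) - cpoly A h N))%C by ring.
    eapply Rle_trans; [apply Cmod_triangle|]. rewrite 2!Cmod_mult.
    rewrite Rmult_plus_distr_r, Rmult_plus_distr_r. apply Rplus_le_compat.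
    + rewrite Rmult_assoc. apply Rmult_le_compat_l; [easy|]. now apply H.
    + replace (r * B * (Cmod h / r) ^ S N) with (Cmod h * (B * (Cmod h / r) ^ N)) by (simpl; field; lra).
      apply Rmult_le_compat_l; [easy|]. now apply H.
Qed.

Lemma C_partial_sums (a : nat -> C) (h l : C) :
  is_pseries (K := C_AbsRing) (V := C_NormedModule) a h l ->
  forall eps, 0 < eps -> exists n0, forall n, (n0 <= n)%nat -> Cmod (cpoly a h (S n) - l)%C < eps.
Proof.
  intros H eps Heps.
  assert (Heps2 : 0 < eps / 2) by lra.
  assert (HP : locally (l : C_NormedModule) (fun z : C => Cmod (z - l)%C < eps)).
  { exists (mkposreal _ Heps2). intros z [H1 H2].
    change (Rabs (fst z - fst l) < eps / 2) in H1. change (Rabs (snd z - snd l) < eps / 2) in H2.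
    eapply Rle_lt_trans; [apply Cmod_le_Re_Im|].
    replace eps with (eps / 2 + eps / 2) by field. apply Rplus_lt_compat; [exact H1|exact H2]. }
  destruct (H _ HP) as [n0 Hn0]. exists n0. intros n Hn. specialize (Hn0 n Hn).
  replace (cpoly a h (S n)) with (sum_n (G := C_NormedModule) (fun k => scal (pow_n (K := C_AbsRing) h k) (a k)) n); [exact Hn0|].
  clear. induction n as [|n IH].
  - rewrite sum_O. change (RtoC 1 * a 0%nat = 0 + a 0%nat * 1)%C. ring.
  - rewrite sum_Sn, IH. cbn [cpoly].
    change ((cpoly a h n + a n * h ^ n) + h ^ S n * a (S n) = cpoly a h n + a n * h ^ n + a (S n) * h ^ S n)%C. ring.
Qed.

Lemma eventually_bounded (u : nat -> R) (c : R) (n0 : nat) :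
  (forall n, (n0 <= n)%nat -> u n <= c) -> exists M, forall n, u n <= M.
Proof.
  induction n0 as [|n0 IH] in c |- *; intros H.
  - exists c. intros n. apply H. lia.
  - apply (IH (Rmax c (u n0))). intros n Hn. destruct (Nat.eq_dec n n0) as [->|Hne].
    + apply Rmax_r.
    + eapply Rle_trans; [apply H; lia|apply Rmax_l].
Qed.

(** The terms of the power series are bounded at half the radius of convergence,
    hence decay geometrically further inside. *)
Lemma taylor_analytic (f : C -> C) (s : C) : analytic_at f s -> taylor_at f s.
Proof.
  intros (a & r0 & Hr0 & H). set (r := r0 / 2).
  assert (Hr : 0 < r) by (unfold r; lra).
  assert (Hs : forall h, Cmod h <= r -> is_pseries (K := C_AbsRing) (V := C_NormedModule) a h (f (s + h)%C)).
  { intros h Hh. assert (E := H (s + h)%C). replace (s + h - s)%C with h in E by ring.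
    apply E. unfold r in Hh. lra. }
  assert (HM : exists M, forall n, Cmod (a n) * r ^ n <= M).
  { destruct (C_partial_sums a (RtoC r) _ (Hs (RtoC r) ltac:(rewrite Cmod_R, Rabs_right; lra)) 1 ltac:(lra)) as [n0 Hn0].
    apply (eventually_bounded _ 2 (S n0)). intros n Hn.
    assert (H1 := Hn0 n ltac:(lia)). destruct n as [|n]; [lia|]. assert (H2 := Hn0 n ltac:(lia)).
    replace (Cmod (a (S n)) * r ^ S n) with (Cmod (a (S n) * RtoC r ^ S n)%C)
      by (rewrite Cmod_mult, Cmod_pow, Cmod_R, Rabs_right by lra; easy).
    set (l := f (s + RtoC r)%C) in *.
    replace (a (S n) * RtoC r ^ S n)%C with ((cpoly a (RtoC r) (S (S n)) - l) + - (cpoly a (RtoC r) (S n) - l))%C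
      by (cbn [cpoly]; ring).
    eapply Rle_trans; [apply Cmod_triangle|]. rewrite Cmod_opp. lra. }
  destruct HM as [M HM].
  assert (HM0 : 0 <= M).
  { eapply Rle_trans; [|apply (HM 0%nat)]. rewrite Rmult_1_r. apply Cmod_ge_0. }
  exists a, r, (2 * M). split; [easy|]. split; [lra|]. intros h N Hh.
  assert (Hh0 := Cmod_ge_0 h). set (q := Cmod h / r).
  assert (Hq : 0 <= q <= 1 / 2).
  { unfold q. split; [apply Rmult_le_pos; [easy|]; now apply Rlt_le, Rinv_0_lt_compat|].
    apply (Rmult_le_reg_r r); [easy|]. unfold Rdiv. rewrite Rmult_assoc, Rinv_l; lra. }
  assert (Hterm : forall n, Cmod (a n * h ^ n)%C <= M * q ^ n).
  { intros n. rewrite Cmod_mult, Cmod_pow. unfold q, Rdiv. rewrite Rpow_mult_distr, pow_inv.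
    replace (Cmod (a n) * Cmod h ^ n) with (Cmod (a n) * r ^ n * (Cmod h ^ n * / r ^ n))
      by (field; apply pow_nonzero; lra).
    apply Rmult_le_compat_r; [|apply HM].
    apply Rmult_le_pos; [now apply pow_le|]. now apply Rlt_le, Rinv_0_lt_compat, pow_lt. }
  assert (Hdiff : forall m, Cmod (cpoly a h (N + m) - cpoly a h N)%C <= 2 * M * q ^ N - 2 * M * q ^ (N + m)).
  { induction m as [|m IH].
    - rewrite Nat.add_0_r. replace (_ - _)%C with (RtoC 0) by ring. rewrite Cmod_0. lra.
    - rewrite Nat.add_succ_r. cbn [cpoly].
      replace (_ - _)%C with ((cpoly a h (N + m) - cpoly a h N) + a (N + m)%nat * h ^ (N + m))%C by ring.
      eapply Rle_trans; [apply Cmod_triangle|].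
      eapply Rle_trans; [apply Rplus_le_compat; [apply IH|apply Hterm]|].
      simpl. assert (0 <= M * q ^ (N + m)) by (apply Rmult_le_pos; [easy|apply pow_le; lra]). nra. }
  apply le_epsilon. intros eps Heps.
  destruct (C_partial_sums a h _ (Hs h ltac:(lra)) eps Heps) as [n0 Hn0].
  specialize (Hn0 (N + n0)%nat ltac:(lia)). specialize (Hdiff (S n0)).
  rewrite Nat.add_succ_r in Hdiff.
  replace (f (s + h) - cpoly a h N)%C with ((cpoly a h (S (N + n0)) - cpoly a h N) + - (cpoly a h (S (N + n0)) - f (s + h)))%C by ring.
  eapply Rle_trans; [apply Cmod_triangle|]. rewrite Cmod_opp.
  assert (0 <= 2 * M * q ^ S (N + n0)) by (apply Rmult_le_pos; [lra|apply pow_le; lra]). lra.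
Qed.

(** If all coefficients below [n] vanish, then at a zero [s + h] of [f] the
    remainder bound of order [n + 1] gives [|A n| <= K |h|]; as [h] can be taken
    arbitrarily small, [A n = 0]. *)
Lemma taylor_isolated_zeros (f : C -> C) (s : C) : taylor_at f s ->
  (forall eps, 0 < eps -> exists h, 0 < Cmod h < eps /\ f (s + h)%C = 0) ->
  exists r, 0 < r /\ forall h, Cmod h <= r -> f (s + h)%C = 0.
Proof.
  intros (A & r & B & Hr & HB & H) Hz.
  assert (HA : forall n, A n = 0).
  { intros n. induction n as [n IH] using lt_wf_ind.
    assert (Hp : forall h, cpoly A h (S n) = (A n * h ^ n)%C).
    { intros h. cbn [cpoly]. replace (cpoly A h n) with (RtoC 0); [ring|].
      clear -IH. induction n as [|n IHn]; [easy|]. cbn [cpoly]. rewrite <- IHn by (intros; apply IH; lia).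
      rewrite IH by lia. ring. }
    apply Cmod_eq_0. apply Rle_antisym; [|apply Cmod_ge_0].
    apply le_epsilon. intros eps Heps. rewrite Rplus_0_l.
    set (K := B / r ^ S n + 1).
    assert (HK : 0 < K).
    { unfold K. assert (0 <= B / r ^ S n); [|lra]. apply Rmult_le_pos; [easy|].
      now apply Rlt_le, Rinv_0_lt_compat, pow_lt. }
    destruct (Hz (Rmin (r / 2) (eps / K))) as [h [Hh Hf]].
    { apply Rmin_pos; [lra|now apply Rdiv_lt_0_compat]. }
    assert (Hh1 : Cmod h < r / 2) by (eapply Rlt_le_trans; [apply Hh|apply Rmin_l]).
    assert (Hh2 : Cmod h < eps / K) by (eapply Rlt_le_trans; [apply Hh|apply Rmin_r]).
    specialize (H h (S n) ltac:(lra)). rewrite Hf, Hp in H.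
    replace (0 - A n * h ^ n)%C with (- (A n * h ^ n))%C in H by ring.
    rewrite Cmod_opp, Cmod_mult, Cmod_pow in H.
    assert (Hpn : 0 < Cmod h ^ n) by now apply pow_lt.
    unfold Rdiv in H. rewrite Rpow_mult_distr, pow_inv in H.
    replace (B * (Cmod h ^ S n * / r ^ S n)) with (B / r ^ S n * Cmod h * Cmod h ^ n) in H
      by (simpl; field; split; [apply pow_nonzero|]; lra).
    apply Rmult_le_reg_r in H; [|easy]. eapply Rle_trans; [exact H|].
    apply Rle_trans with (K * Cmod h); [unfold K; nra|].
    apply (Rmult_lt_compat_l K) in Hh2; [|easy]. replace (K * (eps / K)) with eps in Hh2 by (field; lra). lra. }
  exists (r / 2). split; [lra|]. intros h Hh. apply Cmod_eq_0. apply Rle_antisym; [|apply Cmod_ge_0].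
  assert (Hh0 := Cmod_ge_0 h). set (q := Cmod h / r).
  assert (Hq : 0 <= q <= 1 / 2).
  { unfold q. split; [apply Rmult_le_pos; [easy|]; now apply Rlt_le, Rinv_0_lt_compat|].
    apply (Rmult_le_reg_r r); [easy|]. unfold Rdiv. rewrite Rmult_assoc, Rinv_l; lra. }
  assert (Hl : is_lim_seq (fun N => B * q ^ N) 0).
  { replace (Finite 0) with (Rbar_mult B 0) by (simpl; f_equal; ring).
    apply is_lim_seq_scal_l, is_lim_seq_geom. rewrite Rabs_right; lra. }
  refine (is_lim_seq_le _ _ (Finite _) (Finite _) _ (is_lim_seq_const _) Hl).
  intros N. assert (HN := H h N Hh). fold q in HN.
  replace (cpoly A h N) with (RtoC 0) in HN.
  - now replace (f (s + h) - 0)%C with (f (s + h)%C) in HN by ring.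
  - clear -HA. induction N as [|N IH]; [easy|]. cbn [cpoly]. rewrite <- IH, HA. ring.
Qed.

(** The identity theorem along a segment: the zero set cannot stop before the
    end, because its end point would be an accumulation point of zeros. *)
Lemma identity_segment (f : C -> C) (p w : C) (t0 : R) : w <> 0 -> 0 <= t0 < 1 ->
  (forall t, 0 <= t <= 1 -> taylor_at f (p + RtoC t * w)%C) ->
  (forall t, t0 < t <= 1 -> f (p + RtoC t * w)%C = 0) ->
  exists r, 0 < r /\ forall h, Cmod h <= r -> f (p + h)%C = 0.
Proof.
  intros Hw Ht0 Hf Hz.
  assert (Hw0 : 0 < Cmod w) by now apply Cmod_gt_0.
  (* [1 - x] ranges over the parameters beyond which [f] vanishes on the
     segment. *)
  set (E := fun x => 0 <= x <= 1 /\ forall t, 1 - x < t <= 1 -> f (p + RtoC t * w)%C = 0).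
  destruct (completeness E) as [m [Hub Hlub]].
  { exists 1. intros x [Hx _]. lra. }
  { exists (1 - t0). split; [lra|]. intros t Ht. apply Hz. lra. }
  assert (Hm1 : 1 - t0 <= m).
  { apply Hub. split; [lra|]. intros t Ht. apply Hz. lra. }
  assert (Hm2 : m <= 1) by (apply Hlub; intros x [Hx _]; lra).
  assert (Hzm : forall t, 1 - m < t <= 1 -> f (p + RtoC t * w)%C = 0).
  { intros t Ht. destruct (Classical_Prop.classic (exists x, E x /\ 1 - x < t)) as [[x [Hx Hxt]]|Hn].
    - apply Hx. lra.
    - exfalso. assert (m <= 1 - t); [|lra]. apply Hlub. intros x Hx.
      apply Rnot_lt_le. intros Hlt. apply Hn. exists x. split; [easy|lra]. }
  destruct (taylor_isolated_zeros f (p + RtoC (1 - m) * w)%C) as [r [Hr Hfr]].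
  - apply Hf. lra.
  - intros eps Heps. set (d := Rmin (m / 2) (eps / (2 * Cmod w))).
    assert (Hd0 : 0 < d) by (apply Rmin_pos; [lra|apply Rdiv_lt_0_compat; lra]).
    assert (Hd1 : d <= m / 2) by apply Rmin_l.
    assert (Hd2 : d <= eps / (2 * Cmod w)) by apply Rmin_r.
    exists (RtoC d * w)%C. rewrite Cmod_mult, Cmod_R, Rabs_right by lra. split; [split|].
    + now apply Rmult_lt_0_compat.
    + apply (Rmult_le_compat_r (Cmod w)) in Hd2; [|lra].
      replace (eps / (2 * Cmod w) * Cmod w) with (eps / 2) in Hd2 by (field; lra). lra.
    + replace (p + RtoC (1 - m) * w + RtoC d * w)%C with (p + RtoC (1 - m + d) * w)%C
        by (rewrite (RtoC_plus (1 - m)); ring).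
      apply Hzm. lra.
  - destruct (Req_dec m 1) as [Hm|Hm].
    + exists r. split; [easy|]. intros h Hh. specialize (Hfr h Hh).
      rewrite Hm, Rminus_diag in Hfr. now replace (p + RtoC 0 * w + h)%C with (p + h)%C in Hfr by ring.
    + exfalso. set (d := Rmin (1 - m) (r / Cmod w)).
      assert (Hd0 : 0 < d) by (apply Rmin_pos; [lra|apply Rdiv_lt_0_compat; lra]).
      assert (Hd1 : d <= 1 - m) by apply Rmin_l.
      assert (Hd2 : d <= r / Cmod w) by apply Rmin_r.
      assert (m + d <= m); [|lra]. apply Hub. split; [lra|]. intros t Ht.
      destruct (Rlt_le_dec (1 - m) t) as [Hlt|Hge]; [apply Hzm; lra|].
      replace (p + RtoC t * w)%C with (p + RtoC (1 - m) * w + RtoC (t - (1 - m)) * w)%C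
        by (rewrite (RtoC_minus t); ring).
      apply Hfr. rewrite Cmod_mult, Cmod_R, Rabs_left1 by lra.
      apply (Rmult_le_compat_r (Cmod w)) in Hd2; [|lra].
      replace (r / Cmod w * Cmod w) with r in Hd2 by (field; lra). nra.
Qed.

(** * The zeta function near -1 *)

(** The formula is multiplied by [1 - s], which keeps the antiderivative
    [x^(1-s)/(1-s)] free of a division. *)
Lemma phi_euler_maclaurin (k : nat) (s : C) :
  let x := INR (S k) in
  (RtoC (/ 2) * (1 - s) * (cpow x s + cpow (x + 1) s) - (cpow (x + 1) (s - 1) - cpow x (s - 1))
    + RtoC (/ 12) * (s * (1 - s)) * (cpow (x + 1) (s + 1) - cpow x (s + 1)))%C
  = (- RtoC (/ 6) * (s * (s + 1) * (s + 2) * (1 - s)) * phi k s)%C.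
Proof.
  intros x. assert (Hx := INR_S_ge1 k). fold x in Hx.
  apply C_eq_of_Re. intros c.
  assert (Hd : forall a b s' y, 0 < y -> a = (- (b * s'))%C -> is_derive (fun x => Re (b * cpow x s')%C) y (Re (a * cpow y (s' + 1))%C)).
  { intros a b s' y Hy ->. now apply is_derive_Re_cpow. }
  set (c0 := (c * (1 - s))%C). set (c1 := (- (c0 * s))%C). set (c2 := (- (c1 * (s + 1)))%C).
  set (c3 := (- (c2 * (s + 2)))%C).
  assert (H : is_RInt (fun y => bern3 y * Re (c3 * cpow (x + y) (s + 3))%C) 0 1
     (6 * (/ 2 * (Re (c0 * cpow x s)%C + Re (c0 * cpow (x + 1) s)%C)
        - (Re (c * cpow (x + 1) (s - 1))%C - Re (c * cpow x (s - 1))%C)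
        - / 12 * (Re (c1 * cpow (x + 1) (s + 1))%C - Re (c1 * cpow x (s + 1))%C)))).
  { apply (euler_maclaurin_unit (fun t => Re (c * cpow t (s - 1))%C) (fun t => Re (c0 * cpow t s)%C)
      (fun t => Re (c1 * cpow t (s + 1))%C) (fun t => Re (c2 * cpow t (s + 2))%C)
      (fun t => Re (c3 * cpow t (s + 3))%C)); intros t Ht.
    - replace (cpow t s) with (cpow t (s - 1 + 1)) by (f_equal; ring).
      apply Hd; [lra|]. unfold c0. ring.
    - apply Hd; [lra|]. easy.
    - replace (s + 2)%C with (s + 1 + 1)%C by ring. apply Hd; [lra|]. easy.
    - replace (s + 3)%C with (s + 2 + 1)%C by ring. apply Hd; [lra|]. easy.
    - apply (ex_derive_continuous (fun t => Re (c3 * cpow t (s + 3))%C)).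
      eexists. apply is_derive_Re_cpow. lra. }
  apply (is_RInt_unique (V := R_CompleteNormedModule)) in H.
  assert (E : Re (c3 * phi k s)%C = RInt (fun y => bern3 y * Re (c3 * cpow (x + y) (s + 3))%C) 0 1).
  { unfold phi. rewrite <- CInt_scal by (apply ccont_mult; [apply ccont_bern3|apply ccont_cpow]).
    change (RInt (fun y => Re (c3 * (RtoC (bern3 y) * cpow (x + y) (s + 3)))%C) 0 1
      = RInt (fun y => bern3 y * Re (c3 * cpow (x + y) (s + 3))%C) 0 1).
    apply RInt_ext. intros y _.
    generalize (cpow (x + y) (s + 3)) c3. intros [] []. unfold Re, Cmult, RtoC; simpl. ring. }
  rewrite H in E.
  replace (c * (- RtoC (/ 6) * (s * (s + 1) * (s + 2) * (1 - s)) * phi k s))%C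
    with (RtoC (/ 6) * (c3 * phi k s))%C by (unfold c3, c2, c1, c0; ring).
  assert (Hsc : forall a z, Re (RtoC a * z)%C = a * Re z).
  { intros a z. destruct z. unfold Re, Cmult, RtoC; simpl. ring. }
  assert (Hpl : forall z z', Re (z + z')%C = Re z + Re z') by (intros; reflexivity).
  assert (Hmi : forall z z', Re (z - z')%C = Re z - Re z') by (intros; reflexivity).
  rewrite Hsc, E.
  replace (c * _)%C with (RtoC (/ 2) * (c0 * cpow x s + c0 * cpow (x + 1) s)
    - (c * cpow (x + 1) (s - 1) - c * cpow x (s - 1))
    - RtoC (/ 12) * (c1 * cpow (x + 1) (s + 1) - c1 * cpow x (s + 1)))%C
    by (unfold c1, c0; ring).
  rewrite 2!Hmi, 2!Hsc, Hpl, 2!Hmi. field.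
Qed.

Definition cpartial (u : nat -> C) (n : nat) : C := cpoly u 1 (S n).

Lemma cpartial_S (u : nat -> C) (n : nat) : cpartial u (S n) = (cpartial u n + u (S n))%C.
Proof. unfold cpartial. cbn [cpoly]. rewrite !Cpow_1_l. ring. Qed.

Lemma cpartial_0 (u : nat -> C) : cpartial u 0 = u 0%nat.
Proof. unfold cpartial. simpl. ring. Qed.

Lemma cpow_1 (s : C) : cpow 1 s = 1.
Proof.
  unfold cpow. rewrite ln_1. replace (- (s * 0))%C with (RtoC 0) by ring.
  unfold Cexp; simpl. rewrite exp_0, cos_0, sin_0. unfold RtoC. f_equal; ring.
Qed.

Lemma dirichlet_partial (s : C) (n : nat) :
  let X := INR (S (S n)) in
  ((1 - s) * (cpartial (fun k => cpow (INR (S k)) s) (S n) - RtoC (/ 2) - RtoC (/ 2) * cpow X s)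
    - (cpow X (s - 1) - 1) + RtoC (/ 12) * (s * (1 - s)) * (cpow X (s + 1) - 1))%C
  = (- RtoC (/ 6) * (s * (s + 1) * (s + 2) * (1 - s)) * cpartial (fun k => phi k s) n)%C.
Proof.
  assert (H2 : RtoC (/ 2) = (/ 2)%C) by (apply RtoC_inv; lra).
  assert (H20 : RtoC 2 <> 0) by (intros E; apply RtoC_inj in E; lra).
  induction n as [|n IH]; intros X.
  - assert (H := phi_euler_maclaurin 0 s). cbv zeta in H.
    rewrite cpartial_S, 2!cpartial_0, <- H, <- S_INR. unfold X. simpl (INR 1). rewrite !cpow_1, H2. now field.
  - rewrite (cpartial_S _ (S n)), (cpartial_S (fun k => phi k s)),
      (Cmult_plus_distr_l (- RtoC (/ 6) * _)). cbv zeta in IH.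
    rewrite <- IH, <- (phi_euler_maclaurin (S n) s). cbv zeta. rewrite <- S_INR. fold X.
    rewrite H2. now field.
Qed.

Definition clim (u : nat -> C) (l : C) : Prop := is_lim_seq (fun n => Cmod (u n - l)%C) 0.

Lemma clim_of_le (u : nat -> C) (l : C) (b : nat -> R) :
  (forall n, Cmod (u n - l)%C <= b n) -> is_lim_seq b 0 -> clim u l.
Proof.
  intros H Hb. apply (is_lim_seq_le_le (fun _ => 0) _ b); [|apply is_lim_seq_const|exact Hb].
  intros n. split; [apply Cmod_ge_0|apply H].
Qed.

Lemma clim_const (c : C) : clim (fun _ => c) c.
Proof.
  apply (clim_of_le _ _ (fun _ => 0)); [|apply is_lim_seq_const].
  intros n. replace (c - c)%C with (RtoC 0) by ring. rewrite Cmod_0. lra.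
Qed.

Lemma clim_plus (u v : nat -> C) (l m : C) : clim u l -> clim v m -> clim (fun n => u n + v n)%C (l + m)%C.
Proof.
  intros Hu Hv. apply (clim_of_le _ _ (fun n => Cmod (u n - l)%C + Cmod (v n - m)%C)).
  - intros n. replace (u n + v n - (l + m))%C with ((u n - l) + (v n - m))%C by ring. apply Cmod_triangle.
  - replace (Finite 0) with (Finite (0 + 0)) by (f_equal; ring). now apply is_lim_seq_plus'.
Qed.

Lemma clim_scal (c : C) (u : nat -> C) (l : C) : clim u l -> clim (fun n => c * u n)%C (c * l)%C.
Proof.
  intros Hu. apply (clim_of_le _ _ (fun n => Cmod c * Cmod (u n - l)%C)).
  - intros n. rewrite <- Cmod_mult. apply Req_le. f_equal. ring.
  - replace (Finite 0) with (Finite (Cmod c * 0)) by (f_equal; ring).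
    apply (is_lim_seq_scal_l _ (Cmod c) 0 Hu).
Qed.

Lemma clim_minus (u v : nat -> C) (l m : C) : clim u l -> clim v m -> clim (fun n => u n - v n)%C (l - m)%C.
Proof.
  intros Hu Hv. assert (H := clim_plus _ _ _ _ Hu (clim_scal (- (1)) _ _ Hv)).
  apply (clim_of_le _ _ (fun n => Cmod (u n + - (1) * v n - (l + - (1) * m))%C)); [|exact H].
  intros n. apply Req_le. f_equal. ring.
Qed.

Lemma clim_unique (u v : nat -> C) (l m : C) : (forall n, u n = v n) -> clim u l -> clim v m -> l = m.
Proof.
  intros E Hu Hv. assert (H := clim_minus _ _ _ _ Hu Hv).
  assert (H0 : is_lim_seq (fun _ => Cmod (l - m)%C) 0).
  { revert H. apply is_lim_seq_ext. intros n. rewrite E. rewrite <- Cmod_opp. f_equal. ring. }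
  apply is_lim_seq_unique in H0. rewrite Lim_seq_const in H0. injection H0 as H0.
  apply Cmod_eq_0 in H0. replace l with ((l - m) + m)%C by ring. rewrite H0. ring.
Qed.

Lemma clim_series (u : nat -> C) (l : C) :
  is_series (K := C_AbsRing) (V := C_NormedModule) u l -> clim (cpartial u) l.
Proof.
  intros H.
  assert (H1 : is_pseries (K := C_AbsRing) (V := C_NormedModule) u (RtoC 1) l).
  { revert H. apply (is_series_ext (K := C_AbsRing) (V := C_NormedModule)). intros n.
    assert (E : pow_n (K := C_AbsRing) (RtoC 1) n = RtoC 1).
    { induction n as [|n IH]; [reflexivity|]. simpl. rewrite IH. apply Cmult_1_l. }
    rewrite E. symmetry. apply Cmult_1_l. }
  apply is_lim_seq_spec. intros eps.
  destruct (C_partial_sums u (RtoC 1) l H1 eps (cond_pos eps)) as [n0 Hn0].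
  exists n0. intros n Hn. rewrite Rminus_0_r, Rabs_right by (apply Rle_ge, Cmod_ge_0).
  now apply Hn0.
Qed.

Lemma clim_csum (u : nat -> C) : csummable u -> clim (cpartial u) (csum u).
Proof.
  intros Hu. destruct (csummable_ex u Hu) as [H1 H2].
  apply Series_correct in H1, H2.
  assert (E : forall n, cpartial u n = (sum_n (fun k => Re (u k)) n, sum_n (fun k => Im (u k)) n)).
  { induction n as [|n IH].
    - rewrite cpartial_0, 2!sum_O. now destruct (u 0%nat).
    - rewrite cpartial_S, 2!sum_Sn, IH. destruct (u (S n)). reflexivity. }
  apply (clim_of_le _ _ (fun n => Rabs (sum_n (fun k => Re (u k)) n - Series (fun k => Re (u k)))
     + Rabs (sum_n (fun k => Im (u k)) n - Series (fun k => Im (u k))))).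
  - intros n. rewrite E. eapply Rle_trans; [apply Cmod_le_Re_Im|]. apply Rle_refl.
  - assert (Hab : forall v l, is_lim_seq v (Finite l) -> is_lim_seq (fun n => Rabs (v n - l)) 0).
    { intros v l Hv. replace (Finite 0) with (Rbar_abs (l - l)) by (simpl; f_equal; rewrite Rminus_diag; apply Rabs_R0).
      apply is_lim_seq_abs, is_lim_seq_minus'; [exact Hv|apply is_lim_seq_const]. }
    replace (Finite 0) with (Finite (0 + 0)) by (f_equal; ring).
    apply is_lim_seq_plus'; now apply Hab.
Qed.

Lemma clim_cpow (s : C) : 0 < Re s -> clim (fun n => cpow (INR (S (S n))) s) 0.
Proof.
  intros Hs. apply (clim_of_le _ _ (fun n => exp (- Re s * ln (INR (S (S n)))))).
  - intros n. replace (cpow (INR (S (S n))) s - 0)%C with (cpow (INR (S (S n))) s) by ring.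
    rewrite Cmod_cpow. apply exp_le_mono. lra.
  - apply (is_lim_comp_seq exp _ m_infty 0).
    + apply is_lim_exp_m.
    + now exists 0%nat.
    + replace m_infty with (Rbar_mult (- Re s) p_infty).
      * apply is_lim_seq_scal_l.
        apply (is_lim_comp_seq ln _ p_infty p_infty); [apply is_lim_ln_p|now exists 0%nat|].
        apply (is_lim_seq_incr_1 (fun n => INR (S n))), (is_lim_seq_incr_1 INR), is_lim_seq_INR.
      * unfold Rbar_mult, Rbar_mult'. destruct (Rle_dec 0 (- Re s)) as [H|H]; [exfalso; lra|easy].
Qed.

Lemma csummable_phi (s : C) : -2 < Re s -> csummable (fun k => phi k s).
Proof.
  intros Hs. set (r := (Re s + 2) / 4).
  assert (Hr : 0 < r) by (unfold r; lra). assert (Hs4 : Re s + 2 = 4 * r) by (unfold r; field).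
  exists (power_weight (2 * r)). split; [apply ex_series_power_weight; lra|]. intros k.
  assert (H := phi_remainder s 0 k 0 r Hr Hs4 ltac:(rewrite Cmod_0; lra)). simpl in H.
  rewrite Rmult_1_l in H. now replace (phi k (s + 0) - 0)%C with (phi k s) in H by (replace (s + 0)%C with s by ring; ring).
Qed.

(** [(s - 1) zeta s] minus its Euler-Maclaurin expression, arranged as nested
    linear factors so that its analyticity is immediate. *)
Definition zeta_defect (zeta : C -> C) (s : C) : C :=
  ((s + - (1)) * zeta s + (- (1) + ((s + - (1)) * - (/ 2) + ((s + 0) * ((s + - (1)) * - (/ 12))
   + (s + - (1)) * ((s + 0) * ((s + 1) * ((s + 2) * (/ 6 * Psi s))))))))%C.

Lemma zeta_defect_dirichlet (zeta : C -> C) (s : C) : is_riemann_zeta zeta ->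
  1 < Re s -> zeta_defect zeta s = 0.
Proof.
  intros [Hz _] Hs. specialize (Hz s Hs).
  apply clim_series in Hz. change (clim (cpartial (fun k => cpow (INR (S k)) s)) (zeta s)) in Hz.
  assert (Hz' : clim (fun n => cpartial (fun k => cpow (INR (S k)) s) (S n)) (zeta s)).
  { apply (is_lim_seq_incr_1 (fun n => Cmod (cpartial (fun k => cpow (INR (S k)) s) n - zeta s)%C)). exact Hz. }
  assert (Hp := clim_csum _ (csummable_phi s ltac:(lra))). fold (Psi s) in Hp.
  assert (H0 := clim_cpow s ltac:(lra)).
  assert (H1 := clim_cpow (s - 1)%C ltac:(destruct s; simpl in *; lra)).
  assert (H2 := clim_cpow (s + 1)%C ltac:(destruct s; simpl in *; lra)).
  assert (HL := clim_plus _ _ _ _ (clim_minus _ _ _ _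
      (clim_scal (1 - s)%C _ _ (clim_minus _ _ _ _ (clim_minus _ _ _ _ Hz' (clim_const (RtoC (/ 2))))
          (clim_scal (RtoC (/ 2)) _ _ H0)))
      (clim_minus _ _ _ _ H1 (clim_const 1)))
      (clim_scal (RtoC (/ 12) * (s * (1 - s)))%C _ _ (clim_minus _ _ _ _ H2 (clim_const 1)))).
  assert (HR := clim_scal (- RtoC (/ 6) * (s * (s + 1) * (s + 2) * (1 - s)))%C _ _ Hp).
  assert (E := clim_unique _ _ _ _ (dirichlet_partial s) HL HR).
  unfold zeta_defect. rewrite !RtoC_inv in E by lra.
  assert (H6 : RtoC 6 <> 0) by (intros E'; apply RtoC_inj in E'; lra).
  assert (H12 : RtoC 12 <> 0) by (intros E'; apply RtoC_inj in E'; lra).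
  assert (H20 : RtoC 2 <> 0) by (intros E'; apply RtoC_inj in E'; lra).
  match type of E with ?a = ?b => transitivity (b - a)%C; [field; easy|rewrite E; ring] end.
Qed.

Lemma taylor_scal (c : C) (f : C -> C) (s : C) : taylor_at f s -> taylor_at (fun z => c * f z)%C s.
Proof.
  intros (A & r & B & Hr & HB & H). exists (fun n => c * A n)%C, r, (Cmod c * B).
  assert (Hc := Cmod_ge_0 c).
  split; [easy|]. split; [now apply Rmult_le_pos|]. intros h N Hh.
  replace (c * f (s + h) - cpoly (fun n => c * A n) h N)%C with (c * (f (s + h) - cpoly A h N))%C.
  - rewrite Cmod_mult, Rmult_assoc. apply Rmult_le_compat_l; [easy|]. now apply H.
  - clear. enough (E : cpoly (fun n => c * A n)%C h N = (c * cpoly A h N)%C) by (rewrite E; ring).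
    induction N as [|N IH]; simpl; [ring|]. rewrite IH. ring.
Qed.

Lemma taylor_zeta_defect (zeta : C -> C) (s : C) : is_riemann_zeta zeta ->
  -2 < Re s -> s <> 1 -> taylor_at (zeta_defect zeta) s.
Proof.
  intros [_ Hz] Hs Hs1.
  assert (H1 := taylor_mul_linear zeta (- (1))%C s (taylor_analytic zeta s (Hz s Hs1))).
  assert (H2 := taylor_mul_linear _ (- (1))%C s (taylor_const (- (/ 2))%C s)).
  assert (H3 := taylor_mul_linear _ 0 s (taylor_mul_linear _ (- (1))%C s (taylor_const (- (/ 12))%C s))).
  assert (H4 := taylor_mul_linear _ (- (1))%C s (taylor_mul_linear _ 0 s (taylor_mul_linear _ 1 s
     (taylor_mul_linear _ 2 s (taylor_scal (/ 6)%C _ s (taylor_Psi s Hs)))))).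
  exact (taylor_plus _ _ s H1 (taylor_plus _ _ s (taylor_const (- (1))%C s)
     (taylor_plus _ _ s H2 (taylor_plus _ _ s H3 H4)))).
Qed.

(** The segment from [-1] to [2 + i] crosses the line [Re s = 1] at [1 + 2i/3] and so
    avoids the pole at [1]. *)
Lemma zeta_defect_zero (zeta : C -> C) : is_riemann_zeta zeta ->
  exists r, 0 < r /\ forall h, Cmod h <= r -> zeta_defect zeta (RtoC (-1) + h)%C = 0.
Proof.
  intros Hz.
  assert (HRe : forall t, Re (RtoC (-1) + RtoC t * (3, 1))%C = -1 + 3 * t)
    by (intros t; unfold Re, Cplus, Cmult, RtoC; simpl; ring).
  assert (HIm : forall t, Im (RtoC (-1) + RtoC t * (3, 1))%C = t)
    by (intros t; unfold Im, Cplus, Cmult, RtoC; simpl; ring).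
  apply (identity_segment _ _ (3, 1) (2 / 3)); [|lra| |].
  - intros E. apply (f_equal fst) in E. simpl in E. lra.
  - intros t Ht. apply taylor_zeta_defect; [easy|rewrite HRe; lra|].
    intros E. assert (E1 := HRe t). assert (E2 := HIm t). rewrite E in E1, E2. simpl in E1, E2. lra.
  - intros t Ht. apply zeta_defect_dirichlet; [easy|]. rewrite HRe. lra.
Qed.

Lemma cpow_2 (x : R) : 0 < x -> cpow x (RtoC (-1) + 3)%C = RtoC (/ x ^ 2).
Proof.
  intros Hx. replace (RtoC (-1) + 3)%C with (0 + 1 + 1)%C.
  - rewrite 2!cpow_shift1 by easy. replace (cpow x 0) with (RtoC 1).
    + rewrite <- 2!RtoC_mult. f_equal. field. lra.
    + unfold cpow. replace (- (0 * RtoC (ln x)))%C with (RtoC 0) by ring.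
      unfold Cexp; simpl. rewrite exp_0, cos_0, sin_0. unfold RtoC. f_equal; ring.
  - unfold Cplus, RtoC; simpl. f_equal; ring.
Qed.

Lemma Re_phi_kinkelin_term (k : nat) : Re (phi k (RtoC (-1))) = kinkelin_term k.
Proof.
  unfold phi, kinkelin_term. 
  change (RInt (fun y => Re (RtoC (bern3 y) * cpow (INR (S k) + y) (RtoC (-1) + 3))%C) 0 1
   = RInt (fun y => bern3 y * / (INR (S k) + y) ^ 2) 0 1).
  apply RInt_ext. intros y. rewrite Rmin_left, Rmax_right by lra. intros Hy.
  assert (Hk := INR_S_ge1 k). rewrite cpow_2 by lra. rewrite <- RtoC_mult. reflexivity.
Qed.

Lemma Re_Psi_kinkelin_sum : is_lim_seq (sum_f_R0 kinkelin_term) (Re (Psi (RtoC (-1)))).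
Proof.
  destruct (csummable_ex _ (csummable_phi (RtoC (-1)) ltac:(simpl; lra))) as [H _].
  apply Series_correct in H.
  change (is_lim_seq (sum_n (fun k => Re (phi k (RtoC (-1))))) (Re (Psi (RtoC (-1))))) in H.
  revert H. apply is_lim_seq_ext. intros n. rewrite sum_n_Reals. apply sum_eq. intros; apply Re_phi_kinkelin_term.
Qed.

Lemma Psi_lim : is_lim (fun x => Re (Psi (RtoC x))) (-1) (Re (Psi (RtoC (-1)))).
Proof.
  destruct (taylor_Psi (RtoC (-1)) ltac:(simpl; lra)) as (A & r & B & Hr & HB & H).
  assert (HA : Psi (RtoC (-1)) = A 0%nat).
  { assert (E := H 0 1%nat ltac:(rewrite Cmod_0; lra)). rewrite Cmod_0 in E.
    replace (B * (0 / r) ^ 1) with 0 in E by (field; lra).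
    simpl cpoly in E. replace (RtoC (-1) + 0)%C with (RtoC (-1)) in E by ring.
    assert (E0 : (Psi (RtoC (-1)) - (0 + A 0%nat * 1))%C = 0).
    { apply Cmod_eq_0. apply Rle_antisym; [exact E|apply Cmod_ge_0]. }
    replace (Psi (RtoC (-1))) with ((Psi (RtoC (-1)) - (0 + A 0%nat * 1)) + A 0%nat)%C by ring.
    rewrite E0. ring. }
  assert (Hlip : forall x : R, Rabs (x + 1) <= r / 2 ->
    Re (Psi (RtoC (-1))) - B / r * Rabs (x + 1) <= Re (Psi (RtoC x)) <= Re (Psi (RtoC (-1))) + B / r * Rabs (x + 1)).
  { intros x Hx.
    assert (E := H (RtoC (x + 1)) 1%nat ltac:(rewrite Cmod_R; lra)).
    replace (RtoC (-1) + RtoC (x + 1))%C with (RtoC x) in E by (rewrite <- RtoC_plus; f_equal; ring).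
    simpl cpoly in E. rewrite <- HA, Cmod_R, pow_1 in E.
    replace (Psi (RtoC x) - (0 + Psi (RtoC (-1)) * 1))%C with (Psi (RtoC x) - Psi (RtoC (-1)))%C in E by ring.
    assert (E1 := Rle_trans _ _ _ (re_le_Cmod _) E).
    change (Re (Psi (RtoC x) - Psi (RtoC (-1)))%C) with (Re (Psi (RtoC x)) - Re (Psi (RtoC (-1)))) in E1.
    apply Rabs_le_between in E1.
    replace (B * (Rabs (x + 1) / r)) with (B / r * Rabs (x + 1)) in E1 by (field; lra). lra. }
  apply (is_lim_le_le_loc (fun x => Re (Psi (RtoC (-1))) - B / r * Rabs (x + 1))
     (fun x => Re (Psi (RtoC (-1))) + B / r * Rabs (x + 1))).
  - assert (Hr2 : 0 < r / 2) by lra. exists (mkposreal _ Hr2). intros x Hx _.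
    change (Rabs (x - -1) < r / 2) in Hx. apply Hlip.
    replace (x + 1) with (x - -1) by ring. now apply Rlt_le.
  - replace (Finite (Re (Psi (RtoC (-1))))) with (Finite (Re (Psi (RtoC (-1))) - B / r * Rabs (-1 + 1)))
      by (f_equal; replace (-1 + 1) with 0 by ring; rewrite Rabs_R0; ring).
    apply (is_lim_continuity (fun x => Re (Psi (RtoC (-1))) - B / r * Rabs (x + 1))).
    apply continuity_pt_minus; [apply continuity_pt_const; intros ? ?; easy|].
    apply continuity_pt_mult; [apply continuity_pt_const; intros ? ?; easy|].
    apply (continuity_pt_comp (fun x => x + 1) Rabs); [|apply Rcontinuity_abs].
    apply continuity_pt_plus; [apply continuity_pt_id|apply continuity_pt_const; intros ? ?; easy].
  - replace (Finite (Re (Psi (RtoC (-1))))) with (Finite (Re (Psi (RtoC (-1))) + B / r * Rabs (-1 + 1)))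
      by (f_equal; replace (-1 + 1) with 0 by ring; rewrite Rabs_R0; ring).
    apply (is_lim_continuity (fun x => Re (Psi (RtoC (-1))) + B / r * Rabs (x + 1))).
    apply continuity_pt_plus; [apply continuity_pt_const; intros ? ?; easy|].
    apply continuity_pt_mult; [apply continuity_pt_const; intros ? ?; easy|].
    apply (continuity_pt_comp (fun x => x + 1) Rabs); [|apply Rcontinuity_abs].
    apply continuity_pt_plus; [apply continuity_pt_id|apply continuity_pt_const; intros ? ?; easy].
Qed.

(** The difference quotient at [-1] contains [Psi x] multiplied by
    [x (x+1) (x+2) / (x+1)], so only the continuity of [Psi] at [-1] is needed. *)
Lemma zeta_derivative (zeta : C -> C) : is_riemann_zeta zeta ->
  Re (C_derive zeta (RtoC (-1))) = - / 6 + / 6 * Re (Psi (RtoC (-1))).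
Proof.
  intros Hz. destruct (zeta_defect_zero zeta Hz) as [r [Hr H]].
  assert (H6 : RtoC 6 <> 0) by (intros E'; apply RtoC_inj in E'; lra).
  assert (H12 : RtoC 12 <> 0) by (intros E'; apply RtoC_inj in E'; lra).
  assert (H20 : RtoC 2 <> 0) by (intros E'; apply RtoC_inj in E'; lra).
  assert (Hv : forall x, Rabs (x + 1) <= r -> x <> 1 ->
    zeta (RtoC x) = (1 / (RtoC x - 1) + / 2 + RtoC x / 12 - RtoC x * (RtoC x + 1) * (RtoC x + 2) / 6 * Psi (RtoC x))%C).
  { intros x Hx Hx1. assert (E := H (RtoC (x + 1)) ltac:(rewrite Cmod_R; easy)).
    replace (RtoC (-1) + RtoC (x + 1))%C with (RtoC x) in E by (rewrite <- RtoC_plus; f_equal; ring).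
    assert (Hx0 : (RtoC x - 1)%C <> 0).
    { rewrite <- RtoC_minus. intros E'. apply RtoC_inj in E'. lra. }
    unfold zeta_defect in E.
    match type of E with (?a * zeta ?s + ?b)%C = _ => 
      transitivity ((a * zeta s + b) / (RtoC x - 1) - b / (RtoC x - 1))%C; [field; easy|rewrite E; field; easy] end. }
  assert (H0 := Hv (-1) ltac:(replace (-1 + 1) with 0 by ring; rewrite Rabs_R0; lra) ltac:(lra)).
  unfold C_derive, C_lim. cbn [fst snd Re].
  rewrite (is_lim_unique _ (-1) (/ (2 * (-1 - 1)) + / 12 - (-1) * (-1 + 2) / 6 * Re (Psi (RtoC (-1))))).
  - unfold real, Re. field.
  - assert (Hm : 0 < Rmin r 1) by (apply Rmin_pos; lra).
    assert (Hq : forall x : R, Rabs (x - -1) < Rmin r 1 -> x <> -1 ->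
      / (2 * (x - 1)) + / 12 - x * (x + 2) / 6 * Re (Psi (RtoC x))
      = fst ((zeta (x, 0) - zeta (RtoC (-1))) / ((x, 0) - RtoC (-1)))%C).
    { intros x Hx Hx1.
      replace (x - -1) with (x + 1) in Hx by ring.
      assert (Hxr : Rabs (x + 1) < r) by (eapply Rlt_le_trans; [exact Hx|apply Rmin_l]).
      assert (Hx2 : Rabs (x + 1) < 1) by (eapply Rlt_le_trans; [exact Hx|apply Rmin_r]).
      apply Rabs_lt_between in Hx2.
      change (x, 0) with (RtoC x). 
      rewrite (Hv x) by lra. rewrite H0.
      assert (Hx0 : (RtoC x - 1)%C <> 0).
      { rewrite <- RtoC_minus. intros E'. apply RtoC_inj in E'. lra. }
      assert (Hx3 : (RtoC x + 1)%C <> 0).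
      { rewrite <- RtoC_plus. intros E'. apply RtoC_inj in E'. lra. }
      assert (Hm1 : RtoC (-1) = (- (1))%C) by (rewrite <- RtoC_opp; f_equal).
      transitivity (Re (RtoC (/ (2 * (x - 1)) + / 12) - RtoC (x * (x + 2) / 6) * Psi (RtoC x))%C).
      * generalize (Psi (RtoC x)). intros [p q]. unfold Re, Cminus, Copp, Cplus, Cmult, RtoC; simpl. ring.
      * unfold Re. f_equal.
        rewrite RtoC_plus, !RtoC_inv by lra. unfold Rdiv. rewrite !RtoC_mult, RtoC_inv, RtoC_plus, RtoC_minus by lra.
        rewrite !Hm1. field. repeat split; try easy.
        intros E'; apply Hx3; rewrite <- E'; ring.
    }
    apply (is_lim_ext_loc (fun x => / (2 * (x - 1)) + / 12 - x * (x + 2) / 6 * Re (Psi (RtoC x)))).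
    + exists (mkposreal _ Hm). intros x Hx Hx1. now apply Hq.
    + apply is_lim_minus'.
      * apply (is_lim_continuity (fun x => / (2 * (x - 1)) + / 12)).
        apply continuity_pt_filterlim, (ex_derive_continuous (fun x => / (2 * (x - 1)) + / 12)).
        auto_derive. lra.
      * apply (is_lim_mult _ _ _ (Finite _) (Finite _)); [|apply Psi_lim|easy].
        apply (is_lim_continuity (fun x => x * (x + 2) / 6)).
        apply continuity_pt_filterlim, (ex_derive_continuous (fun x => x * (x + 2) / 6)).
        auto_derive. easy.
Qed.

(** * The expansions of log G and its derivatives *)

Lemma bernoulli_1 : bernoulli 1 = - / 2.
Proof.
  assert (H := bernoulli_rec 0). simpl sum_f_R0 in H. rewrite bernoulli_0 in H.
  unfold Binomial.C in H. simpl in H. lra.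
Qed.

Lemma bernoulli_2 : bernoulli 2 = / 6.
Proof.
  assert (H := bernoulli_rec 1). simpl sum_f_R0 in H. rewrite bernoulli_0, bernoulli_1 in H.
  unfold Binomial.C in H. simpl in H. lra.
Qed.

Lemma V_0 (n : nat) : V n 0 = 0.
Proof. now rewrite V_vcoef. Qed.

Lemma V_3_1 : V 3 1 = 1.
Proof. rewrite V_vcoef. unfold vcoef. simpl. rewrite bernoulli_0. field. Qed.

Lemma V_2_1 : V 2 1 = 0.
Proof. rewrite V_vcoef. unfold vcoef. simpl. unfold Rdiv. ring. Qed.

Lemma V_1_1 : V 1 1 = - / 12.
Proof. rewrite V_vcoef. unfold vcoef. change (1 + 2 - 1)%nat with 2%nat. rewrite bernoulli_2. simpl. field. Qed.

(** The coefficient [c] of [1/z] is the one that does not come from [V n]: its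
    antiderivative is a logarithm, which is part of the explicit function
    subtracted in [F]. *)
Lemma expands_V_integrate (n : nat) (c : R) (F f : R -> R) :
  (forall z, 0 < z -> is_derive F z (f z - c * / z)) ->
  expands (V (S n)) f -> V (S n) 1 = c ->
  is_lim_seq (fun k => F (INR k)) 0 -> expands (V n) F.
Proof.
  intros HF Hf Hc Hlim.
  assert (Hg := expands_lincomb 1 (- c) _ _ _ _ Hf expands_inv).
  assert (H : expands (fun k => - (1 * V (S n) (S k) + - c * delta1 (S k)) / INR k) F).
  { apply (expands_integrate (fun k => 1 * V (S n) k + - c * delta1 k) F (fun z => 1 * f z + - c * / z)).
    - intros z Hz. replace (1 * f z + - c * / z) with (f z - c * / z) by ring. now apply HF.
    - rewrite V_0. unfold delta1; simpl. ring.
    - rewrite Hc. unfold delta1; simpl. ring.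
    - exact Hg.
    - exact Hlim. }
  revert H. apply expands_ext; [|easy]. intros k. destruct k as [|k].
  - rewrite Hc, V_0. unfold delta1; simpl. unfold Rdiv. ring.
  - rewrite V_derivative by lia. unfold delta1; simpl (S (S k) =? 1)%nat. cbv iota.
    field. apply not_0_INR; lia.
Qed.

Lemma expands_second : expands (V 2) (fun z => logG_der 2 z - ln z).
Proof.
  apply (expands_V_integrate 2 1 _ (logG_der 3)).
  - intros z Hz. apply (is_derive_minus (logG_der 2) ln); [now apply (is_derive_logG_der 2)|].
    auto_derive; [easy|ring].
  - now apply expands_logG_der.
  - apply V_3_1.
  - apply is_lim_seq_incr_1. exact second_der_at_integers.
Qed.

Lemma expands_first :
  expands (V 1) (fun z => logG_der 1 z - 1 / 2 * ln (2 * PI) - z * ln z + z).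
Proof.
  apply (expands_V_integrate 1 0 _ (fun z => logG_der 2 z - ln z)).
  - intros z Hz.
    apply (is_derive_ext (fun z => logG_der 1 z - (1 / 2 * ln (2 * PI) + z * ln z - z))).
    { intros t. match goal with |- @eq _ ?a ?b => change (@eq R a b) end. ring. }
    replace (logG_der 2 z - ln z - 0 * / z) with (logG_der 2 z - ln z) by ring.
    apply (is_derive_minus (logG_der 1) (fun z => 1 / 2 * ln (2 * PI) + z * ln z - z));
      [now apply (is_derive_logG_der 1)|].
    auto_derive; [easy|field; lra].
  - exact expands_second.
  - apply V_2_1.
  - apply is_lim_seq_incr_1. exact first_der_at_integers.
Qed.

(** At the integers, the explicit terms of [N log N!] and of [sum k log k] cancel
    against the subtracted function, which leaves
    [1/12 - 1/4 + Psi(-1)/6 - zeta'(-1) = 0]. *)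
Lemma expands_logG (zeta : C -> C) : is_riemann_zeta zeta ->
  expands (V 0) (fun z => logG_der 0 z - (Re (C_derive zeta (RtoC (-1))) + z / 2 * ln (2 * PI)
          + (z ^ 2 / 2 - 1 / 12) * ln z - 3 * z ^ 2 / 4)).
Proof.
  intros Hz.
  apply (expands_V_integrate 0 (- / 12) _ (fun z => logG_der 1 z - 1 / 2 * ln (2 * PI) - z * ln z + z)).
  - intros z Hz0.
    replace (_ - _) with (logG_der 1 z - (1 / 2 * ln (2 * PI) + z * ln z - z - / 12 * / z)) by ring.
    apply (is_derive_minus (logG_der 0) (fun z => Re (C_derive zeta (RtoC (-1))) + z / 2 * ln (2 * PI)
          + (z ^ 2 / 2 - 1 / 12) * ln z - 3 * z ^ 2 / 4)); [now apply (is_derive_logG_der 0)|].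
    generalize (Re (C_derive zeta (RtoC (-1)))). intros c.
    auto_derive; [easy|]. field. lra.
  - exact expands_first.
  - apply V_1_1.
  - apply is_lim_seq_incr_1, is_lim_seq_incr_1.
    destruct stirling as [K HK].
    apply (is_lim_seq_ext (fun n => INR (S (S n)) * stirling_error (S (S n))
      + (/ 12 - / 4 + / 6 * sum_f_R0 kinkelin_term n - Re (C_derive zeta (RtoC (-1)))))).
    + intros n. rewrite logG_integer, sum_k_ln_k_expansion. unfold stirling_error.
      assert (Hx := INR_S_ge1 (S n)). field. lra.
    + rewrite (zeta_derivative zeta Hz).
      replace (Finite 0) with (Finite (0 + (/ 12 - / 4 + / 6 * Re (Psi (RtoC (-1)))
         - (- / 6 + / 6 * Re (Psi (RtoC (-1))))))) by (f_equal; field).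
      apply is_lim_seq_plus'.
      * apply (is_lim_seq_incr_1 (fun n => INR (S n) * stirling_error (S n))).
        apply (is_lim_seq_of_bound _ _ K 0). intros n. assert (Hx := INR_S_ge1 n).
        rewrite Rminus_0_r, Rabs_mult, Rabs_right by lra.
        replace (K * / INR (S n) ^ 1) with (INR (S n) * (K * / INR (S n) ^ 2)) by (field; lra).
        apply Rmult_le_compat_l; [lra|apply HK].
      * apply is_lim_seq_minus'; [|apply is_lim_seq_const].
        apply is_lim_seq_plus'; [apply is_lim_seq_const|].
        apply (is_lim_seq_scal_l _ (/ 6) (Re (Psi (RtoC (-1)))) Re_Psi_kinkelin_sum).
Qed.

Theorem lemma4p2 (zeta : C -> C) (Hzeta : is_riemann_zeta zeta) :
  (forall z : R, 0 < z ->
     0 < barnesG (z + 1) /\ forall n : nat, ex_derive_n logG_succ n z) /\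
  asymptotic_expansion (V 0)
    (fun z => logG_succ z
       - (Re (C_derive zeta (RtoC (-1))) + z / 2 * ln (2 * PI)
          + (z ^ 2 / 2 - 1 / 12) * ln z - 3 * z ^ 2 / 4)) /\
  asymptotic_expansion (V 1)
    (fun z => Derive logG_succ z - 1 / 2 * ln (2 * PI) - z * ln z + z) /\
  asymptotic_expansion (V 2)
    (fun z => Derive_n logG_succ 2 z - ln z) /\
  (forall n : nat, (3 <= n)%nat ->
     asymptotic_expansion (V n) (fun z => Derive_n logG_succ n z)).
Proof.
  assert (HD : forall n z, 2 <= z -> logG_der n z = Derive_n logG_succ n z).
  { intros n z Hz. symmetry. apply Derive_n_logG_succ. lra. }
  repeat split.
  - rewrite barnesG_exp by lra. apply exp_pos.
  - intros n. now apply Derive_n_logG_succ.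
  - apply expands_asymptotic. generalize (expands_logG zeta Hzeta).
    apply expands_ext; [easy|]. intros z Hz. now rewrite HD.
  - apply expands_asymptotic. generalize expands_first.
    apply expands_ext; [easy|]. intros z Hz. now rewrite HD.
  - apply expands_asymptotic. generalize expands_second.
    apply expands_ext; [easy|]. intros z Hz. now rewrite HD.
  - intros n Hn. apply expands_asymptotic. generalize (expands_logG_der n Hn).
    apply expands_ext; [easy|]. intros z Hz. now rewrite HD.
Qed.
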